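(* Let $q\in(0,1)$ and let $n\ge 1$ be an integer. Let $C(\mathbb{B})_q$ be the $C^*$-algebra of the quantum unit ball, $J\subset C(\mathbb{B})_q$ the closed two-sided ideal generated by $1-\sum_{j=1}^n z_jz_j^*$, $C(\partial\mathbb{B})_q=C(\mathbb{B})_q/J$, and $j_q:C(\mathbb{B})_q\to C(\partial\mathbb{B})_q$ the canonical quotient homomorphism. Let $A(\mathbb{B})_q\subset C(\mathbb{B})_q$ be the closed unital subalgebra generated by $z_1,z_2,\ldots,z_n$. Then the restriction $j_{A(\mathbb{B})_q}=j_q|_{A(\mathbb{B})_q}:A(\mathbb{B})_q\to C(\partial\mathbb{B})_q$ is completely isometric, i.e. for every integer $m\ge 1$ and every matrix $(a_{ik})_{i,k=1}^m\in M_m(A(\mathbb{B})_q)$ one has $\|(j_q(a_{ik}))\|_{M_m(C(\partial\mathbb{B})_q)}=\|(a_{ik})\|_{M_m(C(\mathbb{B})_q)}$.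
   Context: The ground field is $\mathbb{C}$ and all algebras are unital; $q\in(0,1)$. $\operatorname{Pol}(\mathbb{C}^n)_q$ is the unital $*$-algebra given by generators $z_1,z_2,\ldots,z_n$ and the defining relations $$z_jz_k=qz_kz_j\quad (j<k),\qquad z_j^*z_k=qz_kz_j^*\quad (j\ne k),$$ $$z_j^*z_j=q^2z_jz_j^*+(1-q^2)\Bigl(1-\sum_{k>j}z_kz_k^*\Bigr).$$ For $f\in\operatorname{Pol}(\mathbb{C}^n)_q$ put $\|f\|=\sup_T\|T(f)\|$, where $T$ runs over the irreducible $*$-representations of $\operatorname{Pol}(\mathbb{C}^n)_q$ by bounded operators on Hilbert spaces. It is known that $0<\|f\|<\infty$ for every nonzero $f$. The $C^*$-algebra $C(\mathbb{B})_q$ is the $C^*$-enveloping algebra of $\operatorname{Pol}(\mathbb{C}^n)_q$, i.e. its completion with respect to this norm. The matrix algebras $M_m(C(\mathbb{B})_q)$ and $M_m(C(\partial\mathbb{B})_q)$ carry their unique $C^*$-norms. *)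

(* Defs.v *)
From HB Require Import structures.
From mathcomp Require Import all_boot all_order all_algebra.
From mathcomp Require Import generic_quotient.
From mathcomp Require Import all_classical all_reals all_analysis.
From mathcomp Require Import complex.
Set Implicit Arguments.
Unset Strict Implicit.
Unset Printing Implicit Defensive.
Import Order.TTheory GRing.Theory Num.Theory.
Import numFieldNormedType.Exports.
Local Open Scope classical_set_scope.
Local Open Scope ring_scope.
Local Open Scope quotient_scope.

HB.mixin Record hasStar (K : numClosedFieldType) A of GRing.Algebra K A := {
  star : A -> A ;
  starK : involutive star ;
  starD : {morph star : x y / x + y} ;
  starM : forall x y, star (x * y) = star y * star x ;
  starZ : forall (c : K) x, star (c *: x) = c^* *: star x
}.

#[short(type="starAlgType")]
HB.structure Definition StarAlgebra (K : numClosedFieldType) :=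
  {A of GRing.Algebra K A & hasStar K A}.

Section Norms.
Context {R : realType}.
Local Notation C := R[i].

(* The modulus of a complex number, or the norm of a [normedModType R[i]]: a
   real element of [R[i]] in the library, read here in [R]. *)
Definition rnorm {V : normedZmodType C} (x : V) : R := complex.Re `|x|.

(* [N] makes [V], with the given *-algebra operations, a C*-algebra. *)
Record cstar_norm (V : zmodType) (scale : C -> V -> V) (mul : V -> V -> V)
    (st : V -> V) (N : V -> R) : Prop := CstarNorm {
  cstar_norm_ge0 : forall x, 0 <= N x ;
  cstar_norm_eq0 : forall x, N x = 0 -> x = 0 ;
  cstar_normD : forall x y, N (x + y) <= N x + N y ;
  cstar_normZ : forall c x, N (scale c x) = rnorm c * N x ;
  cstar_normM : forall x y, N (mul x y) <= N x * N y ;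
  cstar_normE : forall x, N (mul (st x) x) = N x ^+ 2 ;
  cstar_norm_complete : forall u : nat -> V,
    (forall e, 0 < e ->
      exists k, forall i j, (k <= i)%N -> (k <= j)%N -> N (u i - u j) < e) ->
    exists l, forall e, 0 < e ->
      exists k, forall i, (k <= i)%N -> N (u i - l) < e
}.

End Norms.

(* The library norm cannot be used here: no structure can join [algType] with
   [normedModType] once [numDomainType] has been declared. *)
HB.mixin Record hasCstarNorm (R : realType) A of StarAlgebra R[i] A := {
  cnorm : A -> R ;
  cnormP : cstar_norm (@GRing.scale R[i] A) *%R star cnorm
}.

#[short(type="cstarAlgType")]
HB.structure Definition CstarAlgebra (R : realType) :=
  {A of StarAlgebra R[i] A & hasCstarNorm R A}.

(* The coefficientwise scaling: ['M[A]_m] is a library module over [A] only. *)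
Definition cstar_mxnorm (R : realType) (A : starAlgType R[i]) m
    (N : 'M[A]_m -> R) : Prop :=
  cstar_norm (fun c : R[i] => map_mx ( *:%R c)) mulmx
    (fun x => map_mx star x^T) N.

Section ClosedSubobjects.
Context {R : realType} {A : cstarAlgType R}.

Definition cclosure (S : set A) : set A :=
  [set x | forall e, 0 < e -> exists2 y, S y & cnorm (x - y) < e].

Definition cclosed (S : set A) : Prop := cclosure S `<=` S.

(* Stability under scalars is a consequence, as [A] is unital. *)
Definition closed_ideal (I : set A) : Prop :=
  [/\ cclosed I, I 0,
      forall x y, I x -> I y -> I (x + y),
      forall a x, I x -> I (a * x) &
      forall a x, I x -> I (x * a)].

Definition closed_subalg (S : set A) : Prop :=
  [/\ cclosed S, S 1,
      forall x y, S x -> S y -> S (x + y),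
      forall (c : R[i]) x, S x -> S (c *: x) &
      forall x y, S x -> S y -> S (x * y)].

Definition gen_closed_ideal (X : set A) : set A := smallest closed_ideal X.
Definition gen_closed_subalg (X : set A) : set A := smallest closed_subalg X.

End ClosedSubobjects.

Section Representations.
Context {R : realType}.

(* [{dot _ for _}] is linear in its left argument. *)
Record hilbertType := Hilbert {
  hilbert_sort :> completeNormedModType R[i] ;
  hdot : {dot hilbert_sort for (Num.conj : R[i] -> R[i])} ;
  hdot_norm : forall x, hdot x x = `|x| ^+ 2
}.

Definition opnorm {H : hilbertType} (T : H -> H) : \bar R :=
  ereal_sup [set (rnorm (T x))%:E | x in [set x | rnorm x <= 1]].

Record starrep (P : starAlgType R[i]) (H : hilbertType) (T : P -> H -> H)
    : Prop := Starrep {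
  starrep_linear : forall f, linear (T f) ;
  starrep_bounded : forall f, exists M : R, forall x,
    rnorm (T f x) <= M * rnorm x ;
  starrepD : forall f g x, T (f + g) x = T f x + T g x ;
  starrepZ : forall c f x, T (c *: f) x = c *: T f x ;
  starrep1 : forall x, T 1 x = x ;
  starrepM : forall f g x, T (f * g) x = T f (T g x) ;
  starrep_adj : forall f x y, hdot H (T f x) y = hdot H x (T (star f) y)
}.

Definition closed_subspace {H : hilbertType} (V : set H) : Prop :=
  [/\ closed V, V 0,
      forall x y, V x -> V y -> V (x + y) &
      forall (c : R[i]) x, V x -> V (c *: x)].

Definition irreducible (P : starAlgType R[i]) (H : hilbertType)
    (T : P -> H -> H) : Prop :=
  (exists x : H, x != 0) /\
  forall V : set H, closed_subspace V ->
    (forall f x, V x -> V (T f x)) -> V = [set 0] \/ V = [set: H].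

Definition envnorm {P : starAlgType R[i]} (f : P) : \bar R :=
  ereal_sup [set r | exists (H : hilbertType) (T : P -> H -> H),
    [/\ starrep T, irreducible T & r = opnorm (T f)]].

(* [iota] exhibits [A] as the completion of [P] for [envnorm]. *)
Record cstar_envelope (P : starAlgType R[i]) (A : cstarAlgType R)
    (iota : P -> A) : Prop := CstarEnvelope {
  envelope_star : forall f, iota (star f) = star (iota f) ;
  envelope_norm : forall f, (cnorm (iota f))%:E = envnorm f ;
  envelope_dense : cclosure (range iota) = [set: A]
}.

(* [j] exhibits [Q] as [A / J] with the quotient norm. *)
Record cstar_quotient (A Q : cstarAlgType R) (J : set A) (j : A -> Q)
    : Prop := CstarQuotient {
  quotient_star : forall x, j (star x) = star (j x) ;
  quotient_surj : forall y, exists x, j x = y ;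
  quotient_ker : forall x, j x = 0 <-> J x ;
  quotient_norm : forall x, cnorm (j x) = inf [set cnorm (x + y) | y in J]
}.

End Representations.
Arguments hilbertType : clear implicits.

(* Pol(C^n)_q : *-polynomial expressions modulo the congruence generated by the
   axioms of unital *-algebras and the defining relations. *)
Inductive qterm (R : realType) (n : nat) : Type :=
| QGen of 'I_n
| QScal of R[i]
| QAdd of qterm R n & qterm R n
| QMul of qterm R n & qterm R n
| QStar of qterm R n.
Arguments QGen {R n}.
Arguments QScal {R n}.
Arguments QAdd {R n}.
Arguments QMul {R n}.
Arguments QStar {R n}.

HB.instance Definition _ (R : realType) n := gen_eqMixin (qterm R n).
HB.instance Definition _ (R : realType) n := gen_choiceMixin (qterm R n).

Section QCong.
Local Open Scope complex_scope.
Context {R : realType} (q : R) (n : nat).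
Local Notation C := R[i].
Local Notation z := (@QGen R n).
Local Notation s := (@QScal R n).
Local Infix "⊕" := QAdd (at level 50, left associativity).
Local Infix "⊗" := QMul (at level 40, left associativity).
Local Notation "x ^⋆" := (QStar x) (at level 2, format "x ^⋆").

Inductive qcong : qterm R n -> qterm R n -> Prop :=
| qrefl x : qcong x x
| qsym x y : qcong x y -> qcong y x
| qtrans x y t : qcong x y -> qcong y t -> qcong x t
| qcongD x x' y y' : qcong x x' -> qcong y y' -> qcong (x ⊕ y) (x' ⊕ y')
| qcongM x x' y y' : qcong x x' -> qcong y y' -> qcong (x ⊗ y) (x' ⊗ y')
| qcongS x x' : qcong x x' -> qcong x^⋆ x'^⋆
| qaddA x y t : qcong (x ⊕ (y ⊕ t)) (x ⊕ y ⊕ t)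
| qaddC x y : qcong (x ⊕ y) (y ⊕ x)
| qadd0 x : qcong (s 0 ⊕ x) x
| qmulA x y t : qcong (x ⊗ (y ⊗ t)) (x ⊗ y ⊗ t)
| qmul1 x : qcong (s 1 ⊗ x) x
| qmul0 x : qcong (s 0 ⊗ x) (s 0)
| qmulDl x y t : qcong ((x ⊕ y) ⊗ t) ((x ⊗ t) ⊕ (y ⊗ t))
| qmulDr x y t : qcong (t ⊗ (x ⊕ y)) ((t ⊗ x) ⊕ (t ⊗ y))
| qscalD a b : qcong (s (a + b)) (s a ⊕ s b)
| qscalM a b : qcong (s (a * b)) (s a ⊗ s b)
| qscalC a x : qcong (s a ⊗ x) (x ⊗ s a)
| qstarK x : qcong x^⋆^⋆ x
| qstarD x y : qcong (x ⊕ y)^⋆ (x^⋆ ⊕ y^⋆)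
| qstarM x y : qcong (x ⊗ y)^⋆ (y^⋆ ⊗ x^⋆)
| qstar_scal a : qcong (s a)^⋆ (s a^*)
| qrel_zz (j k : 'I_n) : (j < k)%N ->
    qcong (z j ⊗ z k) (s q%:C ⊗ (z k ⊗ z j))
| qrel_sz (j k : 'I_n) : j != k ->
    qcong ((z j)^⋆ ⊗ z k) (s q%:C ⊗ (z k ⊗ (z j)^⋆))
| qrel_ss (j : 'I_n) :
    qcong ((z j)^⋆ ⊗ z j)
      ((s (q ^+ 2)%:C ⊗ (z j ⊗ (z j)^⋆)) ⊕
       (s (1 - q ^+ 2)%:C ⊗
         (s 1 ⊕ (s (-1) ⊗
           \big[QAdd/s 0]_(k < n | (j < k)%N) (z k ⊗ (z k)^⋆))))).

Definition qcongb (x y : qterm R n) : bool := `[< qcong x y >].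

Lemma qcongb_refl : reflexive qcongb.
Proof. by move=> x; apply/asboolP/qrefl. Qed.
Lemma qcongb_sym : symmetric qcongb.
Proof. by move=> x y; apply/asboolP/asboolP => /qsym. Qed.
Lemma qcongb_trans : transitive qcongb.
Proof.
by move=> y x t /asboolP xy /asboolP yt; apply/asboolP/(qtrans xy).
Qed.
Canonical qcong_equiv := EquivRel qcongb qcongb_refl qcongb_sym qcongb_trans.

Definition Pol := {eq_quot qcong_equiv}.
HB.instance Definition _ := Choice.on Pol.
HB.instance Definition _ := EqQuotient.on Pol.

Implicit Types f g h : Pol.
Local Notation cl := (\pi_(Pol) : qterm R n -> Pol).

Lemma polP x y : cl x = cl y <-> qcong x y.
Proof.
split; first by move/eqmodP/asboolP.
by move=> xy; apply/eqmodP/asboolP.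
Qed.

Definition pol_scal (a : C) : Pol := cl (s a).
Definition pol_add f g : Pol := cl (repr f ⊕ repr g).
Definition pol_mul f g : Pol := cl (repr f ⊗ repr g).
Definition pol_star f : Pol := cl (repr f)^⋆.

Lemma polD x y : pol_add (cl x) (cl y) = cl (x ⊕ y).
Proof. by apply/polP/qcongD; apply/polP; rewrite reprK. Qed.
Lemma polM x y : pol_mul (cl x) (cl y) = cl (x ⊗ y).
Proof. by apply/polP/qcongM; apply/polP; rewrite reprK. Qed.
Lemma polS x : pol_star (cl x) = cl x^⋆.
Proof. by apply/polP/qcongS/polP; rewrite reprK. Qed.

Lemma pol_ind (Q : Pol -> Prop) : (forall x, Q (cl x)) -> forall f, Q f.
Proof. by move=> H f; rewrite -[f]reprK. Qed.

Fact pol_addA : associative pol_add.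
Proof.
by do 3![elim/pol_ind => ?]; rewrite !polD; apply/polP/qaddA.
Qed.
Fact pol_addC : commutative pol_add.
Proof. by do 2![elim/pol_ind => ?]; rewrite !polD; apply/polP/qaddC. Qed.
Fact pol_add0 : left_id (pol_scal 0) pol_add.
Proof. by elim/pol_ind => ?; rewrite polD; apply/polP/qadd0. Qed.
Fact pol_mulA : associative pol_mul.
Proof.
by do 3![elim/pol_ind => ?]; rewrite !polM; apply/polP/qmulA.
Qed.
Fact pol_mul1l : left_id (pol_scal 1) pol_mul.
Proof. by elim/pol_ind => ?; rewrite polM; apply/polP/qmul1. Qed.
Fact pol_scalC a f : pol_mul (pol_scal a) f = pol_mul f (pol_scal a).
Proof. by elim/pol_ind: f => ?; rewrite !polM; apply/polP/qscalC. Qed.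
Fact pol_mul1r : right_id (pol_scal 1) pol_mul.
Proof. by move=> f; rewrite -pol_scalC pol_mul1l. Qed.
Fact pol_mulDl : left_distributive pol_mul pol_add.
Proof.
by do 3![elim/pol_ind => ?]; rewrite !(polM, polD); apply/polP/qmulDl.
Qed.
Fact pol_mulDr : right_distributive pol_mul pol_add.
Proof.
by do 3![elim/pol_ind => ?]; rewrite !(polM, polD); apply/polP/qmulDr.
Qed.
Fact pol_mul0 f : pol_mul (pol_scal 0) f = pol_scal 0.
Proof. by elim/pol_ind: f => ?; rewrite polM; apply/polP/qmul0. Qed.
Fact pol_scalD a b : pol_scal (a + b) = pol_add (pol_scal a) (pol_scal b).
Proof. by rewrite polD; apply/polP/qscalD. Qed.
Fact pol_scalM a b : pol_scal (a * b) = pol_mul (pol_scal a) (pol_scal b).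
Proof. by rewrite polM; apply/polP/qscalM. Qed.

Definition pol_opp f := pol_mul (pol_scal (-1)) f.
Fact pol_addN : left_inverse (pol_scal 0) pol_opp pol_add.
Proof.
by move=> f; rewrite -{2}[f]pol_mul1l -pol_mulDl -pol_scalD addNr pol_mul0.
Qed.

(* 1 != 0, as needed for [algType]: the *-character z_(n-1) |-> 1 (indices
   starting at 0), all other generators being mapped to 0. *)
Fixpoint qchar (x : qterm R n) : C :=
  match x with
  | QGen j => (j.+1 == n)%:R
  | QScal a => a
  | QAdd x y => qchar x + qchar y
  | QMul x y => qchar x * qchar y
  | QStar x => (qchar x)^*
  end.

Lemma qchar_big (P : pred 'I_n) :
  qchar (\big[QAdd/s 0]_(k < n | P k) (z k ⊗ (z k)^⋆)) =
  \sum_(k < n | P k) (k.+1 == n)%:R.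
Proof.
rewrite (big_morph qchar (id1 := 0) (op1 := +%R)) //=.
by apply: eq_bigr => k _; case: eqP => _; rewrite ?mul0r // conjc_nat mul1r.
Qed.

Lemma qchar_cong x y : qcong x y -> qchar x = qchar y.
Proof.
elim=> //= {x y}.
- by move=> x y t _ -> _ ->.
- by move=> x x' y y' _ -> _ ->.
- by move=> x x' y y' _ -> _ ->.
- by move=> x x' _ ->.
- by move=> *; rewrite addrA.
- by move=> *; rewrite addrC.
- by move=> *; rewrite add0r.
- by move=> *; rewrite mulrA.
- by move=> *; rewrite mul1r.
- by move=> *; rewrite mul0r.
- by move=> *; rewrite mulrDl.
- by move=> *; rewrite mulrDr.
- by move=> *; rewrite mulrC.
- by move=> x; rewrite conjcK.
- by move=> *; rewrite rmorphD.
- by move=> *; rewrite rmorphM mulrC.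
- move=> j k jk; have -> : (j.+1 == n) = false.
    by rewrite ltn_eqF // (leq_ltn_trans jk).
  by rewrite mul0r mulr0 mulr0.
- move=> j k jk; case: (j.+1 =P n) => [jn|_]; last first.
    by rewrite conjc_nat mul0r !mulr0.
  case: (k.+1 =P n) => [kn|_]; last by rewrite mul0r !mulr0.
  by case/eqP: jk; apply/val_inj/succn_inj; rewrite jn kn.
- move=> j; rewrite qchar_big conjc_nat; case: (j.+1 =P n) => [jn|/eqP jn].
    rewrite big_pred0 => [|k]; last by rewrite ltnNge -ltnS jn ltn_ord.
    by rewrite mulr0 addr0 !mulr1 -rmorphD /= addrC subrK.
  have lt_j : (j.+1 < n)%N by rewrite ltn_neqAle jn ltn_ord.
  have lt_m : (n.-1 < n)%N by rewrite prednK // (leq_trans _ lt_j).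
  rewrite (bigD1 (Ordinal lt_m)) /=; last by rewrite -ltnS prednK // (leq_trans _ lt_j).
  rewrite prednK ?(leq_trans _ lt_j) // eqxx big1 => [|k /andP[_ kn]].
    by rewrite addr0 mulN1r subrr mul0r !mulr0 addr0.
  case: eqP => // kn'; case/eqP: kn; apply/val_inj => /=.
  by move/(congr1 predn): kn'.
Qed.

Fact pol_oner_neq0 : pol_scal 1 != pol_scal 0.
Proof. by apply/eqP => /polP/qchar_cong/= /eqP; rewrite oner_eq0. Qed.

HB.instance Definition _ := GRing.isZmodule.Build Pol
  pol_addA pol_addC pol_add0 pol_addN.
HB.instance Definition _ := GRing.Zmodule_isNzRing.Build Pol
  pol_mulA pol_mul1l pol_mul1r pol_mulDl pol_mulDr pol_oner_neq0.

Definition pol_scale (a : C) f : Pol := pol_mul (pol_scal a) f.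
Fact pol_scaleA a b f : pol_scale a (pol_scale b f) = pol_scale (a * b) f.
Proof. by rewrite /pol_scale pol_mulA pol_scalM. Qed.
Fact pol_scale1 : left_id 1 pol_scale.
Proof. exact: pol_mul1l. Qed.
Fact pol_scaleDr : right_distributive pol_scale +%R.
Proof. by move=> a f g; apply: pol_mulDr. Qed.
Fact pol_scaleDl f : {morph pol_scale^~ f : a b / a + b}.
Proof. by move=> a b; rewrite /pol_scale pol_scalD; apply: pol_mulDl. Qed.
HB.instance Definition _ := GRing.Zmodule_isLmodule.Build C Pol
  pol_scaleA pol_scale1 pol_scaleDr pol_scaleDl.

Fact pol_scaleAl (a : C) (f g : Pol) : a *: (f * g) = (a *: f) * g.
Proof. exact: pol_mulA. Qed.
HB.instance Definition _ := GRing.Lmodule_isLalgebra.Build C Pol pol_scaleAl.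
Fact pol_scaleAr (a : C) (f g : Pol) : a *: (f * g) = f * (a *: g).
Proof.
by rewrite -[RHS]/(pol_mul f (pol_mul _ g)) pol_mulA -pol_scalC -pol_mulA.
Qed.
HB.instance Definition _ := GRing.Lalgebra_isAlgebra.Build C Pol pol_scaleAr.

Fact pol_starK : involutive pol_star.
Proof. by elim/pol_ind => ?; rewrite !polS; apply/polP/qstarK. Qed.
Fact pol_starD : {morph pol_star : f g / f + g}.
Proof.
by do 2![elim/pol_ind => ?]; rewrite -[LHS]/(pol_star (pol_add _ _))
  -[RHS]/(pol_add _ _) !(polD, polS); apply/polP/qstarD.
Qed.
Fact pol_starM (f g : Pol) : pol_star (f * g) = pol_star g * pol_star f.
Proof.
elim/pol_ind: f => x; elim/pol_ind: g => y.
by rewrite -[LHS]/(pol_star (pol_mul _ _)) -[RHS]/(pol_mul _ _) !(polM, polS);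
  apply/polP/qstarM.
Qed.
Fact pol_starZ (a : C) (f : Pol) : pol_star (a *: f) = a^* *: pol_star f.
Proof.
have -> : a *: f = (pol_scal a : Pol) * f by [].
rewrite pol_starM -[LHS]/(pol_mul _ _) [X in pol_mul _ X]polS.
have /polP -> := qstar_scal a.
by rewrite -pol_scalC.
Qed.
HB.instance Definition _ := hasStar.Build C Pol
  pol_starK pol_starD pol_starM pol_starZ.

Definition pol_z (j : 'I_n) : Pol := cl (z j).

Lemma pi_D x y : cl x + cl y = cl (x ⊕ y). Proof. exact: polD. Qed.
Lemma pi_M x y : cl x * cl y = cl (x ⊗ y). Proof. exact: polM. Qed.
Lemma pi_Z a x : a *: cl x = cl (s a ⊗ x). Proof. exact: polM. Qed.
Lemma pi_S x : star (cl x) = cl x^⋆. Proof. exact: polS. Qed.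

Lemma pol_z_mul (j k : 'I_n) : (j < k)%N ->
  pol_z j * pol_z k = q%:C *: (pol_z k * pol_z j).
Proof. by move=> jk; rewrite /pol_z !pi_M pi_Z; apply/polP/qrel_zz. Qed.

Lemma pol_star_z_mul (j k : 'I_n) : j != k ->
  star (pol_z j) * pol_z k = q%:C *: (pol_z k * star (pol_z j)).
Proof.
by move=> jk; rewrite /pol_z pi_S !pi_M pi_Z; apply/polP/qrel_sz.
Qed.

Lemma pol_star_z_z (j : 'I_n) :
  star (pol_z j) * pol_z j =
  (q ^+ 2)%:C *: (pol_z j * star (pol_z j)) +
  (1 - q ^+ 2)%:C *:
    (1 - \sum_(k < n | (j < k)%N) pol_z k * star (pol_z k)).
Proof.
have -> : \sum_(k < n | (j < k)%N) pol_z k * star (pol_z k) =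
    cl (\big[QAdd/s 0]_(k < n | (j < k)%N) (z k ⊗ (z k)^⋆)).
  rewrite (big_morph cl (id1 := 0) (op1 := +%R)) //; last first.
    by move=> x y; rewrite pi_D.
  by apply: eq_bigr => k _; rewrite /pol_z pi_S pi_M.
set S := \big[_/_]_(_ < _ | _) _; have -> : 1 - cl S = cl (s 1 ⊕ (s (-1) ⊗ S)).
  by rewrite -[- cl S]scaleN1r (pi_Z (-1) S) (pi_D (s 1) (s (-1) ⊗ S)).
rewrite /pol_z pi_S (pi_M (z j)^⋆ (z j)) (pi_M (z j) (z j)^⋆).
rewrite (pi_Z _ (z j ⊗ (z j)^⋆)) (pi_Z _ (s 1 ⊕ (s (-1) ⊗ S))).
rewrite (pi_D (_ ⊗ _) (_ ⊗ _)).
exact/polP/qrel_ss.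
Qed.

End QCong.

(* Main.v *)
Require Import Defs.
From HB Require Import structures.
From mathcomp Require Import all_boot all_order all_algebra.
From mathcomp Require Import generic_quotient.
From mathcomp Require Import all_classical all_reals all_analysis.
From mathcomp Require Import complex ring lra.
Set Implicit Arguments.
Unset Strict Implicit.
Unset Printing Implicit Defensive.
Import Order.TTheory GRing.Theory Num.Theory.
Import numFieldNormedType.Exports.
Local Open Scope classical_set_scope.
Local Open Scope ring_scope.

(* An irreducible representation of Pol(C^n)_q on which X = 1 - sum_k z_k z_k^*
   does not vanish contains a vacuum vector and thus a positive square root N of
   X acting as q^d on the span of the monomials of degree d.  Let z denote the
   first generator: it commutes with X up to q^2 and H is the closed span of the
   orthogonal spaces z^k (ker z^* ).  For |u| = 1, replacing z by u N and keeping the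
   other generators gives an irreducible representation of Pol(C^n)_q on ker z^*
   which annihilates X.  Relative to the decomposition of H, z acts as a weighted
   shift tensored with N, and a Schur multiplier compresses the unweighted
   shift to it; approximating the latter by circulant matrices and diagonalising
   those by a finite Fourier transform bounds the norm of a matrix of
   holomorphic polynomials by its norms for u a root of unity.  Irreducible
   representations annihilating X factor through C(dB)_q.  Everything is
   transported to the abstract C*-norms by the fact that a complete C*-norm
   dominates every C*-seminorm. *)

Local Open Scope complex_scope.

(** * Norms over the complex numbers *)

(** No functional calculus enters. Since z_k^* X = q^2 X z_k^* , a bound on X known at all vectors
    z_k^* x returns at x with its constant multiplied by q^2; iteration proves X >= 0 and, when
    there is no vacuum, X = 0. With a vacuum, the commutator of z^* and z is (1 - q^2) X, whence
    |z^k w|^2 = g_k |N^k w|^2 for w in ker z^* , where g_k = (1 - q^2)...(1 - q^(2k)). A word in the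
    generators with c letters z sends z^j w to level k = j + c, and its coefficient against z^k w'
    is g_k times that of the replaced word between N^j w and N^k w' at u = 1. As j <= k, this factor
    is g_max(j,k) = g_j g_k / g_min(j,k): a positive multiplier, because 1/g increases with
    increments q^(2l)/g_l. On the diagonal it is the weight of the norm, so the dilation is
    isometric. For words mixing z and z^* the coefficients no longer have this form, hence the
    restriction to holomorphic polynomials. On finitely supported vectors an average over enough
    roots of unity is exact, so the only limit left is density. *)

Lemma ler_addeps_mul (R : realType) (a b K : R) :
  (forall e, 0 < e -> a <= b + e * K) -> a <= b.
Proof.
move=> h; rewrite leNgt; apply/negP => ba.
have K1 : 0 < `|K| + 1 by rewrite ltr_wpDl.
have /h : 0 < (a - b) / (`|K| + 1) / 2 by rewrite !divr_gt0 ?subr_gt0.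
apply/negP; rewrite -ltNge -ltrBrDl.
apply: (@le_lt_trans _ _ ((a - b) / 2 * (`|K| / (`|K| + 1)))).
  have -> : (a - b) / (`|K| + 1) / 2 * K = (a - b) / 2 * (K / (`|K| + 1)) by ring.
  rewrite ler_wpM2l ?divr_ge0 ?subr_ge0 ?(ltW ba) //.
  by rewrite ler_wpM2r ?invr_ge0 ?(ltW K1) // ler_norm.
have h1 : `|K| / (`|K| + 1) <= 1 by rewrite ler_pdivrMr // mul1r lerDl.
apply: (@le_lt_trans _ _ ((a - b) / 2 * 1)).
  by rewrite ler_wpM2l // divr_ge0 ?subr_ge0 // ltW.
by rewrite mulr1 gtr_pMr ?subr_gt0 // invf_lt1 // ltr1n.
Qed.

Section RealComplex.
Context {R : realType}.
Implicit Types a b : R.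

Lemma rcD a b : (a + b)%:C = a%:C + b%:C. Proof. exact: rmorphD. Qed.
Lemma rcB a b : (a - b)%:C = a%:C - b%:C. Proof. exact: rmorphB. Qed.
Lemma rcM a b : (a * b)%:C = a%:C * b%:C. Proof. exact: rmorphM. Qed.
Lemma rcX a k : (a ^+ k)%:C = a%:C ^+ k. Proof. exact: rmorphXn. Qed.
Lemma rcV a : (a^-1)%:C = (a%:C)^-1. Proof. exact: fmorphV. Qed.
Lemma rcnat k : (k%:R : R)%:C = k%:R. Proof. exact: rmorph_nat. Qed.
Lemma rc_sum I (r : seq I) (P : pred I) (F : I -> R) :
  (\sum_(i <- r | P i) F i)%:C = \sum_(i <- r | P i) (F i)%:C.
Proof. exact: rmorph_sum. Qed.
Lemma rc_conj a : ((a%:C)^*)%R = a%:C. Proof. exact: conjc_real. Qed.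

End RealComplex.

Section Rnorm.
Context {R : realType}.
Local Notation C := R[i].

Lemma rnormE (V : normedZmodType C) (x : V) : (rnorm x)%:C = `|x|.
Proof. by apply: RRe_real; rewrite ger0_real. Qed.

Lemma rnorm_ge0 (V : normedZmodType C) (x : V) : 0 <= rnorm x.
Proof. by rewrite -ler0c rnormE. Qed.
Hint Extern 0 (is_true (0 <= rnorm _)) => exact: rnorm_ge0 : core.

Lemma rnormD (V : normedZmodType C) (x y : V) : rnorm (x + y) <= rnorm x + rnorm y.
Proof. by rewrite -lecR rmorphD /= !rnormE ler_normD. Qed.

Lemma rnormN (V : normedZmodType C) (x : V) : rnorm (- x) = rnorm x.
Proof. by rewrite /rnorm normrN. Qed.

Lemma rnormB (V : normedZmodType C) (x y : V) : rnorm (x - y) = rnorm (y - x).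
Proof. by rewrite /rnorm distrC. Qed.

Lemma rnorm_dist (V : normedZmodType C) (y x z : V) :
  rnorm (x - z) <= rnorm (x - y) + rnorm (y - z).
Proof. by rewrite -[x - z](subrKA y) rnormD. Qed.

Lemma rnorm0 (V : normedZmodType C) : rnorm (0 : V) = 0.
Proof. by rewrite /rnorm normr0. Qed.

Lemma rnorm0_eq0 (V : normedZmodType C) (x : V) : rnorm x = 0 -> x = 0.
Proof. by move=> x0; apply/normr0_eq0; rewrite -rnormE x0. Qed.

Lemma rnorm_sum (V : normedZmodType C) I (r : seq I) (P : pred I) (F : I -> V) :
  rnorm (\sum_(i <- r | P i) F i) <= \sum_(i <- r | P i) rnorm (F i).
Proof. by rewrite -lecR rmorph_sum /= rnormE (le_trans (ler_norm_sum _ _ _)) // ler_sum => // i _; rewrite rnormE. Qed.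

Lemma rnormM (a b : C) : rnorm (a * b) = rnorm a * rnorm b.
Proof. by apply: complexI; rewrite rmorphM /= !rnormE normrM. Qed.

Lemma rnormZ (V : normedModType C) (c : C) (x : V) : rnorm (c *: x) = rnorm c * rnorm x.
Proof. by apply: complexI; rewrite rmorphM /= !rnormE normrZ. Qed.

Lemma rnorm_real (r : R) : rnorm (r%:C : C) = `|r|.
Proof. by rewrite /rnorm normc_def /= expr0n /= addr0 sqrtr_sqr. Qed.

Lemma rnorm1 : rnorm (1 : C) = 1.
Proof. by rewrite /rnorm normr1. Qed.

Lemma rnorm_conj (c : C) : rnorm (c^*)%R = rnorm c.
Proof. by rewrite /rnorm norm_conjC. Qed.

Lemma rnorm_le_eps (V : normedZmodType C) (x : V) K :
  (forall e, 0 < e -> rnorm x <= e * K) -> x = 0.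
Proof.
move=> h; apply: rnorm0_eq0; apply/eqP; rewrite eq_le rnorm_ge0 andbT.
by apply: (@ler_addeps_mul _ _ _ K) => e /h; rewrite add0r.
Qed.

Lemma Re_le_rnorm (c : C) : complex.Re c <= rnorm c.
Proof.
by rewrite -lecR rnormE (le_trans _ (normc_ge_Re c)) // lecR ler_norm.
Qed.

Lemma sqr_rnorm (c : C) : ((rnorm c ^+ 2)%:C : C) = (c * c^*)%R.
Proof. by rewrite rmorphXn /= rnormE normCK. Qed.

End Rnorm.
#[export] Hint Extern 0 (is_true (0 <= rnorm _)) => exact: rnorm_ge0 : core.

Section Closure.
Context {R : realType} {V : normedModType R[i]}.

Lemma closureP_rnorm (S : set V) x :
  closure S x <-> forall e, 0 < e -> exists2 y, S y & rnorm (x - y) < e.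
Proof.
split=> [cx e e0|h].
  have e0' : (0 < e%:C)%R by rewrite ltcR.
  have [y [Sy]] := cx _ (nbhsx_ballx x e%:C e0').
  rewrite -ball_normE /= => xy; exists y => //.
  by rewrite -ltcR rnormE.
move=> B /nbhs_ballP [d /= d0 dB].
have dE : (complex.Re d)%:C = d by apply: RRe_real; rewrite gtr0_real.
have [|y Sy xy] := h (complex.Re d); first by rewrite -ltcR dE.
exists y; split=> //; apply: dB; rewrite -ball_normE /=.
by rewrite -rnormE -dE ltcR.
Qed.

Lemma closedP_rnorm (S : set V) :
  closed S <-> forall x, (forall e, 0 < e -> exists2 y, S y & rnorm (x - y) < e) -> S x.
Proof.
split=> [cS x /closureP_rnorm|h]; first by rewrite -(closure_id S).1.
by move=> x /closureP_rnorm; exact: h.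
Qed.

End Closure.

Lemma rnorm_complete (R : realType) (V : completeNormedModType R[i]) (u : nat -> V) :
  (forall e, 0 < e ->
    exists k, forall i j, (k <= i)%N -> (k <= j)%N -> rnorm (u i - u j) < e) ->
  exists l, forall e, 0 < e -> exists k, forall i, (k <= i)%N -> rnorm (u i - l) < e.
Proof.
move=> h; have /cvg_ex [l ul] : cvg (u @ \oo).
  apply/cauchy_cvgP/cauchy_exP => d /= d0.
  have dE : (complex.Re d)%:C = d by apply: RRe_real; rewrite gtr0_real.
  have [|k hk] := h (complex.Re d); first by rewrite -ltcR dE.
  exists (u k); exists k => // i /= ki; rewrite -ball_normE /=.
  by rewrite -rnormE -dE ltcR hk.
exists l => e e0; have e0' : (0 < e%:C)%R by rewrite ltcR.
have /= := ul _ (nbhsx_ballx l e%:C e0').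
case=> k _ hk; exists k => i /hk /=; rewrite -ball_normE /= -rnormE ltcR.
by rewrite rnormB.
Qed.

(** * Hilbert spaces from inner products *)

Record inner_product (R : realType) (V : lmodType R[i]) (f : V -> V -> R[i]) : Prop :=
  InnerProduct {
  innerP : forall a x y z, f (a *: x + y) z = a * f x z + f y z ;
  inner_herm : forall x y, f x y = (f y x)^*%R ;
  inner_gt0 : forall x, x != 0 -> 0 < f x x
}.

Section InnerProduct.
Context {R : realType} {V : lmodType R[i]} {f : V -> V -> R[i]}.
Hypothesis fP : inner_product f.
Local Notation C := R[i].

Lemma inner0l x : f 0 x = 0.
Proof.
by have := innerP fP 1 0 0 x; rewrite scaler0 addr0 mul1r => /esym/eqP;
  rewrite -subr_eq0 addrK => /eqP.
Qed.

Lemma innerDl x y z : f (x + y) z = f x z + f y z.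
Proof. by rewrite -{1}[x]scale1r (innerP fP) mul1r. Qed.

Lemma innerZl a x z : f (a *: x) z = a * f x z.
Proof. by rewrite -[a *: x]addr0 (innerP fP) inner0l addr0. Qed.

Lemma innerDr x y z : f z (x + y) = f z x + f z y.
Proof. by rewrite (inner_herm fP) innerDl rmorphD /= -!(inner_herm fP). Qed.

Lemma innerZr a x z : f z (a *: x) = (a^*)%R * f z x.
Proof. by rewrite (inner_herm fP) innerZl rmorphM /= -(inner_herm fP). Qed.

Lemma inner_ge0 x : 0 <= f x x.
Proof.
have [->|/(inner_gt0 fP)/ltW//] := eqVneq x 0.
by rewrite inner0l.
Qed.

Lemma inner_CS x y : f x y * (f x y)^*%R <= f x x * f y y.
Proof.
have [->|y0] := eqVneq y 0.
  by rewrite (inner_herm fP x) !inner0l rmorph0 mul0r mulr0.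
have yy := inner_gt0 fP y0.
have yyr : (f y y)^*%R = f y y by rewrite -(inner_herm fP).
have aE : ((f x y / f y y)^*)%R = (f x y)^*%R / f y y.
  by rewrite rmorphM /= fmorphV /= yyr.
have := inner_ge0 (x + (- (f x y / f y y)) *: y).
rewrite innerDl !innerDr !innerZl !innerZr rmorphN /= aE (inner_herm fP y x).
have -> : f x x + - ((f x y)^*%R / f y y) * f x y +
  (- (f x y / f y y) * (f x y)^*%R + - (f x y / f y y) *
   (- ((f x y)^*%R / f y y) * f y y)) = f x x - f x y * (f x y)^*%R / f y y.
  by field; rewrite gt_eqF.
by rewrite subr_ge0 ler_pdivrMr.
Qed.

Definition inner_norm x : C := sqrtC (f x x).

Lemma inner_norm_sqr x : inner_norm x ^+ 2 = f x x.
Proof. exact: sqrtCK. Qed.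

Lemma inner_norm_ge0 x : 0 <= inner_norm x.
Proof. by rewrite sqrtC_ge0 inner_ge0. Qed.

Lemma inner_normD x y : inner_norm (x + y) <= inner_norm x + inner_norm y.
Proof.
have n0 := inner_norm_ge0.
rewrite -ler_sqr ?nnegrE ?addr_ge0 // sqrrD !inner_norm_sqr innerDl !innerDr.
have cs : `|f x y| <= inner_norm x * inner_norm y.
  rewrite -ler_sqr ?nnegrE ?mulr_ge0 // normCK exprMn !inner_norm_sqr.
  exact: inner_CS.
have re : f x y + f y x <= 2 * `|f x y|.
  rewrite (inner_herm fP y x) addcJ ler_pM2l ?ltr0n //.
  by rewrite (le_trans _ (normc_ge_Re _)) // lecR ler_norm.
have {cs re} := le_trans re (ler_wpM2l _ cs) => /(_ _); rewrite ler0n => /(_ isT) h.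
have -> : f x x + f x y + (f y x + f y y) = (f x x + f y y) + (f x y + f y x) by ring.
have -> : f x x + inner_norm x * inner_norm y *+ 2 + f y y =
  (f x x + f y y) + 2 * (inner_norm x * inner_norm y) by ring.
by rewrite lerD2l.
Qed.

Lemma inner_normZ (a : C) x : inner_norm (a *: x) = `|a| * inner_norm x.
Proof.
apply/eqP; rewrite -(@eqrXn2 _ 2) ?mulr_ge0 ?inner_norm_ge0 //.
by rewrite exprMn !inner_norm_sqr innerZl innerZr normCK mulrA.
Qed.

Lemma inner_norm_eq0 x : inner_norm x = 0 -> x = 0.
Proof.
move=> x0; apply/eqP/negPn/negP => /(inner_gt0 fP).
by rewrite -inner_norm_sqr x0 expr0n ltxx.
Qed.

End InnerProduct.

Record hilbert_axioms (R : realType) (V : lmodType R[i]) (f : V -> V -> R[i]) : Prop :=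
  HilbertAxioms {
  hilbert_inner : inner_product f ;
  hilbert_complete : forall u : nat -> V,
    (forall e : R, 0 < e -> exists k, forall i j, (k <= i)%N -> (k <= j)%N ->
       f (u i - u j) (u i - u j) < (e ^+ 2)%:C) ->
    exists l, forall e : R, 0 < e -> exists k, forall i, (k <= i)%N ->
       f (u i - l) (u i - l) < (e ^+ 2)%:C
}.

(** The proof [hf] is an argument of the type, so that the norm and completeness instances below can
    be inferred from the type alone. *)
Definition hilbert_carrier (R : realType) (V : lmodType R[i]) (f : V -> V -> R[i])
  (hf : hilbert_axioms f) : Type := V.

Section HilbertOf.
Context {R : realType} {V : lmodType R[i]} {f : V -> V -> R[i]}.
Variable hf : hilbert_axioms f.
Local Notation C := R[i].
Local Notation W := (hilbert_carrier hf).
Let fP := hilbert_inner hf.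

HB.instance Definition _ := GRing.Lmodule.copy W V.
HB.instance Definition _ := @Lmodule_isNormed.Build C W (@inner_norm R V f)
  (inner_normD fP) (inner_normZ fP) (inner_norm_eq0 fP).

Lemma hilbert_carrier_norm (x : W) : `|x| = inner_norm (f := f) x.
Proof. by []. Qed.

Lemma hilbert_carrier_lt (x : W) (e : R) : 0 < e ->
  (rnorm x < e) = (f x x < (e ^+ 2)%:C).
Proof.
move=> e0; rewrite -ltcR rnormE hilbert_carrier_norm -inner_norm_sqr rmorphXn /=.
by rewrite ltr_pXn2r // nnegrE ?(inner_norm_ge0 fP) // ler0c ltW.
Qed.

(** A Cauchy filter contains a ball of each radius 1/(k+1). Any two of these balls meet, so their
    centres form a Cauchy sequence, to which the sequential hypothesis applies; the filter has the
    same limit. *)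
Lemma hilbert_carrier_complete (F : set_system W) : ProperFilter F -> cauchy F -> cvg F.
Proof.
move=> FF /cauchy_ballP Fc.
have e1 (k : nat) : (0 < (k.+1%:R^-1 : R)%:C :> C)%R by rewrite ltcR invr_gt0 ltr0n.
have hex k : exists x : W, F (ball x ((k.+1%:R^-1 : R)%:C : C)).
  by have /cauchy_ballP/cauchyP := Fc; apply.
pose u k := projT1 (cid (hex k)).
have uP k : F (ball (u k) ((k.+1%:R^-1 : R)%:C : C)) := projT2 (cid (hex k)).
have uu k l : rnorm (u k - u l) < k.+1%:R^-1 + l.+1%:R^-1.
  have [y [+ +]] := filter_ex (filterI (uP k) (uP l)).
  rewrite -!ball_normE /= -!rnormE !ltcR => h1 h2.
  by rewrite (le_lt_trans (rnorm_dist y _ _)) // ltrD // rnormB.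
have small (e : R) : 0 < e -> exists k : nat, forall i, (k <= i)%N -> i.+1%:R^-1 < e.
  move=> e0; exists (Num.Def.truncn e^-1) => i ki.
  rewrite invf_plt ?posrE ?ltr0n //.
  rewrite (lt_le_trans (truncnS_gt _)) // ler_nat ltnS //.
have /(hilbert_complete hf) [l hl] : forall e : R, 0 < e ->
    exists k, forall i j, (k <= i)%N -> (k <= j)%N ->
    f ((u i : V) - u j) ((u i : V) - u j) < (e ^+ 2)%:C.
  move=> e e0; have [|k hk] := small (e / 2); first by rewrite divr_gt0.
  exists k => i j ki kj; rewrite -hilbert_carrier_lt // (lt_trans (uu i j)) //.
  by rewrite (splitr e) ltrD ?hk.
apply/cvg_ex; exists l; apply/cvg_ballP => d /= d0.
have dE : (complex.Re d)%:C = d by apply: RRe_real; rewrite gtr0_real.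
have d0' : 0 < complex.Re d by rewrite -ltcR dE.
have [|k1 hk1] := small (complex.Re d / 2); first by rewrite divr_gt0.
have [|k2 hk2] := hl (complex.Re d / 2); first by rewrite divr_gt0.
pose k := maxn k1 k2.
apply: filterS (uP k) => y; rewrite -!ball_normE /= -!rnormE ltcR => uy.
rewrite -dE ltcR (le_lt_trans (rnorm_dist (u k) _ _)) // (splitr (complex.Re d)).
rewrite ltrD //; last by rewrite (lt_trans uy) // hk1 // leq_maxl.
rewrite rnormB hilbert_carrier_lt ?divr_gt0 //.
by apply: hk2; rewrite leq_maxr.
Qed.

HB.instance Definition _ := Uniform_isComplete.Build W hilbert_carrier_complete.

Definition hilbert_carrier_dot : W -> W -> C := f.

Lemma hilbert_carrier_dot_bilinear : bilinear_for
  ( *%R) ((Num.conj : C -> C) \; *%R) hilbert_carrier_dot.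
Proof.
split=> u a x y /=; first exact: (innerP fP).
exact: (eq_trans (innerDr fP _ _ _) (congr1 (+%R^~ _) (innerZr fP _ _ _))).
Qed.

Lemma hilbert_carrier_dot_herm (x y : W) :
  hilbert_carrier_dot x y =
  (-1) ^+ false * (Num.conj : C -> C) (hilbert_carrier_dot y x).
Proof. by rewrite mul1r; exact: (inner_herm fP). Qed.

HB.instance Definition _ := @bilinear_isBilinear.Build C W W C
  ( *%R) ((Num.conj : C -> C) \; *%R) hilbert_carrier_dot hilbert_carrier_dot_bilinear.
HB.instance Definition _ := @isHermitianSesquilinear.Build C W false (Num.conj : C -> C)
  hilbert_carrier_dot hilbert_carrier_dot_herm.
HB.instance Definition _ := @isDotProduct.Build C W hilbert_carrier_dot (inner_gt0 fP).

Definition hilbert_of : hilbertType R :=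
  @Hilbert R W hilbert_carrier_dot (fun x => esym (inner_norm_sqr x)).

End HilbertOf.

(** * Complete C*-norms dominate C*-seminorms *)

Section HilbertTheory.
Context {R : realType} {H : hilbertType R}.
Local Notation C := R[i].
Local Notation "''[' u , v ]" := (hdot H u v) : ring_scope.
Implicit Types (x y z : H) (a : C).

Lemma hdot_inner : inner_product (hdot H).
Proof.
split=> [a x y z|x y|x]; [by rewrite linearPl|by rewrite hermC mul1r|exact: neq0_dnorm_gt0].
Qed.

Lemma hdotC x y : '[x, y] = ('[y, x]^*)%R.
Proof. exact: (inner_herm hdot_inner). Qed.
Lemma hdotDl x y z : '[x + y, z] = '[x, z] + '[y, z].
Proof. exact: (innerDl hdot_inner). Qed.
Lemma hdotDr x y z : '[z, x + y] = '[z, x] + '[z, y].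
Proof. exact: (innerDr hdot_inner). Qed.
Lemma hdotZl a x z : '[a *: x, z] = a * '[x, z].
Proof. exact: (innerZl hdot_inner). Qed.
Lemma hdotZr a x z : '[z, a *: x] = (a^*)%R * '[z, x].
Proof. exact: (innerZr hdot_inner). Qed.
Lemma hdot0l x : '[0, x] = 0.
Proof. exact: (inner0l hdot_inner). Qed.
Lemma hdot0r x : '[x, 0] = 0.
Proof. by rewrite hdotC hdot0l rmorph0. Qed.
Lemma hdotNl x z : '[- x, z] = - '[x, z].
Proof. by rewrite -scaleN1r hdotZl mulN1r. Qed.
Lemma hdotNr x z : '[z, - x] = - '[z, x].
Proof. by rewrite hdotC hdotNl rmorphN /= -hdotC. Qed.
Lemma hdotBl x y z : '[x - y, z] = '[x, z] - '[y, z].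
Proof. by rewrite hdotDl hdotNl. Qed.
Lemma hdotBr x y z : '[z, x - y] = '[z, x] - '[z, y].
Proof. by rewrite hdotDr hdotNr. Qed.
Lemma hdot_suml I (r : seq I) (P : pred I) (F : I -> H) z :
  '[\sum_(i <- r | P i) F i, z] = \sum_(i <- r | P i) '[F i, z].
Proof.
by apply: (big_morph (fun x => '[x, z])) => [x y|]; [exact: hdotDl|exact: hdot0l].
Qed.
Lemma hdot_sumr I (r : seq I) (P : pred I) (F : I -> H) z :
  '[z, \sum_(i <- r | P i) F i] = \sum_(i <- r | P i) '[z, F i].
Proof.
by apply: (big_morph (fun x => '[z, x])) => [x y|]; [exact: hdotDr|exact: hdot0r].
Qed.

Lemma hdotxx x : '[x, x] = (rnorm x ^+ 2)%:C.
Proof. by rewrite hdot_norm rmorphXn /= rnormE. Qed.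

Lemma hdot_CS x y : rnorm '[x, y] <= rnorm x * rnorm y.
Proof.
rewrite -(@ler_pXn2r _ 2) ?nnegrE ?mulr_ge0 // exprMn -lecR sqr_rnorm [leRHS]rcM -!hdotxx; exact: (inner_CS hdot_inner).
Qed.

Lemma hdot_bound x K : 0 <= K ->
  (forall y, rnorm '[x, y] <= K * rnorm y) -> rnorm x <= K.
Proof.
move=> K0 /(_ x); have [x0 _|x0] := eqVneq (rnorm x) 0; first by rewrite x0.
rewrite hdotxx rnorm_real ger0_norm ?exprn_ge0 // expr2.
by rewrite ler_pM2r // lt_def x0 rnorm_ge0.
Qed.

Lemma hdot_inj x y : (forall z, '[x, z] = '[y, z]) -> x = y.
Proof.
move=> h; apply/subr0_eq/rnorm0_eq0/eqP.
by rewrite -sqrf_eq0 -(inj_eq (@complexI R)) -hdotxx hdotBl h subrr.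
Qed.

End HilbertTheory.

(* The values of the extension are characterised through every element of the
   graph, so no linearity is needed. *)
Lemma dense_extension (R : realType) (E : zmodType) (N : E -> R)
    (H : completeNormedModType R[i]) (G : E -> H -> Prop) (M : R) :
  (forall x y, N (x - y) = N (y - x)) ->
  (forall x y z, N (x - z) <= N (x - y) + N (y - z)) ->
  0 <= M ->
  (forall x y x' y', G x y -> G x' y' -> rnorm (y - y') <= M * N (x - x')) ->
  (forall x e, 0 < e -> exists x' y', G x' y' /\ N (x - x') < e) ->
  exists F : E -> H, forall x x' y', G x' y' -> rnorm (F x - y') <= M * N (x - x').
Proof.
move=> NB NT M0 GM dense.
suff hx x : exists y, forall x' y', G x' y' -> rnorm (y - y') <= M * N (x - x').
  by exists (fun x => projT1 (cid (hx x))) => x; exact: (projT2 (cid (hx x))).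
have hk (k : nat) : exists p : E * H, G p.1 p.2 /\ N (x - p.1) < k.+1%:R^-1.
  have [|x' [y' h]] := dense x k.+1%:R^-1; first by rewrite invr_gt0 ltr0n.
  by exists (x', y').
pose u k := projT1 (cid (hk k)).
have uG k : G (u k).1 (u k).2 := proj1 (projT2 (cid (hk k))).
have uN k : N (x - (u k).1) < k.+1%:R^-1 := proj2 (projT2 (cid (hk k))).
have small (e : R) : 0 < e -> exists k : nat, forall i, (k <= i)%N -> i.+1%:R^-1 < e.
  move=> e0; exists (Num.Def.truncn e^-1) => i ki.
  rewrite invf_plt ?posrE ?ltr0n //.
  rewrite (lt_le_trans (truncnS_gt _)) // ler_nat ltnS //.
have small2 e : 0 < e -> exists k : nat, forall i, (k <= i)%N -> M * N (x - (u i).1) < e.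
  move=> e0; have M1 : 0 < M + 1 by rewrite ltr_wpDl.
  have [|k hk'] := small (e / (M + 1)); first by rewrite divr_gt0.
  exists k => i /hk' /(lt_trans (uN i)); rewrite ltr_pdivlMr // mulrC => h.
  have := le_lt_trans _ h; apply; rewrite mulrDl lerDl mul1r.
  (* Nonnegativity of [N] on differences comes from the triangle inequality: first [0 <= N 0], then
     N 0 is at most twice N (x - u). *)
  have := NT x (u i).1 x; have := NT x x x; rewrite subrr.
  rewrite (NB (u i).1 x); lra.
have [|l hl] := @rnorm_complete R H (fun k => (u k).2).
  move=> e e0; have [|k hk'] := small2 (e / 2); first by rewrite divr_gt0.
  exists k => i j ki kj; apply: (le_lt_trans (GM _ _ _ _ (uG i) (uG j))).
  apply: (@le_lt_trans _ _ (M * (N (x - (u i).1) + N (x - (u j).1)))).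
    by rewrite ler_wpM2l // (le_trans (NT _ x _)) // NB.
  by rewrite mulrDr (splitr e) ltrD // hk'.
exists l => x' y' G'; apply: (@ler_addeps_mul _ _ _ 1) => e e0.
have [|k1 hk1] := hl (e / 2); first by rewrite divr_gt0.
have [|k2 hk2] := small2 (e / 2); first by rewrite divr_gt0.
pose k := maxn k1 k2.
have h1 : rnorm ((u k).2 - l) < e / 2 by apply: hk1; rewrite leq_maxl.
have h2 : M * N (x - (u k).1) < e / 2 by apply: hk2; rewrite leq_maxr.
rewrite (le_trans (rnorm_dist (u k).2 _ _)) // rnormB.
have h3 := GM _ _ _ _ (uG k) G'.
have h4 : M * N ((u k).1 - x') <= M * N (x - (u k).1) + M * N (x - x').
  by rewrite -mulrDr ler_wpM2l // (le_trans (NT _ x _)) // NB.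
lra.
Qed.

Section CstarContractive.
Context {R : realType} {A : starAlgType R[i]}.
Local Notation C := R[i].

Lemma star0 : star (0 : A) = 0.
Proof. by have := starD (0 : A) 0; rewrite addr0 => /esym/eqP; rewrite -subr_eq0 addrK => /eqP. Qed.

Lemma star1 : star (1 : A) = 1.
Proof. by have := starM (star (1 : A)) 1; rewrite mulr1 starK mulr1 => <-. Qed.

Lemma starN (x : A) : star (- x) = - star x.
Proof. by apply/eqP; rewrite -addr_eq0 -starD addNr star0. Qed.

Record cstar_seminorm (N : A -> R) : Prop := CstarSeminorm {
  cstar_seminorm_ge0 : forall x, 0 <= N x ;
  cstar_seminormD : forall x y, N (x + y) <= N x + N y ;
  cstar_seminormZ : forall c x, N (c *: x) = rnorm c * N x ;
  cstar_seminormE : forall x, N (star x * x) = N x ^+ 2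
}.

Local Notation cnorm_on N := (cstar_norm (@GRing.scale C A) *%R star N).

Lemma cstar_norm_seminorm N : cnorm_on N -> cstar_seminorm N.
Proof. by case=> *; split. Qed.

Section Norm.
Variable N : A -> R.
Hypothesis hN : cnorm_on N.

Lemma cstar_normN x : N (- x) = N x.
Proof. by rewrite -scaleN1r (cstar_normZ hN) rnormN rnorm1 mul1r. Qed.

Lemma cstar_norm0 : N 0 = 0.
Proof. by rewrite -(scale0r 0) (cstar_normZ hN) rnorm0 mul0r. Qed.

Lemma cstar_norm_star_le x : N x <= N (star x).
Proof.
have [->|x0] := eqVneq (N x) 0; first exact: (cstar_norm_ge0 hN).
have := cstar_normM hN (star x) x; rewrite (cstar_normE hN) expr2 ler_pM2r //.
by rewrite lt_def x0 (cstar_norm_ge0 hN).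
Qed.

Lemma cstar_norm_star x : N (star x) = N x.
Proof.
by apply/eqP; rewrite eq_le cstar_norm_star_le -{2}(starK x) cstar_norm_star_le.
Qed.

Lemma cstar_norm_eq x y K : (forall e, 0 < e -> N (x - y) <= e * K) -> x = y.
Proof.
move=> h; apply/subr0_eq/(cstar_norm_eq0 hN)/eqP.
rewrite eq_le (cstar_norm_ge0 hN) andbT.
by apply: (@ler_addeps_mul _ _ _ K) => e /h; rewrite add0r.
Qed.

(* The square root of [1 - a] is [1 - s] with [s] the fixed point of the
   contraction [s |-> (a + s^2) / 2]. *)
Lemma cstar_sqrt1B a : star a = a -> N a < 1 ->
  exists c, [/\ star c = c, forall b, a * b = b * a -> c * b = b * c & c * c = 1 - a].
Proof.
move=> aS a1; pose r := N a.
pose h : C := 2^-1.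
pose s := fix s k : A := if k is k'.+1 then h *: (a + s k' * s k') else 0.
have sS k : s k.+1 = h *: (a + s k * s k) by [].
have r0 : 0 <= r := cstar_norm_ge0 hN a.
have hr : rnorm h = 2^-1.
  have -> : h = (2^-1 : R)%:C by rewrite /h fmorphV rmorphD /= rmorph1.
  by rewrite rnorm_real ger0_norm // invr_ge0 ler0n.
have hJ : (h^*)%R = h by rewrite /h fmorphV /= conjC_nat.
have sN k : N (s k) <= r.
  elim: k => [|k ih]; first by rewrite cstar_norm0.
  rewrite sS (cstar_normZ hN) hr.
  have := cstar_normD hN a (s k * s k); have := cstar_normM hN (s k) (s k).
  have : N (s k) * N (s k) <= r * 1.
    by rewrite ler_pM ?(cstar_norm_ge0 hN) // (le_trans ih) // ltW.
  rewrite -/r; lra.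
have sstar k : star (s k) = s k.
  by elim: k => [|k ih]; [rewrite star0|rewrite sS starZ starD starM ih aS hJ].
have sb b k : a * b = b * a -> s k * b = b * s k.
  move=> ab; elim: k => [|k ih]; first by rewrite mulr0 mul0r.
  by rewrite sS -scalerAl -scalerAr mulrDl mulrDr ab -mulrA ih mulrA ih mulrA.
have sa k : s k * a = a * s k by exact: sb.
have ss k l : s k * s l = s l * s k.
  elim: k => [|k ih]; first by rewrite mulr0 mul0r.
  by rewrite sS -scalerAl -scalerAr mulrDl mulrDr sa -mulrA ih mulrA ih mulrA.
(* The iterates commute, so the difference of squares factors; both factors come from the ball of
   radius [r], which makes (r + r) / 2 = r the contraction factor. *)
have step k l : N (s k.+1 - s l.+1) <= r * N (s k - s l).
  have -> : s k.+1 - s l.+1 = h *: ((s k + s l) * (s k - s l)).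
    rewrite !sS -scalerBr; congr (_ *: _).
    rewrite opprD addrACA subrr add0r mulrDl !mulrBr (ss l k) addrA subrK //.
  rewrite (cstar_normZ hN) hr.
  have h1 := cstar_normM hN (s k + s l) (s k - s l).
  have h2 := cstar_normD hN (s k) (s l).
  have h3 : N (s k + s l) * N (s k - s l) <= (r + r) * N (s k - s l).
    rewrite ler_wpM2r ?(cstar_norm_ge0 hN) // (le_trans h2) // lerD ?sN //.
  lra.
have sd k l : N (s k - s (k + l)%N) <= r ^+ k * r.
  elim: k => [|k ih].
    by rewrite expr0 mul1r sub0r cstar_normN.
  by rewrite addSn (le_trans (step _ _)) // exprS -mulrA ler_wpM2l.
have NB x y : N (x - y) = N (y - x) by rewrite -cstar_normN opprB.
have NT x y z : N (x - z) <= N (x - y) + N (y - z).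
  by rewrite -[x - z](subrKA y) (cstar_normD hN).
have rsmall e : 0 < e -> exists k, r ^+ k * r < e.
  move=> e0; have r1 : `|r| < 1 by rewrite ger0_norm.
  have /cvgrPdist_lt/(_ e e0) [k _ hk] := cvg_expr r1.
  exists k; have := hk k (leqnn k); rewrite /= sub0r normrN ger0_norm ?exprn_ge0 //.
  move=> h1; rewrite (le_lt_trans _ h1) // ler_piMr ?exprn_ge0 // ltW //.
have [|l hl] := cstar_norm_complete hN (u := s).
  move=> e e0; have [|k hk] := rsmall (e / 2); first by rewrite divr_gt0.
  exists k => i j ki kj; rewrite (splitr e) (le_lt_trans (NT _ (s k) _)) // NB.
  by rewrite -(subnKC ki) -(subnKC kj) ltrD // (le_lt_trans (sd _ _)).
have lN : N l <= r.
  apply: (@ler_addeps_mul _ _ _ 1) => e /hl [k /(_ k (leqnn k))].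
  have := cstar_normD hN (s k) (l - s k); rewrite addrC subrK NB.
  have := sN k; lra.
have lfix : l = h *: (a + l * l).
  apply: (@cstar_norm_eq _ _ (1 + r)) => e /hl [k hk].
  have := NT l (s k.+1) (h *: (a + l * l)).
  have -> : s k.+1 - h *: (a + l * l) =
      h *: (s k * (s k - l) + (s k - l) * l).
    rewrite sS -scalerBr; congr (_ *: _).
    by rewrite opprD addrACA subrr add0r mulrBr mulrBl subrKA.
  rewrite (cstar_normZ hN) hr (NB l (s k.+1)).
  have := hk _ (leqnSn k); have h0 := hk _ (leqnn k).
  have := cstar_normD hN (s k * (s k - l)) ((s k - l) * l).
  have := cstar_normM hN (s k) (s k - l); have := cstar_normM hN (s k - l) l.
  have h1 : N (s k) * N (s k - l) <= r * e.
    by rewrite ler_pM ?(cstar_norm_ge0 hN) ?sN // ltW.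
  have h2 : N (s k - l) * N l <= e * r.
    by rewrite ler_pM ?(cstar_norm_ge0 hN) // ltW.
  rewrite [r * e]mulrC in h1; lra.
have lb b : a * b = b * a -> l * b = b * l.
  move=> ab; apply: (@cstar_norm_eq _ _ (N b + N b)) => e /hl [k /(_ k (leqnn k)) hk].
  have -> : l * b - b * l = (l - s k) * b - b * (l - s k).
    by rewrite mulrBl mulrBr opprB (sb b) // addrA subrK.
  rewrite (le_trans (cstar_normD hN _ _)) // cstar_normN [leRHS]mulrDr.
  have lk : N (l - s k) <= e by rewrite NB ltW.
  rewrite lerD // (le_trans (cstar_normM hN _ _)) //.
    by rewrite ler_pM ?(cstar_norm_ge0 hN).
  by rewrite mulrC ler_pM ?(cstar_norm_ge0 hN).
have lS : star l = l.
  apply: (@cstar_norm_eq _ _ 2) => e /hl [k /(_ k (leqnn k)) hk].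
  have := NT (star l) (s k) l; rewrite -{1}(sstar k) -starN -starD cstar_norm_star.
  rewrite (NB l); lra.
exists (1 - l); split.
- by rewrite starD starN star1 lS.
- by move=> b ab; rewrite mulrBl mulrBr mul1r mulr1 lb.
- have : l + l = a + l * l.
    have hh : h + h = 1 by rewrite -[h]mul1r -splitr.
    by rewrite {1 2}lfix -scalerDl hh scale1r.
  move=> E; have -> : a = l + l - l * l by rewrite E addrK.
  by rewrite mulrBl mul1r mulrBr mulr1 !opprB -addrA opprD; congr (1 + _); rewrite addrCA.
Qed.

(* For [b = x^* x] of norm [< 1], the element [u = b + i (1 - b^2)^(1/2)] is
   unitary and [b = (u + u^* ) / 2]. *)
Lemma cstar_seminorm_le N2 : cstar_seminorm N2 -> forall x, N2 x <= N x.
Proof.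
move=> h2.
(* [N2 1] equals its own square; by the C*-identity every unitary then has seminorm at most 1. *)
have N21 : N2 1 <= 1.
  have := cstar_seminormE h2 1; rewrite star1 mulr1 expr2 => E.
  have := cstar_seminorm_ge0 h2 1; nra.
have half b : star b = b -> N b < 1 -> N2 b <= 1.
  move=> bS b1.
  have [||c [cS cb cc]] := @cstar_sqrt1B (b * b).
  - by rewrite starM bS.
  - rewrite (le_lt_trans (cstar_normM hN _ _)) //.
    have := cstar_norm_ge0 hN b; nra.
  have {}cb : c * b = b * c by apply: cb; rewrite mulrA.
  have iJ : (('i : C)^*)%R = - 'i by rewrite conjCi.
  have ii : ('i : C) * 'i = -1 by rewrite -expr2 sqrCi.
  pose u := b + ('i : C) *: c; pose v := b + (- 'i : C) *: c.
  have uS : star u = v by rewrite starD starZ iJ bS cS.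
  have vS : star v = u by rewrite -uS starK.
  have mulE (t : C) : (b + t *: c) * (b + (- t) *: c) = b * b - (t * t) *: (c * c).
    rewrite mulrDl !mulrDr -!scalerAl -!scalerAr cb addrA scalerA mulrN scaleNr.
    by rewrite scaleNr subrK.
  have uu : u * v = 1 by rewrite mulE ii scaleN1r opprK cc addrC subrK.
  have vv : v * u = 1.
    by rewrite /u -[X in b + X *: c]opprK mulE mulrNN ii scaleN1r opprK cc addrC subrK.
  have le1 w : star w * w = 1 -> N2 w <= 1.
    move=> E; have := cstar_seminormE h2 w; rewrite E => E2.
    have := cstar_seminorm_ge0 h2 w; nra.
  have bE : b = (2^-1 : R)%:C *: (u + v).
    rewrite addrACA -scalerDl subrr scale0r addr0 scalerDr -scalerDl -rcD.
    by rewrite -[X in X + X]mul1r -splitr scale1r.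
  rewrite bE (cstar_seminormZ h2) rnorm_real ger0_norm ?invr_ge0 ?ler0n //.
  have := cstar_seminormD h2 u v; have := le1 u; rewrite uS => /(_ vv).
  have := le1 v; rewrite vS => /(_ uu); lra.
(* The general case reduces to the self-adjoint one through the C*-identity, which holds for both
   [N] and [N2]. *)
have small x : N x < 1 -> N2 x <= 1.
  move=> x1; have := half (star x * x); rewrite starM starK => /(_ erefl).
  rewrite (cstar_normE hN) (cstar_seminormE h2).
  have := cstar_norm_ge0 hN x; have := cstar_seminorm_ge0 h2 x => p1 p2 p3.
  have := p3 ltac:(nra); nra.
move=> x; apply: (@ler_addeps_mul _ _ _ 1) => e e0; rewrite mulr1.
have r0 : 0 < N x + e by rewrite ltr_wpDl ?(cstar_norm_ge0 hN).
have := small ((N x + e)^-1%:C *: x).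
rewrite (cstar_normZ hN) (cstar_seminormZ h2) rnorm_real ger0_norm ?invr_ge0 ?(ltW r0) //.
by rewrite ![_^-1 * _]mulrC ltr_pdivrMr // mul1r ltrDl ler_pdivrMr // mul1r; apply.
Qed.
End Norm.
End CstarContractive.

(** * Representations and their operator norms *)

Section StarrepTheory.
Context {R : realType} {P : starAlgType R[i]} {H : hilbertType R} {T : P -> H -> H}.
Hypothesis hT : starrep T.

Lemma starrepDr f x y : T f (x + y) = T f x + T f y.
Proof. by have := starrep_linear hT f 1 x y; rewrite !scale1r. Qed.

Lemma starrep0r f : T f 0 = 0.
Proof. by have := starrepDr f 0 0; rewrite addr0 => /esym/eqP; rewrite -subr_eq0 addrK => /eqP. Qed.

Lemma starrepZr f c x : T f (c *: x) = c *: T f x.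
Proof. by have := starrep_linear hT f c x 0; rewrite !addr0 starrep0r addr0. Qed.

Lemma starrepNr f x : T f (- x) = - T f x.
Proof. by rewrite -scaleN1r starrepZr scaleN1r. Qed.

Lemma starrepBr f x y : T f (x - y) = T f x - T f y.
Proof. by rewrite starrepDr starrepNr. Qed.

Lemma starrep_sumr f I (r : seq I) (Q : pred I) (F : I -> H) :
  T f (\sum_(i <- r | Q i) F i) = \sum_(i <- r | Q i) T f (F i).
Proof. by apply: (big_morph (T f)); [exact: starrepDr|exact: starrep0r]. Qed.

Lemma starrep0 x : T 0 x = 0.
Proof. by rewrite -(scale0r 0) (starrepZ hT) scale0r. Qed.

Lemma starrepN f x : T (- f) x = - T f x.
Proof. by rewrite -scaleN1r (starrepZ hT) scaleN1r. Qed.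

Lemma starrepB f g x : T (f - g) x = T f x - T g x.
Proof. by rewrite (starrepD hT) starrepN. Qed.

Lemma starrep_sum x I (r : seq I) (Q : pred I) (F : I -> P) :
  T (\sum_(i <- r | Q i) F i) x = \sum_(i <- r | Q i) T (F i) x.
Proof.
apply: (big_morph (fun f => T f x)); last exact: starrep0.
by move=> f g; rewrite (starrepD hT).
Qed.

End StarrepTheory.

(** * Suprema of operator norms over families of representations *)

Section FamilyNorm.
Context {R : realType} {P : starAlgType R[i]} {I : Type}.
Variables (Hs : I -> hilbertType R) (Ts : forall i, P -> Hs i -> Hs i).
Arguments Ts : clear implicits.
Hypothesis hTs : forall i, starrep (Ts i).
Variable K : P -> R.
Hypothesis K0 : forall f, 0 <= K f.
Hypothesis hK : forall i f x, rnorm (Ts i f x) <= K f * rnorm x.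

(** The value 0 keeps the set inhabited when the family is empty; the bound [K] only makes the
    supremum finite. *)
Definition family_norm (f : P) : R :=
  sup [set r | r = 0 \/ exists i (x : Hs i), rnorm x <= 1 /\ r = rnorm (Ts i f x)].

Lemma family_norm_has_sup f :
  has_sup [set r | r = 0 \/ exists i (x : Hs i), rnorm x <= 1 /\ r = rnorm (Ts i f x)].
Proof.
split; first by exists 0; left.
exists (K f) => r [->//|[i [x [x1 ->]]]].
by rewrite (le_trans (hK f x)) // ler_piMr.
Qed.

Lemma family_norm_ge0 f : 0 <= family_norm f.
Proof. by apply: (sup_upper_bound (family_norm_has_sup f)); left. Qed.

Lemma family_normP i f x : rnorm (Ts i f x) <= family_norm f * rnorm x.
Proof.
have [x0|x0] := eqVneq (rnorm x) 0.
  by rewrite (rnorm0_eq0 x0) (starrep0r (hTs i)) rnorm0 mulr0.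
have x1 : 0 < rnorm x by rewrite lt_def x0 rnorm_ge0.
rewrite -ler_pdivrMr //; apply: (sup_upper_bound (family_norm_has_sup f)); right.
have nE (y : Hs i) : rnorm ((rnorm x)^-1%:C *: y) = rnorm y / rnorm x.
  by rewrite rnormZ rnorm_real ger0_norm ?invr_ge0 // mulrC.
exists i, ((rnorm x)^-1%:C *: x); split; first by rewrite nE divff.
by rewrite (starrepZr (hTs i)) nE.
Qed.

Lemma family_norm_lub f c : 0 <= c ->
  (forall i x, rnorm (Ts i f x) <= c * rnorm x) -> family_norm f <= c.
Proof.
move=> c0 h; apply: ge_sup; first by exists 0; left.
move=> r [->//|[i [x [x1 ->]]]]; rewrite (le_trans (h i x)) // ler_piMr //.
Qed.

Lemma family_norm_seminorm : cstar_seminorm family_norm.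
Proof.
have N0 := family_norm_ge0; have NP := family_normP.
have NZ c f : family_norm (c *: f) <= rnorm c * family_norm f.
  apply: family_norm_lub => [|i x]; first by rewrite mulr_ge0.
  by rewrite (starrepZ (hTs i)) rnormZ -mulrA ler_wpM2l // NP.
split=> // [f g|c f|f].
- apply: family_norm_lub => [|i x]; first by rewrite addr_ge0.
  by rewrite (starrepD (hTs i)) (le_trans (rnormD _ _)) // mulrDl lerD // NP.
- apply/eqP; rewrite eq_le NZ /=.
  have [->|c0] := eqVneq c 0; first by rewrite rnorm0 mul0r N0.
  have c1 : 0 < rnorm c.
    by rewrite lt_def rnorm_ge0 andbT; apply: contra_neq c0 => /rnorm0_eq0.
  rewrite -ler_pdivlMl // -{1}[f]scale1r -(mulVf c0) -scalerA (le_trans (NZ _ _)) //.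
  rewrite ler_wpM2r // -(@ler_pM2r _ (rnorm c)) // [leRHS]mulVf ?gt_eqF // -rnormM mulVf //.
  by rewrite rnorm1.
- apply/eqP; rewrite eq_le; apply/andP; split.
    apply: family_norm_lub => [|i x]; first by rewrite exprn_ge0.
    apply: hdot_bound => [|y]; first by rewrite mulr_ge0 ?exprn_ge0.
    rewrite (starrepM (hTs i)) (starrep_adj (hTs i)) starK.
    rewrite (le_trans (hdot_CS _ _)) // expr2 -mulrA mulrACA ler_pM // NP.
  (* The reverse inequality: |T f x|^2 is the inner product of T (f^* f) x with x, so the square
     root of the norm of f^* f bounds T f. *)
  have s0 : 0 <= Num.sqrt (family_norm (star f * f)) by rewrite sqrtr_ge0.
  rewrite -[leRHS]sqr_sqrtr // ler_pXn2r ?nnegrE //.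
  apply: family_norm_lub => // i x.
  rewrite -(@ler_pXn2r _ 2) ?nnegrE ?mulr_ge0 // exprMn sqr_sqrtr // -lecR -hdotxx.
  have -> : hdot _ (Ts i f x) (Ts i f x) = hdot _ (Ts i (star f * f) x) x.
    by rewrite (starrepM (hTs i)) (starrep_adj (hTs i) (star f)) starK.
  have r0 : 0 <= hdot _ (Ts i (star f * f) x) x.
    by rewrite (starrepM (hTs i)) (starrep_adj (hTs i)) starK hdotxx ler0c exprn_ge0.
  rewrite -(ger0_norm r0) -rnormE lecR (le_trans (hdot_CS _ _)) //.
  by rewrite expr2 mulrA ler_wpM2r // NP.
Qed.

End FamilyNorm.

(** A single representation is a family indexed by [unit]; its operator norm is a C*-seminorm and so
    lies below the complete C*-norm. *)
Lemma starrep_contractive (R : realType) (P : starAlgType R[i]) (N : P -> R)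
    (H : hilbertType R) (T : P -> H -> H) :
  cstar_norm (@GRing.scale R[i] P) *%R star N -> starrep T ->
  forall f x, rnorm (T f x) <= N f * rnorm x.
Proof.
move=> hN hT f x.
have hB g : exists K, 0 <= K /\ forall x, rnorm (T g x) <= K * rnorm x.
  have [M hM] := starrep_bounded hT g; exists `|M|; split=> // y.
  by rewrite (le_trans (hM y)) // ler_wpM2r // ler_norm.
pose K g := projT1 (cid (hB g)).
have K0 g : 0 <= K g := proj1 (projT2 (cid (hB g))).
have hK (i : unit) g y : rnorm (T g y) <= K g * rnorm y := proj2 (projT2 (cid (hB g))) y.
have hTs (i : unit) := hT.
apply: (le_trans (@family_normP _ _ _ (fun=> H) (fun=> T) hTs _ K0 hK tt _ _)).
apply: ler_wpM2r => //; apply: cstar_seminorm_le => //.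
exact: (@family_norm_seminorm _ _ _ (fun=> H) (fun=> T) hTs _ K0 hK).
Qed.

(** * Matrices over *-algebras *)

(** A separate name, to carry the module structure over the complex numbers instead of the one over
    [A]. The size is a successor so that the matrices form a nonzero ring. *)
Definition starmx (R : realType) (A : starAlgType R[i]) (m : nat) : Type := 'M[A]_m.+1.

Section StarMatrix.
Context {R : realType} {A : starAlgType R[i]} {m : nat}.
Local Notation C := R[i].
Local Notation M := (starmx A m).
Implicit Types (a b : M).

HB.instance Definition _ := GRing.NzRing.copy M 'M[A]_m.+1.

Definition starmx_scale (c : C) a : M := map_mx ( *:%R c) a.
Definition starmx_star a : M := map_mx star (trmx a).

Fact starmx_scaleA c d a : starmx_scale c (starmx_scale d a) = starmx_scale (c * d) a.
Proof. by apply/matrixP => i j; rewrite !mxE scalerA. Qed.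
Fact starmx_scale1 : left_id 1 starmx_scale.
Proof. by move=> a; apply/matrixP => i j; rewrite !mxE scale1r. Qed.
Fact starmx_scaleDr : right_distributive starmx_scale +%R.
Proof. by move=> c a b; apply/matrixP => i j; rewrite !mxE scalerDr. Qed.
Fact starmx_scaleDl a : {morph starmx_scale^~ a : c d / c + d}.
Proof. by move=> c d; apply/matrixP => i j; rewrite !mxE scalerDl. Qed.
HB.instance Definition _ := GRing.Zmodule_isLmodule.Build C M
  starmx_scaleA starmx_scale1 starmx_scaleDr starmx_scaleDl.

Fact starmx_scaleAl (c : C) a b : c *: (a * b) = (c *: a) * b.
Proof.
apply/matrixP => i j; rewrite !mxE scaler_sumr; apply: eq_bigr => k _.
by rewrite !mxE scalerAl.
Qed.
HB.instance Definition _ := GRing.Lmodule_isLalgebra.Build C M starmx_scaleAl.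
Fact starmx_scaleAr (c : C) a b : c *: (a * b) = a * (c *: b).
Proof.
apply/matrixP => i j; rewrite !mxE scaler_sumr; apply: eq_bigr => k _.
by rewrite !mxE scalerAr.
Qed.
HB.instance Definition _ := GRing.Lalgebra_isAlgebra.Build C M starmx_scaleAr.

Fact starmx_starK : involutive starmx_star.
Proof. by move=> a; apply/matrixP => i j; rewrite !mxE starK. Qed.
Fact starmx_starD : {morph starmx_star : a b / a + b}.
Proof. by move=> a b; apply/matrixP => i j; rewrite !mxE starD. Qed.
Fact starmx_starM a b : starmx_star (a * b) = starmx_star b * starmx_star a.
Proof.
apply/matrixP => i j; rewrite !mxE.
rewrite (big_morph star (id1 := 0) (op1 := +%R)); [|exact: starD|exact: star0].
by apply: eq_bigr => k _; rewrite !mxE starM.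
Qed.
Fact starmx_starZ (c : C) a : starmx_star (c *: a) = (c^*)%R *: starmx_star a.
Proof. by apply/matrixP => i j; rewrite !mxE starZ. Qed.
HB.instance Definition _ := hasStar.Build C M
  starmx_starK starmx_starD starmx_starM starmx_starZ.

End StarMatrix.

Section HilbertPower.
Context {R : realType} (H : hilbertType R) (m : nat).
Local Notation C := R[i].
Local Notation V := {ffun 'I_m -> H}.

Definition hpow_dot (x y : V) : C := \sum_i hdot H (x i) (y i).

Lemma hpow_dotxx x : hpow_dot x x = (\sum_i rnorm (x i) ^+ 2)%:C.
Proof. by rewrite rc_sum; apply: eq_bigr => i _; rewrite hdotxx. Qed.

Lemma ffun_subE (x y : V) i : (x - y) i = x i - y i.
Proof. by rewrite !ffunE. Qed.

Lemma hpow_axioms : hilbert_axioms hpow_dot.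
Proof.
split; first split.
- move=> a x y z; rewrite mulr_sumr -big_split /=; apply: eq_bigr => i _.
  by rewrite !ffunE hdotDl hdotZl.
- move=> x y; rewrite /hpow_dot rmorph_sum; apply: eq_bigr => i _; exact: hdotC.
- move=> x x0; rewrite hpow_dotxx ltcR lt_def sumr_ge0 => [|i _]; last exact: exprn_ge0.
  rewrite andbT; apply: contra_neq x0 => /eqP; rewrite psumr_eq0 => [/allP h|i _].
    apply/ffunP => i; rewrite ffunE; apply: rnorm0_eq0; apply/eqP.
    by rewrite -sqrf_eq0; apply: h; rewrite mem_index_enum.
  exact: exprn_ge0.
move=> u hu.
have hl i : exists l, forall e, 0 < e ->
    exists k, forall j, (k <= j)%N -> rnorm (u j i - l) < e.
  apply: (@rnorm_complete _ _ (fun k => u k i)) => e e0; have [k hk] := hu e e0.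
  exists k => j j' kj kj'; have := hk j j' kj kj'.
  rewrite hpow_dotxx ltcR (bigD1 i) //= !ffunE => h.
  rewrite -(@ltr_pXn2r _ 2) ?nnegrE ?(ltW e0) //; apply: le_lt_trans h.
  by rewrite lerDl sumr_ge0 // => j'' _; exact: exprn_ge0.
pose l : V := [ffun i => projT1 (cid (hl i))].
have lP i e : 0 < e -> exists k, forall j, (k <= j)%N -> rnorm (u j i - l i) < e.
  by rewrite ffunE; exact: (projT2 (cid (hl i))).
exists l => e e0.
(* With this share for each coordinate, the sum of the m squares stays strictly below e^2, also for
   m = 0. *)
have e1 : 0 < e / m.+1%:R by rewrite divr_gt0.
pose k i := projT1 (cid (lP i _ e1)).
have kP i j : (k i <= j)%N -> rnorm (u j i - l i) < e / m.+1%:R := projT2 (cid (lP i _ e1)) j.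
exists (\max_i k i) => j kj; rewrite hpow_dotxx ltcR.
apply: (@le_lt_trans _ _ (\sum_(i < m) (e / m.+1%:R) ^+ 2)).
  apply: ler_sum => i _; rewrite ler_pXn2r ?nnegrE // ?(ltW e1) // ffun_subE ltW //.
  by apply: kP; rewrite (leq_trans _ kj) // (leq_bigmax i).
rewrite sumr_const card_ord -[_ *+ m]mulr_natr expr_div_n mulrAC ltr_pdivrMr ?exprn_gt0 //.
rewrite ltr_pM2l ?exprn_gt0 // -natrX ltr_nat.
by rewrite expnS expn1 mulSn; apply: leq_trans (leq_addr _ _).
Qed.

Definition hpow : hilbertType R := hilbert_of hpow_axioms.

Lemma rnorm_hpow (x : hpow) : rnorm x ^+ 2 = \sum_i rnorm ((x : V) i) ^+ 2.
Proof. by apply: complexI; rewrite -hdotxx -hpow_dotxx. Qed.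

Lemma rnorm_hpow_coord (x : hpow) k : rnorm ((x : V) k) <= rnorm x.
Proof.
rewrite -(@ler_pXn2r _ 2) ?nnegrE // rnorm_hpow (bigD1 k) //= lerDl.
by rewrite sumr_ge0 // => j _; exact: exprn_ge0.
Qed.

Lemma rnorm_hpow_le (x : hpow) : rnorm x <= \sum_i rnorm ((x : V) i).
Proof.
have s0 : 0 <= \sum_i rnorm ((x : V) i) by rewrite sumr_ge0.
rewrite -(@ler_pXn2r _ 2) ?nnegrE // rnorm_hpow [leRHS]expr2 mulr_suml ler_sum // => i _.
by rewrite expr2 ler_wpM2l // (bigD1 i) //= lerDl sumr_ge0.
Qed.

Lemma rnorm_hpow_single k (x : H) :
  rnorm (([ffun i => if i == k then x else 0] : V) : hpow) = rnorm x.
Proof.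
apply/eqP; rewrite -(@eqrXn2 _ 2) // rnorm_hpow (bigD1 k) //= ffunE eqxx big1 ?addr0 //.
by move=> i ik; rewrite ffunE (negPf ik) rnorm0 expr0n.
Qed.

End HilbertPower.

Section MatrixRep.
Context {R : realType} {A : starAlgType R[i]} {H : hilbertType R} (T : A -> H -> H) (m : nat).
Local Notation V := {ffun 'I_m.+1 -> H}.

Definition mxrep (a : starmx A m) (x : hpow H m.+1) : hpow H m.+1 :=
  [ffun i => \sum_k T (a i k) ((x : V) k)] : V.

(** A crude bound, used for boundedness of [mxrep] and, with [B] the norm of [A], for the continuity
    of matrix norms in the entries. *)
Lemma mxrep_bound (B : A -> R) a x : (forall f, 0 <= B f) ->
  (forall f x, rnorm (T f x) <= B f * rnorm x) ->
  rnorm (mxrep a x) <= (\sum_i \sum_k B (a i k)) * rnorm x.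
Proof.
move=> B0 hB; set S := \sum_i _.
have xk := rnorm_hpow_coord x.
have s0 i : 0 <= \sum_k B (a i k) by rewrite sumr_ge0.
have S0 : 0 <= S by rewrite sumr_ge0.
rewrite -(@ler_pXn2r _ 2) ?nnegrE ?mulr_ge0 // rnorm_hpow exprMn.
apply: (@le_trans _ _ (\sum_i (\sum_k B (a i k)) ^+ 2 * rnorm x ^+ 2)).
  apply: ler_sum => i _; rewrite ffunE -exprMn ler_pXn2r ?nnegrE ?mulr_ge0 //.
  rewrite (le_trans (rnorm_sum _ _ _)) // mulr_suml ler_sum // => k _.
  by rewrite (le_trans (hB _ _)) // ler_wpM2l.
rewrite -mulr_suml ler_wpM2r ?exprn_ge0 // [leRHS]expr2 mulr_suml ler_sum // => i _.
rewrite expr2 ler_wpM2l // /S [leRHS](bigD1 i) //= lerDl sumr_ge0 //.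
Qed.

Lemma mxrep_starrep : starrep T -> starrep mxrep.
Proof.
move=> hT.
have hB f : exists K, 0 <= K /\ forall x, rnorm (T f x) <= K * rnorm x.
  have [M hM] := starrep_bounded hT f; exists `|M|; split=> // y.
  by rewrite (le_trans (hM y)) // ler_wpM2r // ler_norm.
split.
- move=> a c x y; apply/ffunP => i; rewrite !ffunE scaler_sumr -big_split /=.
  by apply: eq_bigr => k _; rewrite !ffunE (starrep_linear hT).
- move=> a; exists (\sum_i \sum_k projT1 (cid (hB (a i k)))) => x.
  apply: (@mxrep_bound (fun f => projT1 (cid (hB f)))) => f.
    exact: (proj1 (projT2 (cid (hB f)))).
  exact: (proj2 (projT2 (cid (hB f)))).
- move=> a b x; apply/ffunP => i; rewrite !ffunE -big_split /=.
  by apply: eq_bigr => k _; rewrite !mxE (starrepD hT).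
- move=> c a x; apply/ffunP => i; rewrite !ffunE scaler_sumr /=.
  by apply: eq_bigr => k _; rewrite !mxE (starrepZ hT).
- move=> x; apply/ffunP => i; rewrite ffunE (bigD1 i) //= big1 => [|k ki].
    by rewrite addr0 mxE eqxx (starrep1 hT).
  by rewrite mxE eq_sym (negPf ki) (starrep0 hT).
- move=> a b x; apply/ffunP => i; rewrite !ffunE.
  under eq_bigr => k _ do rewrite mxE (starrep_sum hT).
  rewrite exchange_big /=; apply: eq_bigr => k _; rewrite ffunE (starrep_sumr hT).
  by apply: eq_bigr => j _; rewrite (starrepM hT).
- move=> a x y; change (hpow_dot (mxrep a x) y = hpow_dot x (mxrep (star a) y)).
  rewrite /hpow_dot.
  under eq_bigr => i _ do rewrite ffunE hdot_suml.
  under [RHS]eq_bigr => i _ do rewrite ffunE hdot_sumr.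
  rewrite exchange_big /=; apply: eq_bigr => i _; apply: eq_bigr => k _.
  by rewrite (starrep_adj hT) !mxE.
Qed.

End MatrixRep.

(** * Representations of the envelope and of the quotient *)

Section Envelope.
Context {R : realType} {P : starAlgType R[i]} {A : cstarAlgType R}.
Variable iota : {lrmorphism P -> A}.
Hypothesis iotaP : cstar_envelope iota.
Local Notation C := R[i].

Lemma cnormB (x y : A) : cnorm (x - y) = cnorm (y - x).
Proof. by rewrite -(cstar_normN cnormP) opprB. Qed.

Lemma cnorm_dist (x y z : A) : cnorm (x - z) <= cnorm (x - y) + cnorm (y - z).
Proof. by rewrite -[x - z](subrKA y) (cstar_normD cnormP). Qed.

Lemma envelope_approx (b : A) e : 0 < e -> exists f, cnorm (b - iota f) < e.
Proof.
move=> e0; have : cclosure (range iota) b by rewrite (envelope_dense iotaP).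
by move=> /(_ e e0) [_ [f _ <-]]; exists f.
Qed.

Lemma irreducible_le_envelope (H : hilbertType R) (T : P -> H -> H) :
  starrep T -> irreducible T -> forall f x, rnorm (T f x) <= cnorm (iota f) * rnorm x.
Proof.
move=> hT iT f x; have [x0|x0] := eqVneq (rnorm x) 0.
  by rewrite (rnorm0_eq0 x0) (starrep0r hT) rnorm0 mulr0.
have x1 : 0 < rnorm x by rewrite lt_def x0 rnorm_ge0.
have nE (y : H) : rnorm ((rnorm x)^-1%:C *: y) = rnorm y / rnorm x.
  by rewrite rnormZ rnorm_real ger0_norm ?invr_ge0 // mulrC.
rewrite -ler_pdivrMr // -nE -(starrepZr hT) -lee_fin (envelope_norm iotaP).
apply: (@le_trans _ _ (opnorm (T f))); apply: ereal_sup_ubound; last by exists H, T.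
by exists ((rnorm x)^-1%:C *: x) => //=; rewrite nE divff.
Qed.

(** The extension is made one vector at a time: for fixed [x] the map taking [iota f] to [T f x] is
    Lipschitz on a dense set. The estimate [T'P] then carries every algebraic identity to the
    limit. *)
Lemma envelope_extension (H : hilbertType R) (T : P -> H -> H) :
  starrep T -> (forall f x, rnorm (T f x) <= cnorm (iota f) * rnorm x) ->
  exists T' : A -> H -> H, starrep T' /\ forall f x, T' (iota f) x = T f x.
Proof.
move=> hT Tb.
have hF (x : H) : exists F : A -> H, forall b f,
    rnorm (F b - T f x) <= rnorm x * cnorm (b - iota f).
  have [|||F hF] := @dense_extension R A cnorm H
    (fun b y => exists f, b = iota f /\ y = T f x) (rnorm x) cnormB cnorm_dist.
  - exact: rnorm_ge0.
  - move=> _ _ _ _ [f [-> ->]] [g [-> ->]].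
    by rewrite -(starrepB hT) -raddfB mulrC Tb.
  - move=> b e e0; have [f hf] := envelope_approx b e0.
    by exists (iota f), (T f x); split=> //; exists f.
  by exists F => b f; apply: hF; exists f.
pose T' b x := projT1 (cid (hF x)) b.
have T'P x b f : rnorm (T' b x - T f x) <= rnorm x * cnorm (b - iota f) :=
  projT2 (cid (hF x)) b f.
have T'E f x : T' (iota f) x = T f x.
  apply/subr0_eq/(@rnorm_le_eps _ _ _ 0) => e _.
  by rewrite (le_trans (T'P _ _ _)) // subrr (cstar_norm0 cnormP) !mulr0.
have T'b b x : rnorm (T' b x) <= cnorm b * rnorm x.
  by have := T'P x b 0; rewrite (starrep0 hT) (rmorph0 iota) !subr0 mulrC.
have T'lim b x y K : (forall f e, 0 < e -> cnorm (b - iota f) < e ->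
    rnorm (T f x - y) <= e * K) -> T' b x = y.
  move=> h; apply/subr0_eq/(@rnorm_le_eps _ _ _ (rnorm x + K)) => e e0.
  have [f hf] := envelope_approx b e0.
  rewrite (le_trans (rnorm_dist (T f x) _ _)) // mulrDr lerD ?h //.
  by rewrite (le_trans (T'P _ _ _)) // mulrC ler_wpM2r // ltW.
have T'lin b : linear (T' b).
  move=> a x y; apply: (@T'lim _ _ _ (rnorm a * rnorm x + rnorm y)) => f e e0 hf.
  rewrite (starrep_linear hT) opprD addrACA -scalerBr (le_trans (rnormD _ _)) //.
  rewrite rnormZ mulrDr mulrCA lerD ?ler_wpM2l // rnormB (le_trans (T'P _ _ _)) //.
    by rewrite mulrC ler_wpM2r // ltW.
  by rewrite mulrC ler_wpM2r // ltW.
have T'D b c x : T' (b + c) x = T' b x + T' c x.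
  apply/subr0_eq/(@rnorm_le_eps _ _ _ (4 * rnorm x)) => e e0.
  have [f hf] := envelope_approx b e0; have [g hg] := envelope_approx c e0.
  have -> : T' (b + c) x - (T' b x + T' c x) =
     (T' (b + c) x - T (f + g) x) - ((T' b x - T f x) + (T' c x - T g x)).
    by rewrite (starrepD hT) [_ - T f x + _]addrACA -opprD opprB addrA subrK.
  have h1 := T'P x (b + c) (f + g); have h2 := T'P x b f; have h3 := T'P x c g.
  have := rnormD (T' (b + c) x - T (f + g) x) (- ((T' b x - T f x) + (T' c x - T g x))).
  rewrite rnormN; have := rnormD (T' b x - T f x) (T' c x - T g x).
  have h4 : cnorm (b + c - iota (f + g)) <= e + e.
    rewrite raddfD opprD addrACA (le_trans (cstar_normD cnormP _ _)) //.
    by rewrite lerD // ltW.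
  have := rnorm_ge0 x; nra.
have T'Z a b x : T' (a *: b) x = a *: T' b x.
  apply/subr0_eq/(@rnorm_le_eps _ _ _ (2 * (rnorm a * rnorm x))) => e e0.
  have [f hf] := envelope_approx b e0.
  rewrite (le_trans (rnorm_dist (T (a *: f) x) _ _)) //.
  have h1 := T'P x (a *: b) (a *: f); rewrite linearZ -scalerBr (cstar_normZ cnormP) in h1.
  rewrite [X in _ + rnorm (X - _)](starrepZ hT) -scalerBr rnormZ [rnorm (T f x - _)]rnormB.
  have h2 := ler_wpM2l (rnorm_ge0 a) (T'P x b f).
  have h3 : rnorm a * rnorm x * cnorm (b - iota f) <= rnorm a * rnorm x * e.
    by rewrite ler_wpM2l ?mulr_ge0 // ltW.
  move: h1; rewrite /=; nra.
have T'B b c x : T' (b - c) x = T' b x - T' c x.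
  by rewrite T'D -scaleN1r T'Z scaleN1r.
have T'Dr b x y : T' b (x + y) = T' b x + T' b y.
  by have := T'lin b 1 x y; rewrite !scale1r.
have T'Br b x y : T' b (x - y) = T' b x - T' b y.
  by rewrite addrC -[- y]scaleN1r T'lin scaleN1r addrC.
(* Multiplicativity takes two stages: here the right factor lies in the range of [iota] and only the
   left one is approximated; approximating the right factor comes afterwards and relies on this
   case. *)
have T'M1 b g x : T' (b * iota g) x = T' b (T g x).
  apply/subr0_eq/(@rnorm_le_eps _ _ _ (cnorm (iota g) * rnorm x + rnorm (T g x))) => e e0.
  have [f hf] := envelope_approx b e0.
  have -> : T' (b * iota g) x - T' b (T g x) =
      T' ((b - iota f) * iota g) x - T' (b - iota f) (T g x).
    rewrite mulrBl !T'B T'E -rmorphM T'E (starrepM hT) /=.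
    by rewrite opprB addrA subrK.
  rewrite (le_trans (rnormD _ _)) // rnormN mulrDr lerD //.
    rewrite (le_trans (T'b _ _)) // mulrA ler_wpM2r // (le_trans (cstar_normM cnormP _ _)) //.
    by rewrite ler_wpM2r ?(cstar_norm_ge0 cnormP) // ltW.
  by rewrite (le_trans (T'b _ _)) // ler_wpM2r // ltW.
exists T'; split=> //; split=> //.
- by move=> f; exists (cnorm f) => x.
- by move=> x; rewrite -(rmorph1 iota) T'E (starrep1 hT).
- move=> b c x; apply/subr0_eq/(@rnorm_le_eps _ _ _ (2 * (cnorm b * rnorm x))) => e e0.
  have [g hg] := envelope_approx c e0.
  have -> : T' (b * c) x - T' b (T' c x) =
      T' (b * (c - iota g)) x - T' b (T' (c - iota g) x).
    by rewrite mulrBr !T'B T'Br T'M1 T'E opprB addrA subrK.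
  have n0 := cstar_norm_ge0 (@cnormP R A).
  have h : cnorm b * cnorm (c - iota g) * rnorm x <= cnorm b * e * rnorm x.
    by rewrite ler_wpM2r // ler_wpM2l // ltW.
  have -> : e * (2 * (cnorm b * rnorm x)) =
    cnorm b * e * rnorm x + cnorm b * e * rnorm x by ring.
  rewrite (le_trans (rnormD _ _)) // rnormN lerD // (le_trans _ h) //.
    by rewrite (le_trans (T'b _ _)) // ler_wpM2r // (cstar_normM cnormP).
  by rewrite (le_trans (T'b _ _)) // -mulrA ler_wpM2l.
- move=> b x y; apply/subr0_eq/(@rnorm_le_eps _ _ _ (2 * (rnorm x * rnorm y))) => e e0.
  have [f hf] := envelope_approx b e0.
  have -> : hdot H (T' b x) y - hdot H x (T' (star b) y) =
      hdot H (T' (b - iota f) x) y - hdot H x (T' (star (b - iota f)) y).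
    rewrite starD starN !T'B hdotBl hdotBr -(envelope_star iotaP) !T'E (starrep_adj hT).
    by rewrite opprB addrA subrK.
  have h : cnorm (b - iota f) * (rnorm x * rnorm y) <= e * (rnorm x * rnorm y).
    by rewrite ler_wpM2r ?mulr_ge0 // ltW.
  have -> : e * (2 * (rnorm x * rnorm y)) =
    e * (rnorm x * rnorm y) + e * (rnorm x * rnorm y) by ring.
  rewrite (le_trans (rnormD _ _)) // rnormN lerD // (le_trans _ h) //.
    by rewrite (le_trans (hdot_CS _ _)) // mulrA ler_wpM2r.
  rewrite (le_trans (hdot_CS _ _)) // mulrCA ler_wpM2l // (le_trans (T'b _ _)) //.
  by rewrite (cstar_norm_star cnormP).
Qed.

End Envelope.

Section Quotient.
Context {R : realType} {A Q : cstarAlgType R}.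
Variables (X : set A) (j : {lrmorphism A -> Q}).
Hypothesis jP : cstar_quotient (gen_closed_ideal X) j.

(** Closedness needs continuity in the norm of [A], which [starrep_contractive] provides for every
    representation. *)
Lemma starrep_kernel_ideal (H : hilbertType R) (T : A -> H -> H) : starrep T ->
  closed_ideal [set b | forall x, T b x = 0].
Proof.
move=> hT; split.
- move=> b hb x; apply: (@rnorm_le_eps _ _ _ (rnorm x)) => e e0.
  have [c hc bc] := hb e e0; have -> : T b x = T (b - c) x by rewrite (starrepB hT) hc subr0.
  rewrite (le_trans (starrep_contractive cnormP hT _ _)) // ler_wpM2r // ltW //.
- by move=> x; exact: (starrep0 hT).
- by move=> b c hb hc x; rewrite (starrepD hT) hb hc addr0.
- by move=> b c hc x; rewrite (starrepM hT) hc (starrep0r hT).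
- by move=> b c hc x; rewrite (starrepM hT) hc.
Qed.

(** The kernel of [T] is a closed ideal containing [X], hence contains the ideal it generates; the
    factor is defined by choosing lifts along [j]. *)
Lemma quotient_factor (H : hilbertType R) (T : A -> H -> H) :
  starrep T -> (forall b x, X b -> T b x = 0) ->
  exists T' : Q -> H -> H, starrep T' /\ forall b x, T' (j b) x = T b x.
Proof.
move=> hT TX.
have TJ b : gen_closed_ideal X b -> forall x, T b x = 0.
  move=> /(_ [set b | forall x, T b x = 0]); apply.
  by split; [exact: starrep_kernel_ideal|move=> c Xc x; exact: TX].
pose l y := projT1 (cid (quotient_surj jP y)).
have lK y : j (l y) = y := projT2 (cid (quotient_surj jP y)).
pose T' y x := T (l y) x.
have T'E b x : T' (j b) x = T b x.
  apply/subr0_eq; rewrite -(starrepB hT); apply: TJ; apply/(quotient_ker jP).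
  by rewrite (raddfB j) /= lK subrr.
exists T'; split=> //; split.
- by move=> y; exact: (starrep_linear hT).
- by move=> y; exact: (starrep_bounded hT).
- by move=> y z x; rewrite -[y in LHS]lK -[z in LHS]lK -raddfD T'E (starrepD hT).
- by move=> c y x; rewrite -[y in LHS]lK -linearZ T'E (starrepZ hT).
- by move=> x; rewrite -(rmorph1 j) T'E (starrep1 hT).
- by move=> y z x; rewrite -[y in LHS]lK -[z in LHS]lK -rmorphM T'E (starrepM hT).
- move=> y x1 x2; rewrite -[y in RHS]lK -(quotient_star jP) T'E.
  exact: (starrep_adj hT).
Qed.

End Quotient.

Lemma starrep_comp (R : realType) (P : starAlgType R[i]) (A : starAlgType R[i])
    (iota : {lrmorphism P -> A}) (H : hilbertType R) (T : A -> H -> H) :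
  (forall f, iota (star f) = star (iota f)) ->
  starrep T -> starrep (fun f => T (iota f)).
Proof.
move=> iS hT; split.
- by move=> f; exact: (starrep_linear hT).
- by move=> f; exact: (starrep_bounded hT).
- by move=> f g x; rewrite raddfD (starrepD hT).
- by move=> c f x; rewrite linearZ (starrepZ hT).
- by move=> x; rewrite rmorph1 (starrep1 hT).
- by move=> f g x; rewrite rmorphM (starrepM hT).
- by move=> f x y; rewrite iS (starrep_adj hT).
Qed.

(** * A concrete C*-norm on the matrices over the envelope *)

Section MatrixEnvelope.
Context {R : realType} {P : starAlgType R[i]} {A : cstarAlgType R}.
Variable iota : {lrmorphism P -> A}.
Hypothesis iotaP : cstar_envelope iota.
Local Notation C := R[i].

(** The index type of the supremum in [irrep_norm]. Irreducibility is asked on [P], as in [envnorm],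
    while the operators are already defined on [A]. *)
Record irrep : Type := Irrep {
  irrep_space : hilbertType R ;
  irrep_map : A -> irrep_space -> irrep_space ;
  irrep_starrep : starrep irrep_map ;
  irrep_irreducible : irreducible (fun f => irrep_map (iota f))
}.

Lemma irrep_extension (H : hilbertType R) (T : P -> H -> H) : starrep T -> irreducible T ->
  exists T' : A -> H -> H, [/\ starrep T', irreducible (fun f => T' (iota f)) &
    forall f x, T' (iota f) x = T f x].
Proof.
move=> hT iT.
have [T' [hT' T'E]] := envelope_extension iotaP hT (irreducible_le_envelope iotaP hT iT).
exists T'; split=> //; suff -> : (fun f => T' (iota f)) = T by [].
by apply/funext => f; apply/funext => x.
Qed.

(** On the range of [iota] this is the definition of the envelope norm. Approximating [b] by
    [iota f] costs [e] twice, once in the norm of [A] and once in each representation. *)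
Lemma cnorm_lub (b : A) c : 0 <= c ->
  (forall (i : irrep) x, rnorm (irrep_map (i := i) b x) <= c * rnorm x) -> cnorm b <= c.
Proof.
move=> c0 h; apply: (@ler_addeps_mul _ _ _ 2) => e e0.
have [f hf] := envelope_approx iotaP b e0.
suff : cnorm (iota f) <= c + e.
  have := cnorm_dist b (iota f) 0; rewrite !subr0; lra.
rewrite -lee_fin (envelope_norm iotaP); apply: ge_ereal_sup => _ [H [T [hT iT ->]]].
apply: ge_ereal_sup => _ [x /= x1 <-]; rewrite lee_fin.
have [T' [hT' iT' T'E]] := irrep_extension hT iT.
have := h (Irrep hT' iT') x => /= hx.
have := starrep_contractive cnormP hT' (iota f - b) x.
rewrite cnormB (starrepB hT') T'E => hfb.
have := rnormD (T f x - T' b x) (T' b x); rewrite subrK => hfx.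
have h1 : cnorm (b - iota f) * rnorm x <= e * 1 by rewrite ler_pM ?(cstar_norm_ge0 cnormP) // ltW.
have h2 : c * rnorm x <= c * 1 by rewrite ler_wpM2l.
lra.
Qed.

Variable m : nat.

(** The reference norm: once it is known to be a complete C*-norm, it dominates any given C*-norm on
    the matrices. *)
Definition irrep_norm : starmx A m -> R :=
  @family_norm R (starmx A m) irrep (fun i => hpow (irrep_space i) m.+1)
    (fun i => mxrep (irrep_map (i := i)) (m := m)).

Let K (a : starmx A m) : R := \sum_i \sum_k cnorm (a i k).

Let K0 a : 0 <= K a.
Proof. by apply: sumr_ge0 => i _; apply: sumr_ge0 => k _; exact: cstar_norm_ge0 cnormP _. Qed.

Let mxrepP (i : irrep) := mxrep_starrep m (irrep_starrep i).

Let hK (i : irrep) (a : starmx A m) x :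
  rnorm (mxrep (irrep_map (i := i)) a x) <= K a * rnorm x.
Proof.
apply: mxrep_bound => [f|f y]; first exact: cstar_norm_ge0 cnormP _.
exact: starrep_contractive cnormP (irrep_starrep i) _ _.
Qed.

Let irrep_normP i a x : rnorm (mxrep (irrep_map (i := i)) a x) <= irrep_norm a * rnorm x.
Proof. exact: (family_normP mxrepP K0 hK). Qed.

Let irrep_norm_lub a c : 0 <= c ->
  (forall i x, rnorm (mxrep (irrep_map (i := i)) a x) <= c * rnorm x) -> irrep_norm a <= c.
Proof. exact: family_norm_lub. Qed.

Let irrep_norm_semi : cstar_seminorm irrep_norm.
Proof. exact: (family_norm_seminorm mxrepP K0 hK). Qed.

Let irrep_norm_le a : irrep_norm a <= K a.
Proof. by apply: irrep_norm_lub => // i x; exact: hK. Qed.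

Let irrep_norm_entry (a : starmx A m) i k : cnorm (a i k) <= irrep_norm a.
Proof.
apply: cnorm_lub => [|p x]; first exact: (cstar_seminorm_ge0 irrep_norm_semi).
have := irrep_normP a (([ffun l => if l == k then x else 0] : {ffun 'I_m.+1 -> irrep_space p})
   : hpow (irrep_space p) m.+1).
rewrite rnorm_hpow_single; apply: le_trans.
apply: le_trans (rnorm_hpow_coord _ i); rewrite ffunE (bigD1 k) //= big1.
  by rewrite addr0 ffunE eqxx.
by move=> l lk; rewrite ffunE (negPf lk) (starrep0r (irrep_starrep p)).
Qed.

(** The norm lies between the norm of each entry and the sum of the norms of the entries, so
    definiteness and completeness are inherited from [A] entrywise. *)
Lemma irrep_norm_cstar : cstar_norm (@GRing.scale C (starmx A m)) *%R star irrep_norm.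
Proof.
case: (irrep_norm_semi) => N0 ND NZ NE; split=> //.
- move=> a a0; apply/matrixP => i k; rewrite mxE; apply: (cstar_norm_eq0 cnormP).
  apply/eqP; rewrite eq_le (cstar_norm_ge0 cnormP) andbT -a0.
  exact: irrep_norm_entry.
- move=> a b; apply: irrep_norm_lub => [|i x]; first by rewrite mulr_ge0.
  rewrite (starrepM (mxrepP i)) (le_trans (irrep_normP _ _)) // -mulrA ler_wpM2l //.
- move=> u hu.
  have hl i k : exists l, forall e, 0 < e ->
      exists n, forall j, (n <= j)%N -> cnorm (u j i k - l) < e.
    apply: (cstar_norm_complete cnormP) => e e0; have [n hn] := hu e e0.
    exists n => j j' nj nj'; apply: le_lt_trans (hn j j' nj nj').
    by have := irrep_norm_entry (u j - u j') i k; rewrite !mxE.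
  pose l : starmx A m := \matrix_(i, k) projT1 (cid (hl i k)).
  have lP i k e : 0 < e -> exists n, forall j, (n <= j)%N -> cnorm (u j i k - l i k) < e.
    by rewrite mxE; exact: (projT2 (cid (hl i k))).
  exists l => e e0.
  (* One more than the number of entries, so that the sum of the shares is strictly below [e]. *)
  have e1 : 0 < e / (m.+1 * m.+1).+1%:R by rewrite divr_gt0.
  pose n i k := projT1 (cid (lP i k _ e1)).
  have nP i k j : (n i k <= j)%N -> cnorm (u j i k - l i k) < e / (m.+1 * m.+1).+1%:R :=
    projT2 (cid (lP i k _ e1)) j.
  exists (\max_i \max_k n i k) => j nj; apply: (le_lt_trans (irrep_norm_le _)).
  apply: (@le_lt_trans _ _
     (\sum_(i < m.+1) \sum_(k < m.+1) (e / (m.+1 * m.+1).+1%:R))).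
    apply: ler_sum => i _; apply: ler_sum => k _.
    have -> : (u j - l) i k = u j i k - l i k by rewrite !mxE.
    apply/ltW/nP/(leq_trans _ nj).
    exact: leq_trans (leq_bigmax (F := n i) k) (leq_bigmax (F := fun i => \max_k n i k) i).
  rewrite !sumr_const !card_ord -mulrnA -[_ *+ _]mulr_natr mulrAC ltr_pdivrMr //.
  by rewrite ltr_pM2l // ltr_nat.
Qed.

Variable N : starmx A m -> R.
Hypothesis hN : cstar_norm (@GRing.scale C (starmx A m)) *%R star N.

Lemma mx_cnorm_le a : N a <= \sum_i \sum_k cnorm (a i k).
Proof.
apply: le_trans (irrep_norm_le a).
exact: (cstar_seminorm_le irrep_norm_cstar (cstar_norm_seminorm hN)).
Qed.

(** [irrep_norm] dominates [N], and by construction it is a supremum over irreducible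
    representations of [P]. *)
Lemma mx_envelope_le (p : 'M[P]_m.+1) c : 0 <= c ->
  (forall (H : hilbertType R) (T : P -> H -> H), starrep T -> irreducible T ->
     forall x, rnorm (mxrep T (p : starmx P m) x) <= c * rnorm x) ->
  N (map_mx iota p : starmx A m) <= c.
Proof.
move=> c0 h.
apply: (le_trans (cstar_seminorm_le irrep_norm_cstar (cstar_norm_seminorm hN) _)).
apply: irrep_norm_lub => // i x.
have hT := starrep_comp (envelope_star iotaP) (irrep_starrep i).
have := h _ _ hT (irrep_irreducible i) x; congr (rnorm _ <= _).
by apply/ffunP => l; rewrite !ffunE; apply: eq_bigr => k _; rewrite !mxE.
Qed.

End MatrixEnvelope.

(** * Matrix norms over the quotient *)

Section MatrixBoundary.
Context {R : realType} {P : starAlgType R[i]} {A Q : cstarAlgType R}.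
Variables (iota : {lrmorphism P -> A}) (X : set A) (j : {lrmorphism A -> Q}).
Hypothesis iotaP : cstar_envelope iota.
Hypothesis jP : cstar_quotient (gen_closed_ideal X) j.
Variable m : nat.
Local Notation C := R[i].
Variables (NA : starmx A m -> R) (NQ : starmx Q m -> R).
Hypothesis hNA : cstar_norm (@GRing.scale C (starmx A m)) *%R star NA.
Hypothesis hNQ : cstar_norm (@GRing.scale C (starmx Q m)) *%R star NQ.

(** The pullback of [NQ] along [j] is a C*-seminorm, hence lies below the complete norm [NA]. *)
Lemma mx_quotient_contractive (a : starmx A m) : NQ (map_mx j a : starmx Q m) <= NA a.
Proof.
apply: (cstar_seminorm_le hNA (N2 := fun a : starmx A m => NQ (map_mx j a : starmx Q m))).
split.
- by move=> x; exact: (cstar_norm_ge0 hNQ).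
- move=> x y; apply: le_trans (cstar_normD hNQ _ _).
  by rewrite (map_mxD j).
- move=> c x; rewrite -(cstar_normZ hNQ); congr NQ.
  by apply/matrixP => i k; rewrite !mxE linearZ.
- move=> x; rewrite -(cstar_normE hNQ); congr NQ.
  apply/matrixP => i k; rewrite !mxE raddf_sum; apply: eq_bigr => l _.
  by rewrite !mxE -(quotient_star jP) -rmorphM.
Qed.

(** Such a [T] extends to [A] and factors through [Q]; its amplification is then a representation of
    the matrices over [Q], which is contractive for [NQ]. *)
Lemma mx_boundary_le (H : hilbertType R) (T : P -> H -> H) (p : 'M[P]_m.+1) x :
  starrep T -> irreducible T ->
  (forall b, X b -> exists2 f, iota f = b & forall x, T f x = 0) ->
  rnorm (mxrep T (p : starmx P m) x) <=
    NQ (map_mx j (map_mx iota p) : starmx Q m) * rnorm x.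
Proof.
move=> hT iT TX.
have [T1 [hT1 _ T1E]] := irrep_extension iotaP hT iT.
have [|T2 [hT2 T2E]] := quotient_factor jP hT1.
  by move=> b y /TX [f <- Tf]; rewrite T1E.
have := starrep_contractive hNQ (mxrep_starrep m hT2) (map_mx j (map_mx iota p)) x.
congr (rnorm _ <= _); apply/ffunP => l; rewrite !ffunE; apply: eq_bigr => k _.
by rewrite !mxE T2E T1E.
Qed.

End MatrixBoundary.

(** * Spectrum of X and existence of a vacuum *)

(* Linear identities between vectors are tested against all linear forms. *)
Ltac hring :=
  apply: hdot_inj => ?; rewrite ?(hdotDl, hdotNl, hdotZl, hdot0l); ring.

Section RealDot.
Context {R : realType} {H : hilbertType R}.
Implicit Types (x y z : H) (r : R).

Definition rdot x y : R := complex.Re (hdot H x y).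

Lemma rdotC x y : rdot x y = rdot y x.
Proof. by rewrite /rdot hdotC; case: (hdot H y x). Qed.
Lemma rdotDl x y z : rdot (x + y) z = rdot x z + rdot y z.
Proof. by rewrite /rdot hdotDl raddfD. Qed.
Lemma rdotNl x z : rdot (- x) z = - rdot x z.
Proof. by rewrite /rdot hdotNl raddfN. Qed.
Lemma rdotBl x y z : rdot (x - y) z = rdot x z - rdot y z.
Proof. by rewrite rdotDl rdotNl. Qed.
Lemma rdotBr x y z : rdot z (x - y) = rdot z x - rdot z y.
Proof. by rewrite rdotC rdotBl !(rdotC z). Qed.
Lemma rdotZl r x z : rdot (r%:C *: x) z = r * rdot x z.
Proof. by rewrite /rdot hdotZl; case: (hdot H x z) => a b /=; rewrite mul0r subr0. Qed.
Lemma rdot0l z : rdot 0 z = 0.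
Proof. by rewrite /rdot hdot0l. Qed.
Lemma rdot_suml I (s : seq I) (Q : pred I) (F : I -> H) z :
  rdot (\sum_(i <- s | Q i) F i) z = \sum_(i <- s | Q i) rdot (F i) z.
Proof.
by apply: (big_morph (fun x => rdot x z)) => [x y|]; [exact: rdotDl|exact: rdot0l].
Qed.
Lemma rdotxx x : rdot x x = rnorm x ^+ 2.
Proof. by rewrite /rdot hdotxx. Qed.
Lemma rdot_CS x y : rdot x y <= rnorm x * rnorm y.
Proof. exact: le_trans (Re_le_rnorm _) (hdot_CS _ _). Qed.

End RealDot.

(** The form in which new representations are built: images of the generators and their adjoints,
    with no reference to the quotient of terms. *)
Record qrep (R : realType) (q : R) (n : nat) (H : hilbertType R)
    (Z Zs : 'I_n -> H -> H) : Prop := Qrep {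
  qrep_linear : forall k, linear (Z k) ;
  qrep_linear_adj : forall k, linear (Zs k) ;
  qrep_bounded : forall k, exists M : R, forall x, rnorm (Z k x) <= M * rnorm x ;
  qrep_bounded_adj : forall k, exists M : R, forall x, rnorm (Zs k x) <= M * rnorm x ;
  qrep_adj : forall k x y, hdot H (Z k x) y = hdot H x (Zs k y) ;
  qrep_zz : forall (j k : 'I_n) x, (j < k)%N -> Z j (Z k x) = q%:C *: Z k (Z j x) ;
  qrep_sz : forall (j k : 'I_n) x, j != k -> Zs j (Z k x) = q%:C *: Z k (Zs j x) ;
  qrep_ss : forall (j : 'I_n) x, Zs j (Z j x) = (q ^+ 2)%:C *: Z j (Zs j x) +
    (1 - q ^+ 2)%:C *: (x - \sum_(k < n | (j < k)%N) Z k (Zs k x))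
}.

Lemma linear_additive (K : pzRingType) (U V : lmodType K) (f : U -> V) : linear f ->
  [/\ f 0 = 0, forall x y, f (x + y) = f x + f y, forall x, f (- x) = - f x &
      forall c x, f (c *: x) = c *: f x].
Proof.
move=> lf; have D x y : f (x + y) = f x + f y by rewrite -[x]scale1r lf !scale1r.
have f0 : f 0 = 0.
  by have := D 0 0; rewrite addr0 => /esym/eqP; rewrite -subr_eq0 addrK => /eqP.
have fZ c x : f (c *: x) = c *: f x by rewrite -[c *: x]addr0 lf f0 addr0.
by split=> // x; rewrite -scaleN1r fZ scaleN1r.
Qed.

Lemma linear_sumE (K : pzRingType) (U V : lmodType K) (f : U -> V) I (s : seq I)
    (Q : pred I) (F : I -> U) : linear f ->
  f (\sum_(i <- s | Q i) F i) = \sum_(i <- s | Q i) f (F i).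
Proof. by case/linear_additive => f0 fD _ _; apply: big_morph. Qed.

Lemma decreasing_cauchy (R : realType) (a : nat -> R) :
  (forall k, 0 <= a k) -> (forall k, a k.+1 <= a k) ->
  exists L, 0 <= L /\ forall e, 0 < e ->
    exists N, forall k, (N <= k)%N -> L <= a k < L + e.
Proof.
move=> a0 aS; pose S := [set a k | k in [set: nat]].
have hS : has_inf S by split; [exists (a 0%N); exists 0%N|exists 0 => _ [k _ <-]].
exists (inf S); split; first by apply: lb_le_inf; [case: hS|move=> _ [k _ <-]].
move=> e e0; have [_ [N _ <-] hN] := inf_adherent e0 hS.
exists N => k Nk; rewrite (inf_lbound hS.2) /=; last by exists k.
apply: le_lt_trans hN; rewrite -(subnKC Nk); elim: (k - N)%N => [|j ih].
  by rewrite addn0.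
by rewrite addnS (le_trans (aS _)).
Qed.

Section Spectral.
Context {R : realType} {q : R} {n : nat} {H : hilbertType R}.
Hypothesis hq : 0 < q < 1.
Variables Z Zs : 'I_n -> H -> H.
Hypothesis hZ : qrep q Z Zs.
Local Notation C := R[i].

Let ZD k x y : Z k (x + y) = Z k x + Z k y.
Proof. by case: (linear_additive (qrep_linear hZ k)). Qed.
Let ZN k x : Z k (- x) = - Z k x.
Proof. by case: (linear_additive (qrep_linear hZ k)). Qed.
Let ZZ k c x : Z k (c *: x) = c *: Z k x.
Proof. by case: (linear_additive (qrep_linear hZ k)). Qed.

Definition qX (x : H) : H := x - \sum_k Z k (Zs k x).

Lemma qX_linear : linear qX.
Proof.
move=> a x y; rewrite /qX.
under eq_bigr => k _ do rewrite (qrep_linear_adj hZ) (qrep_linear hZ).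
by rewrite big_split /= -scaler_sumr scalerBr opprD addrACA.
Qed.

Lemma qrep_adjr k x y : hdot H (Zs k x) y = hdot H x (Z k y).
Proof. by rewrite hdotC -(qrep_adj hZ) -hdotC. Qed.

Lemma qX_adj x y : hdot H (qX x) y = hdot H x (qX y).
Proof.
rewrite /qX hdotBl hdotBr hdot_suml hdot_sumr; congr (_ - _).
by apply: eq_bigr => k _; rewrite (qrep_adj hZ) qrep_adjr.
Qed.

(** Moving [Z i] to the left across Z k Zs k gives a factor q^2 for k < i and 1 for k > i. The
    inhomogeneous term of the relation for k = i turns the coefficients of the identity and of the
    terms k > i into q^2 as well. *)
Lemma qX_Z i x : qX (Z i x) = (q ^+ 2)%:C *: Z i (qX x).
Proof.
have split3 (F : 'I_n -> H) : \sum_k F k =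
    \sum_(k < n | (k < i)%N) F k + F i + \sum_(k < n | (i < k)%N) F k.
  rewrite (bigID (fun k : 'I_n => (i < k)%N)) /= addrC; congr (_ + _).
  under eq_bigl => k do rewrite -leqNgt leq_eqVlt.
  rewrite (bigD1 i) /= ?eqxx // addrC; congr (_ + _); apply: eq_bigl => k.
  have [->|ki] := eqVneq k i; first by rewrite eqxx ltnn.
  by rewrite andbT; case: ltngtP ki => // /val_inj ->; rewrite eqxx.
rewrite /qX !split3 (qrep_ss hZ).
have -> : \sum_(k < n | (k < i)%N) Z k (Zs k (Z i x)) =
    (q ^+ 2)%:C *: Z i (\sum_(k < n | (k < i)%N) Z k (Zs k x)).
  rewrite (linear_sumE _ _ _ (qrep_linear hZ i)) scaler_sumr; apply: eq_bigr => k ki.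
  rewrite (qrep_sz hZ) ?ZZ; last by rewrite neq_ltn ki.
  by rewrite (qrep_zz hZ) // scalerA -rcM.
have -> : \sum_(k < n | (i < k)%N) Z k (Zs k (Z i x)) =
    Z i (\sum_(k < n | (i < k)%N) Z k (Zs k x)).
  rewrite (linear_sumE _ _ _ (qrep_linear hZ i)); apply: eq_bigr => k ik.
  rewrite (qrep_sz hZ) ?ZZ; last by rewrite neq_ltn ik orbT.
  by rewrite (qrep_zz hZ _ ik).
set a := \sum_(_ < _ | _) _; set b := \sum_(_ < _ | _) _.
rewrite !(ZD, ZN, ZZ) rcB rcX; hring.
Qed.

Lemma qX_Zs i x : Zs i (qX x) = (q ^+ 2)%:C *: qX (Zs i x).
Proof.
apply: hdot_inj => z; rewrite qrep_adjr qX_adj qX_Z hdotZl hdotZr rc_conj.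
by rewrite qX_adj qrep_adjr.
Qed.

Lemma qX_self k x : rdot (qX x) (Z k (Zs k x)) = q ^+ 2 * rdot (qX (Zs k x)) (Zs k x).
Proof. by rewrite -rdotZl -qX_Zs /rdot qrep_adjr. Qed.

Let W (x : H) := \sum_k Z k (Zs k x).

Let rdotW x y : rdot (W x) y = \sum_k rdot (Zs k x) (Zs k y).
Proof. by rewrite rdot_suml; apply: eq_bigr => k _; rewrite /rdot (qrep_adj hZ). Qed.

Let rdotWW x : rdot (W x) x = \sum_k rnorm (Zs k x) ^+ 2.
Proof. by rewrite rdotW; apply: eq_bigr => k _; rewrite rdotxx. Qed.

Let qXW x : rdot (qX x) (W x) = q ^+ 2 * \sum_k rdot (qX (Zs k x)) (Zs k x).
Proof.
by rewrite rdotC rdot_suml mulr_sumr; apply: eq_bigr => k _; rewrite rdotC qX_self.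
Qed.

Let q0 : 0 < q. Proof. by case/andP: hq. Qed.
Let q1 : q < 1. Proof. by case/andP: hq. Qed.

Let qq_ge0 : 0 <= q ^+ 2. Proof. exact/exprn_ge0/ltW/q0. Qed.

(** Put t = r q^2 and W = 1 - X. The hypothesis at the vectors Zs k x says that X W >= - t W as
    forms, that is, W^2 <= (1 + t) W. Hence W <= 1 + t, so X >= - t. *)
Let qX_ge_step r : 0 <= r -> (forall x, - r * rnorm x ^+ 2 <= rdot (qX x) x) ->
  forall x, - (r * q ^+ 2) * rnorm x ^+ 2 <= rdot (qX x) x.
Proof.
move=> r0 hr x; set t := r * q ^+ 2.
have t0 : 0 <= t by rewrite mulr_ge0 // qq_ge0.
have h1 : - t * rdot (W x) x <= rdot (qX x) (W x).
  rewrite qXW rdotWW /t mulNr -mulrA mulrCA -mulrN ler_wpM2l ?exprn_ge0 ?(ltW q0) //.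
  by rewrite mulr_sumr -sumrN ler_sum // => k _; rewrite -mulNr hr.
have h2 : rdot (qX x) (W x) = rdot (W x) x - rnorm (W x) ^+ 2.
  by rewrite -rdotxx /qX rdotBl rdotC.
have h3 := rdot_CS (W x) x.
have h4 : rnorm (W x) <= (1 + t) * rnorm x.
  have [->|w0] := eqVneq (rnorm (W x)) 0; first by rewrite mulr_ge0 ?addr_ge0.
  have w1 : 0 < rnorm (W x) by rewrite lt_def w0 rnorm_ge0.
  rewrite -(ler_pM2r w1).
  have : rnorm (W x) ^+ 2 <= (1 + t) * rdot (W x) x by rewrite h2 in h1; lra.
  have : (1 + t) * rdot (W x) x <= (1 + t) * (rnorm (W x) * rnorm x).
    by rewrite ler_wpM2l ?addr_ge0.
  lra.
have h5 : rnorm (W x) * rnorm x <= (1 + t) * rnorm x * rnorm x by rewrite ler_wpM2r.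
rewrite /qX rdotBl rdotxx -/(W x); lra.
Qed.

Let qpow_small e : 0 < e -> exists k, (q ^+ 2) ^+ k < e.
Proof.
move=> e0; have p0 := qq_ge0.
have p1 : `|q ^+ 2| < 1 by rewrite ger0_norm // expr_lt1 ?q1 ?(ltW q0).
have /cvgrPdist_lt/(_ e e0) [k _ /(_ k (leqnn k))] := cvg_expr p1.
rewrite /= sub0r normrN ger0_norm => [hk|]; [by exists k|exact: (exprn_ge0 k p0)].
Qed.

(** Boundedness gives X >= - K, and each use of [qX_ge_step] multiplies the constant by q^2. *)
Lemma qX_ge0 x : 0 <= rdot (qX x) x.
Proof.
pose M k := `|projT1 (cid (qrep_bounded_adj hZ k))|.
have hM k y : rnorm (Zs k y) <= M k * rnorm y.
  apply: (le_trans (projT2 (cid (qrep_bounded_adj hZ k)) y)).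
  by rewrite ler_wpM2r // ler_norm.
have M0 k : 0 <= M k by exact: normr_ge0.
pose K := \sum_k M k ^+ 2.
have K0 : 0 <= K by apply: sumr_ge0 => k _; exact/exprn_ge0/M0.
have step0 y : - K * rnorm y ^+ 2 <= rdot (qX y) y.
  have : rdot (W y) y <= K * rnorm y ^+ 2.
    rewrite rdotWW mulr_suml ler_sum // => k _.
    by rewrite -exprMn ler_pXn2r ?nnegrE ?mulr_ge0 ?M0 ?hM.
  have := exprn_ge0 2 (rnorm_ge0 y).
  rewrite /qX rdotBl rdotxx -/(W y); lra.
have step k : forall y, - (K * (q ^+ 2) ^+ k) * rnorm y ^+ 2 <= rdot (qX y) y.
  elim: k => [|k ih]; first by rewrite expr0 mulr1.
  rewrite exprSr mulrA; apply: qX_ge_step => //.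
  by rewrite mulr_ge0 // exprn_ge0 // qq_ge0.
apply: (@ler_addeps_mul _ _ _ (K * rnorm x ^+ 2)) => e e0.
have [k hk] := qpow_small e0; have := step k x.
have : (q ^+ 2) ^+ k * (K * rnorm x ^+ 2) <= e * (K * rnorm x ^+ 2).
  by rewrite ler_wpM2r ?mulr_ge0 ?exprn_ge0 // ltW.
lra.
Qed.

(** Positivity at the vectors Zs k x, combined with [qXW], says that X (1 - X) >= 0. *)
Lemma qX_sqr_le x : rnorm (qX x) ^+ 2 <= rdot (qX x) x.
Proof.
have : 0 <= rdot (qX x) (W x).
  rewrite qXW mulr_ge0 ?qq_ge0 // sumr_ge0 // => k _; exact: qX_ge0.
have -> : W x = x - qX x by rewrite /qX opprB addrC subrK.
by rewrite rdotBr rdotxx; lra.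
Qed.

Lemma qX_contr x : rnorm (qX x) <= rnorm x.
Proof.
have := qX_sqr_le x; have := rdot_CS (qX x) x.
have := rnorm_ge0 (qX x); have := rnorm_ge0 x => *; nra.
Qed.

Let qXD x y : qX (x + y) = qX x + qX y. Proof. by case: (linear_additive qX_linear). Qed.
Let qXB x y : qX (x - y) = qX x - qX y.
Proof. by case: (linear_additive qX_linear) => _ _ h _; rewrite qXD h. Qed.

(** The moments [rdot (Y k x) x] stand in for the spectral measure of X at x. Even ones are squared
    norms, odd ones are values of the form of X, which makes the sequence nonnegative and
    nonincreasing. *)
Let Y k x := iter k qX x.

Let Y_adj k l x : rdot (Y k x) (Y l x) = rdot (Y (k + l) x) x.
Proof.
elim: k l => [|k ih] l; first by rewrite rdotC.
by rewrite /rdot /Y iterS qX_adj -iterS -/(rdot _ _) -/(Y k x) -/(Y l.+1 x) ih addnS.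
Qed.

Let Yeven k x : rdot (Y (k + k) x) x = rnorm (Y k x) ^+ 2.
Proof. by rewrite -Y_adj rdotxx. Qed.

Let parity k : exists l, k = (l + l)%N \/ k = (l + l).+1.
Proof.
exists k./2; have := odd_double_half k; rewrite -addnn.
by case: (odd k) => h; [right|left]; rewrite -[LHS]h.
Qed.

Let Yodd k x : rdot (Y (k + k).+1 x) x = rdot (qX (Y k x)) (Y k x).
Proof. by rewrite -[qX _]/(Y k.+1 x) Y_adj addSn. Qed.

Let Y_ge0 k x : 0 <= rdot (Y k x) x.
Proof.
have [l [->|->]] := parity k; first by rewrite Yeven exprn_ge0.
by rewrite Yodd qX_ge0.
Qed.

Let Y_le k x : rdot (Y k.+1 x) x <= rdot (Y k x) x.
Proof.
have [l [->|->]] := parity k.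
  rewrite Yodd Yeven; have := rdot_CS (qX (Y l x)) (Y l x).
  have := qX_contr (Y l x); have := rnorm_ge0 (Y l x).
  by rewrite expr2 => h1 h2 h3; apply: (le_trans h3); rewrite ler_wpM2r.
rewrite Yodd -addSn -addnS Yeven; exact: qX_sqr_le.
Qed.

(** Let a_k be the moments. The hypothesis at the vectors Zs k y shows that the differences a_k -
    a_(k+1) shrink by the factor r q^2, so c_k = r q^2 a_k - a_(k+1) is nonincreasing. As a_k
    becomes small, c_1 >= 0, which is the claim. Smallness of the moments is what excludes the
    eigenvalue 1, which the contraction cannot remove. *)
Let vacuum_step r : (forall x e, 0 < e -> exists k, rdot (Y k x) x < e) -> 0 <= r ->
  (forall x, rnorm (qX x) ^+ 2 <= r * rdot (qX x) x) ->
  forall x, rnorm (qX x) ^+ 2 <= r * q ^+ 2 * rdot (qX x) x.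
Proof.
move=> lim0 r0 hr x.
have qq0 : 0 < q ^+ 2 by rewrite exprn_gt0 // q0.
have hr' y : rdot (qX y) y <= r * rnorm y ^+ 2.
  have h2 := rdot_CS (qX y) y; have h3 := hr y.
  have h1 : rnorm (qX y) <= r * rnorm y.
    have [->|w0] := eqVneq (rnorm (qX y)) 0; first by rewrite mulr_ge0.
    have w1 : 0 < rnorm (qX y) by rewrite lt_def w0 rnorm_ge0.
    rewrite -(ler_pM2r w1).
    have := ler_wpM2l r0 h2; lra.
  by apply: (le_trans h2); rewrite expr2 mulrA ler_wpM2r.
have WE y : W y = y - qX y by rewrite /qX opprB addrC subrK.
pose a k := rdot (Y k x) x.
have hA y : rdot (qX y) (W y) <= r * q ^+ 2 * rdot (W y) y.
  have hs : \sum_k rdot (qX (Zs k y)) (Zs k y) <= r * \sum_k rnorm (Zs k y) ^+ 2.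
    by rewrite mulr_sumr ler_sum // => k _; exact: hr'.
  by rewrite qXW rdotWW; have := ler_wpM2l qq_ge0 hs; lra.
have hB y : rdot (W (qX y)) (qX y) <= r * q ^+ 2 * rdot (qX y) (W y).
  have hs : \sum_k rnorm (qX (Zs k y)) ^+ 2 <= r * \sum_k rdot (qX (Zs k y)) (Zs k y).
    by rewrite mulr_sumr ler_sum // => k _; exact: hr.
  have -> : rdot (W (qX y)) (qX y) = q ^+ 2 * (q ^+ 2 * \sum_k rnorm (qX (Zs k y)) ^+ 2).
    rewrite rdotWW !mulr_sumr; apply: eq_bigr => k _.
    by rewrite qX_Zs rnormZ rnorm_real ger0_norm ?qq_ge0 // exprMn expr2 mulrA.
  by rewrite qXW; have := ler_wpM2l qq_ge0 (ler_wpM2l qq_ge0 hs); lra.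
have bS k : a k.+1 - a k.+2 <= r * q ^+ 2 * (a k - a k.+1).
  have [l [->|->]] := parity k.
    have := hA (Y l x); rewrite WE rdotBl rdotBr -[qX (Y l x)]/(Y l.+1 x) !Y_adj.
    by rewrite !addSn !addnS.
  have := hB (Y l x); rewrite !WE rdotBl rdotBr -[qX (Y l x)]/(Y l.+1 x).
  by rewrite -[qX (Y l.+1 x)]/(Y l.+2 x) !Y_adj !addSn !addnS.
pose c k := r * q ^+ 2 * a k - a k.+1.
have cS k : c k.+1 <= c k by rewrite /c; have := bS k; lra.
have c1 k : c k.+1 <= c 1%N by elim: k => // k ih; exact: le_trans (cS _) ih.
suff : 0 <= c 1%N.
  by rewrite /c /a -[2%N]/(1 + 1)%N Yeven -[1%N]/(0 + 0).+1 Yodd /Y /=; lra.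
rewrite leNgt; apply/negP => c0.
have [|k hk] := lim0 x (- c 1%N); first by rewrite oppr_gt0.
have : a k.+2 <= a k by exact: le_trans (Y_le _ _) (Y_le _ _).
have := c1 k; have := Y_ge0 k.+1 x; rewrite -/(a k.+1) => p0.
have : 0 <= r * q ^+ 2 * a k.+1 by rewrite mulr_ge0 // mulr_ge0 // qq_ge0.
have : c k.+1 = r * q ^+ 2 * a k.+1 - a k.+2 by [].
have hk' : a k < - c 1%N := hk; move: (c k.+1) (c 1%N) hk' c0 => u u1 hk' c0; lra.
Qed.

(** The powers X^k x form a Cauchy sequence, because the moments converge, and their limit u
    satisfies X u = u. Then the sum of the |Zs k u|^2 vanishes: u is a vacuum or 0. If there is no
    vacuum, all moments tend to 0 and [vacuum_step] can be iterated. *)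
Lemma vacuum_exists : (forall x, qX x = 0) \/ exists2 v, v != 0 & forall k, Zs k v = 0.
Proof.
have [|nov] := pselect (exists2 v, v != 0 & forall k, Zs k v = 0); [by right|left].
have lim0 x e : 0 < e -> exists k, rdot (Y k x) x < e.
  move=> e0; pose a k := rdot (Y k x) x.
  have [L [L0 hL]] := decreasing_cauchy (fun k => Y_ge0 k x) (fun k => Y_le k x).
  have YY k l : rnorm (Y k x - Y l x) ^+ 2 = a (k + k)%N + a (l + l)%N - a (k + l)%N *+ 2.
    rewrite -rdotxx rdotBl !rdotBr !Y_adj [(l + k)%N]addnC /a; ring.
  have [u hu] : exists u, forall e, 0 < e -> exists k, forall i, (k <= i)%N ->
      rnorm (Y i x - u) < e.
    apply: (@rnorm_complete _ _ (fun k => Y k x)) => d d0.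
    have [|N hN] := hL (d ^+ 2 / 2); first by rewrite divr_gt0 ?exprn_gt0.
    exists N => i j Ni Nj; rewrite -(@ltr_pXn2r _ 2) ?nnegrE ?(ltW d0) // YY.
    have /andP[_ h1] := hN (i + i)%N (leq_trans Ni (leq_addr _ _)).
    have /andP[_ h2] := hN (j + j)%N (leq_trans Nj (leq_addr _ _)).
    have /andP[h3 _] := hN (i + j)%N (leq_trans Ni (leq_addr _ _)).
    rewrite mulr2n /a; lra.
  have Xu : qX u = u.
    apply/subr0_eq/(@rnorm_le_eps _ _ _ 2) => d /hu [k hk].
    have h1 := hk _ (leqnSn k); have h2 := hk _ (leqnn k).
    rewrite (le_trans (rnorm_dist (Y k.+1 x) _ _)) //.
    have := qX_contr (u - Y k x); rewrite qXB (rnormB u) -[qX (Y k x)]/(Y k.+1 x); lra.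
  have u0 : u = 0.
    apply/eqP/negPn/negP => u0; apply: nov; exists u => // k.
    have : rdot (W u) u = 0.
      have -> : W u = u - qX u by rewrite /qX opprB addrC subrK.
      by rewrite Xu subrr rdot0l.
    rewrite rdotWW => /eqP; rewrite psumr_eq0 => [/allP h|i _]; last exact: exprn_ge0.
    apply: rnorm0_eq0; apply/eqP; rewrite -sqrf_eq0.
    by apply: h; rewrite mem_index_enum.
  have s0 : 0 < Num.sqrt e by rewrite sqrtr_gt0.
  have [k /(_ k (leqnn k))] := hu _ s0; rewrite u0 subr0 => hk.
  exists (k + k)%N; rewrite Yeven -[e]sqr_sqrtr ?ltW //.
  by rewrite ltr_pXn2r ?nnegrE ?(ltW s0).
have step k : forall x, rnorm (qX x) ^+ 2 <= (q ^+ 2) ^+ k * rdot (qX x) x.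
  elim: k => [|k ih] x; first by rewrite expr0 mul1r qX_sqr_le.
  by rewrite (exprSr (q ^+ 2) k); apply: vacuum_step => //; exact: (exprn_ge0 k qq_ge0).
move=> x; apply: rnorm0_eq0; apply/eqP; rewrite -sqrf_eq0 eq_le exprn_ge0 // andbT.
apply: (@ler_addeps_mul _ _ _ (rdot (qX x) x)) => e e0; rewrite add0r.
have [k hk] := qpow_small e0; apply: le_trans (step k x) _.
by rewrite ler_wpM2r ?qX_ge0 // ltW.
Qed.

End Spectral.

(** * Presentation of Pol(C^n)_q by operators *)

Section QrepOfStarrep.
Local Open Scope quotient_scope.
Context {R : realType} {q : R} {n : nat} {H : hilbertType R} {T : Pol q n -> H -> H}.
Hypothesis hT : starrep T.

Lemma qrep_of_starrep :
  qrep q (fun k => T (pol_z q k)) (fun k => T (star (pol_z q k))).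
Proof.
split.
- by move=> k; exact: (starrep_linear hT).
- by move=> k; exact: (starrep_linear hT).
- by move=> k; exact: (starrep_bounded hT).
- by move=> k; exact: (starrep_bounded hT).
- by move=> k x y; exact: (starrep_adj hT).
- by move=> j k x jk; rewrite -!(starrepM hT) pol_z_mul // (starrepZ hT).
- by move=> j k x jk; rewrite -!(starrepM hT) pol_star_z_mul // (starrepZ hT).
- move=> j x; rewrite -(starrepM hT) pol_star_z_z (starrepD hT) !(starrepZ hT).
  rewrite (starrepM hT) (starrepB hT) (starrep1 hT) (starrep_sum hT).
  by congr (_ + _ *: (_ - _)); apply: eq_bigr => k _; rewrite (starrepM hT).
Qed.

Lemma starrep_x1 x : T (1 - \sum_(k < n) pol_z q k * star (pol_z q k)) x =
  qX (fun k => T (pol_z q k)) (fun k => T (star (pol_z q k))) x.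
Proof.
rewrite (starrepB hT) (starrep1 hT) (starrep_sum hT); congr (_ - _).
by apply: eq_bigr => k _; rewrite (starrepM hT).
Qed.

Lemma starrep_invariant (V : set H) : V 0 ->
  (forall x y, V x -> V y -> V (x + y)) -> (forall (c : R[i]) x, V x -> V (c *: x)) ->
  (forall k x, V x -> V (T (pol_z q k) x)) ->
  (forall k x, V x -> V (T (star (pol_z q k)) x)) ->
  forall f x, V x -> V (T f x).
Proof.
move=> V0 VD VZ Vz Vs.
(* The induction follows each term together with its adjoint, since [QStar] may occur at any
   depth. *)
suff h (t : qterm R n) : forall x, V x ->
    V (T (\pi_(Pol q n) t) x) /\ V (T (star (\pi_(Pol q n) t)) x).
  by move=> f x; rewrite -[f]reprK => /(h (repr f)) [].
elim: t => [k|a|s ihs t iht|s ihs t iht|s ihs] x Vx.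
- by split; [exact: Vz|exact: Vs].
- have aE (b : R[i]) : \pi_(Pol q n) (QScal b) = b *: 1.
    by rewrite -[RHS]/(pol_mul (pol_scal q n b) (pol_scal q n 1)) polM; apply/polP;
      apply: qtrans (qscalC _ _ _); apply/qsym/qmul1.
  by rewrite aE starZ star1 !(starrepZ hT) (starrep1 hT); split; exact: VZ.
- have [s1 s2] := ihs x Vx; have [t1 t2] := iht x Vx.
  by rewrite -pi_D starD !(starrepD hT); split; exact: VD.
- rewrite -pi_M starM !(starrepM hT); split.
    by apply: (ihs _ _).1; apply: (iht _ _).1.
  by apply: (iht _ _).2; apply: (ihs _ _).2.
- by rewrite -pi_S starK; have [] := ihs x Vx.
Qed.

End QrepOfStarrep.

Section StarrepOfQrep.
Local Open Scope quotient_scope.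
Context {R : realType} {q : R} {n : nat} {H : hilbertType R}.
Variables Z Zs : 'I_n -> H -> H.
Hypothesis hZ : qrep q Z Zs.
Local Notation C := R[i].

(** An operator is evaluated together with its adjoint, so that [QStar] only swaps the two and
    existence of adjoints is never invoked. *)
Fixpoint qeval (t : qterm R n) : (H -> H) * (H -> H) :=
  match t with
  | QGen k => (Z k, Zs k)
  | QScal a => (fun x => a *: x, fun x => (a^*)%R *: x)
  | QAdd s t => (fun x => (qeval s).1 x + (qeval t).1 x,
                 fun x => (qeval s).2 x + (qeval t).2 x)
  | QMul s t => (fun x => (qeval s).1 ((qeval t).1 x),
                 fun x => (qeval t).2 ((qeval s).2 x))
  | QStar s => ((qeval s).2, (qeval s).1)
  end.

Lemma qeval_linear t : linear (qeval t).1 /\ linear (qeval t).2.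
Proof.
elim: t => [k|b|s [l1 l2] t [l3 l4]|s [l1 l2] t [l3 l4]|s [l1 l2]] /=.
- by split; [exact: qrep_linear hZ k|exact: qrep_linear_adj hZ k].
- by split=> a x y; rewrite scalerDr !scalerA mulrC.
- by split=> a x y; rewrite ?l1 ?l2 ?l3 ?l4 scalerDr addrACA.
- by split=> a x y; rewrite ?l1 ?l2 ?l3 ?l4 ?l1 ?l2 ?l4.
- by [].
Qed.

Lemma qeval_bounded t : (exists M : R, forall x, rnorm ((qeval t).1 x) <= M * rnorm x) /\
  (exists M : R, forall x, rnorm ((qeval t).2 x) <= M * rnorm x).
Proof.
have sum (f g : H -> H) : (exists M : R, forall x, rnorm (f x) <= M * rnorm x) ->
    (exists M : R, forall x, rnorm (g x) <= M * rnorm x) ->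
    exists M : R, forall x, rnorm (f x + g x) <= M * rnorm x.
  move=> [M hM] [M' hM']; exists (M + M') => x.
  by rewrite (le_trans (rnormD _ _)) // mulrDl lerD.
have comp (f g : H -> H) : (exists M : R, forall x, rnorm (f x) <= M * rnorm x) ->
    (exists M : R, forall x, rnorm (g x) <= M * rnorm x) ->
    exists M : R, forall x, rnorm (f (g x)) <= M * rnorm x.
  move=> [M hM] [M' hM']; exists (`|M| * M') => x.
  apply: (le_trans (hM _)); apply: (@le_trans _ _ (`|M| * rnorm (g x))).
    by rewrite ler_wpM2r // ler_norm.
  by rewrite -mulrA ler_wpM2l.
elim: t => [k|b|s [l1 l2] t [l3 l4]|s [l1 l2] t [l3 l4]|s [l1 l2]] /=.
- by split; [exact: qrep_bounded hZ k|exact: qrep_bounded_adj hZ k].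
- by split; [exists (rnorm b)|exists (rnorm (b^*)%R)] => x; rewrite rnormZ.
- by split; exact: sum.
- by split; exact: comp.
- by [].
Qed.

Lemma qeval_adj t x y : hdot H ((qeval t).1 x) y = hdot H x ((qeval t).2 y).
Proof.
elim: t x y => [k|b|s ihs t iht|s ihs t iht|s ihs] x y /=.
- exact: qrep_adj hZ k x y.
- by rewrite hdotZl hdotZr conjCK.
- by rewrite hdotDl hdotDr ihs iht.
- by rewrite ihs iht.
- by rewrite hdotC -ihs -hdotC.
Qed.

Lemma qeval_big (Q : pred 'I_n) x :
  (qeval (\big[QAdd/QScal 0]_(k < n | Q k) QMul (QGen k) (QStar (QGen k)))).1 x =
  \sum_(k < n | Q k) Z k (Zs k x).
Proof.
by apply: (big_morph (fun t => (qeval t).1 x)) => //=; rewrite scale0r.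
Qed.

(** Uniqueness of adjoints; it makes the evaluation compatible with the congruence rule for
    [QStar]. *)
Lemma qeval_adj_eq s t : (qeval s).1 =1 (qeval t).1 -> (qeval s).2 =1 (qeval t).2.
Proof.
move=> e x; apply: hdot_inj => z.
by rewrite hdotC -qeval_adj e qeval_adj -hdotC.
Qed.

Lemma qeval_cong s t : qcong q s t -> (qeval s).1 =1 (qeval t).1.
Proof.
have lin t' : [/\ (qeval t').1 0 = 0,
    forall x y, (qeval t').1 (x + y) = (qeval t').1 x + (qeval t').1 y,
    forall x, (qeval t').1 (- x) = - (qeval t').1 x &
    forall c x, (qeval t').1 (c *: x) = c *: (qeval t').1 x].
  by apply: linear_additive; case: (qeval_linear t').
elim=> //= {s t}.
- by move=> x y _ e v; rewrite e.
- by move=> x y t _ e1 _ e2 v; rewrite e1 e2.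
- by move=> x x' y y' _ e1 _ e2 v; rewrite e1 e2.
- by move=> x x' y y' _ e1 _ e2 v; rewrite e2 e1.
- by move=> x x' _ /qeval_adj_eq.
- by move=> x y t v; rewrite addrA.
- by move=> x y v; rewrite addrC.
- by move=> x v; rewrite scale0r add0r.
- by move=> x v; rewrite scale1r.
- by move=> x v; rewrite !scale0r.
- by move=> x y t v; case: (lin t) => _ ->.
- by move=> a b v; rewrite scalerDl.
- by move=> a b v; rewrite scalerA.
- by move=> a x v; case: (lin x) => _ _ _ ->.
- by move=> j k jk v; exact: (qrep_zz hZ).
- by move=> j k jk v; exact: (qrep_sz hZ).
- by move=> j v; rewrite (qrep_ss hZ) qeval_big scale1r scaleN1r.
Qed.

Definition starrep_of_qrep (f : Pol q n) : H -> H := (qeval (repr f)).1.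

Lemma starrep_of_qrep_pi t : starrep_of_qrep (\pi t) = (qeval t).1.
Proof. by apply/funext/qeval_cong/polP; rewrite reprK. Qed.

Lemma starrep_of_qrepP : starrep starrep_of_qrep.
Proof.
split.
- by move=> f; case: (qeval_linear (repr f)).
- by move=> f; case: (qeval_bounded (repr f)).
- by move=> f g x; rewrite -[f]reprK -[g]reprK pi_D !starrep_of_qrep_pi.
- by move=> c f x; rewrite -[f]reprK pi_Z !starrep_of_qrep_pi.
- by move=> x; rewrite -[1]/(\pi_(Pol q n) (QScal 1)) starrep_of_qrep_pi /= scale1r.
- by move=> f g x; rewrite -[f]reprK -[g]reprK pi_M !starrep_of_qrep_pi.
- move=> f x y; rewrite -[f]reprK pi_S !starrep_of_qrep_pi; exact: qeval_adj.
Qed.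

Lemma starrep_of_qrep_z k : starrep_of_qrep (pol_z q k) = Z k.
Proof. exact: starrep_of_qrep_pi. Qed.

Lemma starrep_of_qrep_zs k : starrep_of_qrep (star (pol_z q k)) = Zs k.
Proof. by rewrite /pol_z pi_S starrep_of_qrep_pi. Qed.

End StarrepOfQrep.

(** * Subspaces of Hilbert spaces *)

Section ClosedSubspace.
Context {R : realType} {H : hilbertType R} (V : set H).
Local Notation C := R[i].
Hypothesis hV : closed_subspace V.

Definition subspace_pred of closed_subspace V : {pred H} := fun x => `[< V x >].
Local Notation S := (subspace_pred hV).

Lemma subspace_pred_closed : submod_closed S.
Proof.
have [_ V0 VD VZ] := hV; split; first exact/asboolP.
by move=> a x y /asboolP Vx /asboolP Vy; apply/asboolP/VD => //; exact: VZ.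
Qed.

HB.instance Definition _ := GRing.isSubmodClosed.Build C H S subspace_pred_closed.

Record subspace_type := SubspaceType { subspace_val :> H ; _ : subspace_val \in S }.

HB.instance Definition _ := [isSub for subspace_val].
HB.instance Definition _ := [Choice of subspace_type by <:].
HB.instance Definition _ := [SubChoice_isSubLmodule of subspace_type by <:].

Definition subspace_dot (x y : subspace_type) : C := hdot H (\val x) (\val y).

Lemma subspace_axioms : hilbert_axioms subspace_dot.
Proof.
split; first split.
- by move=> a x y z; rewrite /subspace_dot linearP hdotDl hdotZl.
- by move=> x y; exact: hdotC.
- move=> x x0; apply: (inner_gt0 hdot_inner).
  by apply: contra_neq x0 => x0; apply: val_inj; rewrite x0 raddf0.
move=> u hu.
have rE x y : subspace_dot (x - y) (x - y) = (rnorm (\val x - \val y : H) ^+ 2)%:C.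
  by rewrite /subspace_dot (raddfB (\val : subspace_type -> H)) hdotxx.
have [l hl] : exists l, forall e, 0 < e ->
    exists k, forall i, (k <= i)%N -> rnorm (\val (u i) - l : H) < e.
  apply: (@rnorm_complete _ H (fun k => \val (u k))) => e e0.
  have [k hk] := hu e e0; exists k => i j ki kj; have := hk i j ki kj.
  by rewrite rE ltcR ltr_pXn2r ?nnegrE ?(ltW e0).
have Vl : l \in S.
  apply/asboolP; have [/closedP_rnorm cV _ _ _] := hV; apply: cV => e e0.
  have [k /(_ k (leqnn k)) hk] := hl e e0; exists (\val (u k)); last by rewrite rnormB.
  by have /asboolP := valP (u k).
exists (SubspaceType Vl) => e e0; have [k hk] := hl e e0; exists k => i ki.
by rewrite rE ltcR ltr_pXn2r ?nnegrE ?(ltW e0) // hk.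
Qed.

(** Only an isometry onto [V] is exported; later arguments compute in [H] through [J] and never see
    the subtype. *)
Lemma closed_subspace_hilbert : exists (W : hilbertType R) (J : W -> H),
  [/\ linear J, forall x y, hdot W x y = hdot H (J x) (J y) & range J = V].
Proof.
exists (hilbert_of subspace_axioms), (fun x => subspace_val x); split=> //.
  apply/seteqP; split=> [_ [x _ <-]|x Vx]; first by have /asboolP := valP (x : subspace_type).
  have Sx : x \in S by apply/asboolP.
  by exists (SubspaceType Sx).
Qed.

End ClosedSubspace.

Inductive lspan (R : realType) (H : lmodType R[i]) (S : set H) : H -> Prop :=
| lspan0 : lspan S 0
| lspanD c x y : S x -> lspan S y -> lspan S (c *: x + y).

Section Lspan.
Context {R : realType} {H : lmodType R[i]}.
Implicit Types S : set H.

Lemma lspan_add S x y : lspan S x -> lspan S y -> lspan S (x + y).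
Proof.
move=> + hy; elim=> [|c u w Su _ ih]; first by rewrite add0r.
by rewrite -addrA; exact: lspanD.
Qed.

Lemma lspan_scale S c x : lspan S x -> lspan S (c *: x).
Proof.
elim=> [|d u w Su _ ih]; first by rewrite scaler0; exact: lspan0.
by rewrite scalerDr scalerA; exact: lspanD.
Qed.

Lemma lspan_mem S x : S x -> lspan S x.
Proof. by move=> Sx; rewrite -[x]addr0 -[x]scale1r; apply: lspanD => //; exact: lspan0. Qed.

End Lspan.

Lemma lspan_map (R : realType) (H H' : lmodType R[i]) (S : set H) (S' : set H') (f : H -> H') : linear f ->
  (forall x, S x -> lspan S' (f x)) -> forall x, lspan S x -> lspan S' (f x).
Proof.
move=> /linear_additive [f0 fD _ fZ] h x.
elim=> [|c u w Su _ ih]; first by rewrite f0; exact: lspan0.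
by rewrite fD fZ; apply: lspan_add => //; apply: lspan_scale; exact: h.
Qed.


Section Density.
Context {R : realType} {q : R} {n : nat} {H : hilbertType R} {T : Pol q n -> H -> H}.
Hypotheses (hT : starrep T) (iT : irreducible T).

(** The closure of the span of [S] is a closed invariant subspace containing the nonzero vector
    [x0]. *)
Lemma irreducible_dense (S : set H) (x0 : H) : S x0 -> x0 != 0 ->
  (forall k x, S x -> lspan S (T (pol_z q k) x)) ->
  (forall k x, S x -> lspan S (T (star (pol_z q k)) x)) ->
  forall x e, 0 < e -> exists2 y, lspan S y & rnorm (x - y) < e.
Proof.
move=> Sx0 x00 hz hs; pose V := closure (lspan S : set H).
have Vspan x : lspan S x -> V x by exact: subset_closure.
have cV : closed_subspace V.
  split; first exact: closed_closure.
  - exact/Vspan/lspan0.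
  - move=> x y /closureP_rnorm Vx /closureP_rnorm Vy; apply/closureP_rnorm => e e0.
    have [|x' Sx xx] := Vx (e / 2); first by rewrite divr_gt0.
    have [|y' Sy yy] := Vy (e / 2); first by rewrite divr_gt0.
    exists (x' + y'); first exact: lspan_add.
    by rewrite opprD addrACA (le_lt_trans (rnormD _ _)) // (splitr e) ltrD.
  - move=> c x /closureP_rnorm Vx; apply/closureP_rnorm => e e0.
    have c1 : 0 < rnorm c + 1 by rewrite ltr_wpDl.
    have [|x' Sx xx] := Vx (e / (rnorm c + 1)); first by rewrite divr_gt0.
    exists (c *: x'); first exact: lspan_scale.
    rewrite -scalerBr rnormZ; rewrite ltr_pdivlMr // in xx.
    apply: le_lt_trans xx; rewrite mulrC ler_wpM2l // lerDl //.
have inv f : (forall x, lspan S x -> lspan S (T f x)) -> forall x, V x -> V (T f x).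
  move=> h x /closureP_rnorm Vx; apply/closureP_rnorm => e e0.
  have [M hM] := starrep_bounded hT f.
  have M1 : 0 < `|M| + 1 by rewrite ltr_wpDl.
  have [|y Sy yy] := Vx (e / (`|M| + 1)); first by rewrite divr_gt0.
  exists (T f y); first exact: h.
  rewrite -(starrepBr hT); rewrite ltr_pdivlMr // in yy.
  apply: le_lt_trans yy; rewrite mulrC (le_trans (hM _)) // ler_wpM2r //.
  by rewrite (le_trans (ler_norm M)) // lerDl.
have [_ /(_ V cV)] := iT; case.
- case: cV => _ V0 VD VZ; apply: (starrep_invariant hT) => // k; apply: inv.
    exact: lspan_map (starrep_linear hT _) (hz k).
  exact: lspan_map (starrep_linear hT _) (hs k).
- move=> V0; have : V x0 by apply/Vspan/lspan_mem.
  by rewrite V0 => /eqP; rewrite (negPf x00).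
- move=> VT x e e0; have : V x by rewrite VT.
  by move/closureP_rnorm; apply.
Qed.

End Density.

(** * The number operator *)

Section NumberOperator.
Context {R : realType} {q : R} {n : nat} {H : hilbertType R} {T : Pol q n -> H -> H}.
Hypotheses (hq : 0 < q < 1) (hT : starrep T) (iT : irreducible T).
Variable v : H.
Hypotheses (v0 : v != 0) (vac : forall k, T (star (pol_z q k)) v = 0).
Local Notation C := R[i].
Local Notation Z k := (T (pol_z q k)).
Local Notation Zs k := (T (star (pol_z q k))).
Local Notation X := (qX (fun k => Z k) (fun k => Zs k)).
Let hZ : qrep q (fun k => Z k) (fun k => Zs k) := qrep_of_starrep hT.

Fixpoint level (d : nat) (x : H) : Prop :=
  match d with
  | 0 => exists c : C, x = c *: v
  | d'.+1 => exists y : 'I_n -> H, (forall k, level d' (y k)) /\ x = \sum_k Z k (y k)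
  end.

Lemma level_add d x y : level d x -> level d y -> level d (x + y).
Proof.
elim: d x y => [|d ih] x y /=.
  by move=> [c ->] [c' ->]; exists (c + c'); rewrite scalerDl.
move=> [f [hf ->]] [g [hg ->]]; exists (fun k => f k + g k); split=> [k|]; first exact: ih.
by rewrite -big_split; apply: eq_bigr => k _; rewrite (starrepDr hT).
Qed.

Lemma level_scale d c x : level d x -> level d (c *: x).
Proof.
elim: d x => [|d ih] x /=.
  by move=> [c' ->]; exists (c * c'); rewrite scalerA.
move=> [f [hf ->]]; exists (fun k => c *: f k); split=> [k|]; first exact: ih.
by rewrite scaler_sumr; apply: eq_bigr => k _; rewrite (starrepZr hT).
Qed.

Lemma level0 d : level d 0.
Proof.
elim: d => [|d ih] /=; first by exists 0; rewrite scale0r.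
by exists (fun=> 0); split=> //; rewrite big1 // => k _; rewrite (starrep0r hT).
Qed.

Lemma level_sum d I (r : seq I) (Q : pred I) (F : I -> H) :
  (forall i, Q i -> level d (F i)) -> level d (\sum_(i <- r | Q i) F i).
Proof.
by move=> h; apply: (big_ind (level d)) => //; [exact: level0|move=> x y; exact: level_add].
Qed.

Lemma level_Z d k x : level d x -> level d.+1 (Z k x).
Proof.
move=> dx; exists (fun i => if i == k then x else 0); split=> [i|].
  by case: ifP => // _; exact: level0.
rewrite (bigD1 k) //= eqxx big1 ?addr0 // => i ik.
by rewrite (negPf ik) (starrep0r hT).
Qed.

(** Commuting [Zs k] past the leading generator leaves the vector itself and terms Z i (Zs j y),
    whose level is restored by the induction hypothesis. *)
Lemma level_Zs d k x : level d x -> if d is d'.+1 then level d' (Zs k x) else Zs k x = 0.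
Proof.
elim: d k x => [|d ih] k x.
  by move=> [c ->]; rewrite (starrepZr hT) vac scaler0.
have zz i j y : level d y -> level d (Z i (Zs j y)).
  move=> dy; have := ih j y dy; case: (d) => [->|d' d'y]; first by rewrite (starrep0r hT); exact: level0.
  exact: level_Z.
move=> [y [dy ->]]; have {}dy i : level d (y i) := dy i.
rewrite (starrep_sumr hT); apply: level_sum => i _.
have [<-|ki] := eqVneq k i.
  rewrite (qrep_ss hZ); apply: level_add; first by apply: level_scale; apply: zz.
  apply: level_scale; apply: level_add => //; rewrite -scaleN1r; apply: level_scale.
  by apply: level_sum => j _; exact: zz.
by rewrite (qrep_sz hZ) //; apply: level_scale; exact: zz.
Qed.

Lemma level_X d x : level d x -> X x = ((q ^+ 2) ^+ d)%:C *: x.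
Proof.
have [X0 XD _ XZ] := linear_additive (qX_linear hZ).
elim: d x => [|d ih] x.
  move=> [c ->]; rewrite expr0 scale1r XZ; congr (_ *: _).
  by rewrite /qX big1 ?subr0 // => k _; rewrite vac (starrep0r hT).
move=> [y [dy ->]]; have {}dy i : level d (y i) := dy i.
rewrite (linear_sumE _ _ _ (qX_linear hZ)) scaler_sumr.
apply: eq_bigr => k _; rewrite (qX_Z hZ) ih //= (starrepZr hT) scalerA -rcM.
by rewrite (exprS (q ^+ 2) d).
Qed.

Let q0 : 0 < q. Proof. by case/andP: hq. Qed.
Let q1 : q < 1. Proof. by case/andP: hq. Qed.
Lemma level_orth d e x y : d != e -> level d x -> level e y -> hdot H x y = 0.
Proof.
move=> de dx ey; have := qX_adj hZ x y; rewrite (level_X dx) (level_X ey).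
rewrite hdotZl hdotZr rc_conj => /eqP; rewrite -subr_eq0 -mulrBl mulf_eq0.
case/orP => /eqP // /eqP; rewrite -rcB => /eqP/complexI/eqP.
rewrite subr_eq0 -!exprM => /eqP E; case/eqP: de.
have : (2 * d)%N = (2 * e)%N.
  apply: contra_eq E => ne; case: (ltngtP (2 * d)%N (2 * e)%N) ne => // l _.
    by rewrite gt_eqF // ltr_iXn2l ?q0 ?q1.
  by rewrite lt_eqF // ltr_iXn2l ?q0 ?q1.
by move/eqP; rewrite eqn_pmul2l // => /eqP.
Qed.

Let Lv : set H := [set x | exists d, level d x].

Lemma level_dense x e : 0 < e -> exists2 y, lspan Lv y & rnorm (x - y) < e.
Proof.
have v0' : Lv v by exists 0%N, 1; rewrite scale1r.
apply: (irreducible_dense hT iT v0' v0) => k y [d dy]; apply: lspan_mem.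
  by exists d.+1; exact: level_Z.
have := level_Zs k dy; case: (d) => [->|d' hd]; last by exists d'.
by exists 0%N; exact: (level0 0).
Qed.

(** Homogeneity is asked only at zeros of [f], so that the lemma serves linear and conjugate linear
    maps alike; the two variables of an inner product need both. *)
Lemma level_ext (V : normedZmodType C) (f : H -> V) (M : R) :
  (forall x y, f (x + y) = f x + f y) -> (forall c x, f x = 0 -> f (c *: x) = 0) ->
  (forall x, rnorm (f x) <= M * rnorm x) ->
  (forall d x, level d x -> f x = 0) -> forall x, f x = 0.
Proof.
move=> fD fZ fM f0 x; have fs y : lspan Lv y -> f y = 0.
  elim=> [|c u w [d du] _ ih]; first exact: f0 (level0 0).
  by rewrite fD ih addr0 fZ // (f0 d).
apply: (@rnorm_le_eps _ _ _ `|M|) => e e0; have [y Sy yy] := level_dense x e0.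
have -> : f x = f (x - y) by have := fD (x - y) y; rewrite subrK (fs y Sy) addr0.
rewrite (le_trans (fM _)) // mulrC (le_trans (ler_wpM2l _ (ler_norm M))) //.
by rewrite ler_wpM2r // ltW.
Qed.

(** A vector may be split into levels in several ways, so the operator starts as a relation;
    [ng_contr] shows that it is single-valued and extends it by continuity. *)
Inductive number_graph : H -> H -> Prop :=
| number0 : number_graph 0 0
| numberD d x y w : level d x -> number_graph y w ->
    number_graph (x + y) ((q ^+ d)%:C *: x + w).

Let ngD x w x' w' : number_graph x w -> number_graph x' w' -> number_graph (x + x') (w + w').
Proof.
move=> + h'; elim=> [|d u y z du _ ih]; first by rewrite !add0r.
by rewrite -!addrA; exact: numberD.
Qed.

Let ngZ c x w : number_graph x w -> number_graph (c *: x) (c *: w).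
Proof.
elim=> [|d u y z du _ ih]; first by rewrite !scaler0; exact: number0.
rewrite !scalerDr scalerA mulrC -scalerA; apply: numberD => //; exact: level_scale.
Qed.

Let ng_level d x : level d x -> number_graph x ((q ^+ d)%:C *: x).
Proof.
by move=> dx; rewrite -[x in X in number_graph X]addr0 -[_ *: x]addr0; apply: numberD => //; exact: number0.
Qed.

(** Levels are orthogonal, and on level d both sides carry the factor q^(2d). Contractivity of the
    graph thereby reduces to that of X. *)
Let ng_dot x w x' w' : number_graph x w -> number_graph x' w' ->
  hdot H w w' = hdot H (X x) x'.
Proof.
have [X0 XD _ XZ] := linear_additive (qX_linear hZ).
move=> + h'; elim=> [|d u y z du _ ih]; first by rewrite X0 !hdot0l.
rewrite XD (hdotDl (X u)) (hdotDl (_ *: u)) ih; congr (_ + _).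
clear ih; elim: h' => [|d' u' y' z' du' _ ih']; first by rewrite !hdot0r.
rewrite (hdotDr u') (hdotDr (_ *: u')) ih'; congr (_ + _).
rewrite (level_X du) !hdotZl hdotZr rc_conj.
have [<-|dd'] := eqVneq d d'; first by rewrite mulrA -rcM -exprD addnn -muln2 mulnC exprM.
by rewrite (level_orth dd' du du') !mulr0.
Qed.

Let ng_contr x w : number_graph x w -> rnorm w <= rnorm x.
Proof.
move=> h; rewrite -(@ler_pXn2r _ 2) ?nnegrE // -!rdotxx.
have -> : rdot w w = rdot (X x) x by rewrite /rdot (ng_dot h h).
apply: (le_trans (rdot_CS _ _)); rewrite rdotxx expr2 ler_wpM2r //.
exact: (qX_contr hq hZ).
Qed.

(* The positive square root of [X]: it acts on level [d] as [q^d]. *)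
Lemma number_operator : exists N : H -> H,
  [/\ linear N, forall x, rnorm (N x) <= rnorm x,
      forall x y, hdot H (N x) y = hdot H x (N y),
      forall x, N (N x) = X x &
      (forall k x, N (Z k x) = q%:C *: Z k (N x)) /\
      (forall k x, Zs k (N x) = q%:C *: N (Zs k x))].
Proof.
have [||N hN] := @dense_extension R H rnorm H number_graph 1 (fun x y => rnormB x y) (fun x y z => rnorm_dist y x z) ler01.
- move=> x w x' w' h h'; rewrite mul1r; apply: ng_contr.
  by rewrite -[- x']scaleN1r -[- w']scaleN1r; apply: ngD => //; exact: ngZ.
- move=> x e e0; have [y Sy xy] := level_dense x e0.
  suff [w hw] : exists w, number_graph y w by exists y, w.
  elim: Sy => [|c u y' [d du] _ [w hw]]; first by exists 0; exact: number0.
  exists ((q ^+ d)%:C *: (c *: u) + w); apply: numberD => //; exact: level_scale.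
have NE x w : number_graph x w -> N x = w.
  move=> h; apply/subr0_eq/(@rnorm_le_eps _ _ _ 0) => e e0.
  by rewrite (le_trans (hN _ _ _ h)) // subrr rnorm0 !mulr0.
have Nlev d x : level d x -> N x = (q ^+ d)%:C *: x by move=> /ng_level/NE.
have Nb x : rnorm (N x) <= rnorm x.
  by have := hN x 0 0 number0; rewrite !subr0 mul1r.
have app x e : 0 < e -> exists y, number_graph y (N y) /\ rnorm (x - y) < e.
  move=> e0; have [y Sy xy] := level_dense x e0; exists y; split=> //.
  suff [w hw] : exists w, number_graph y w by rewrite (NE _ _ hw).
  elim: Sy => [|c u y' [d du] _ [w hw]]; first by exists 0; exact: number0.
  exists ((q ^+ d)%:C *: (c *: u) + w); apply: numberD => //; exact: level_scale.
have Nl : linear N.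
  move=> a x y; apply/subr0_eq/(@rnorm_le_eps _ _ _ (2 * (rnorm a + 1))) => e e0.
  have [x' [gx xx]] := app x e e0; have [y' [gy yy]] := app y e e0.
  have g' := ngD (ngZ a gx) gy.
  have h1 := hN (a *: x + y) _ _ g'; have h2 := hN x _ _ gx; have h3 := hN y _ _ gy.
  have -> : N (a *: x + y) - (a *: N x + N y) = (N (a *: x + y) - (a *: N x' + N y')) -
      (a *: (N x - N x') + (N y - N y')) by hring.
  rewrite mul1r in h2; rewrite mul1r in h3; rewrite mul1r in h1.
  have h4 : rnorm (a *: x + y - (a *: x' + y')) <= rnorm a * e + e.
    rewrite opprD addrACA -scalerBr (le_trans (rnormD _ _)) // rnormZ.
    by rewrite lerD ?ler_wpM2l // ltW.
  have h5 : rnorm (a *: (N x - N x') + (N y - N y')) <= rnorm a * e + e.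
    rewrite (le_trans (rnormD _ _)) // rnormZ lerD ?ler_wpM2l //.
      by rewrite (le_trans h2) // ltW.
    by rewrite (le_trans h3) // ltW.
  rewrite (le_trans (rnormD _ _)) // rnormN; lra.
have [N0 ND NN NZ] := linear_additive Nl.
have [X0 XD XN XZ] := linear_additive (qX_linear hZ).
have eqop (f g : H -> H) : linear f -> linear g ->
    (exists M : R, forall x, rnorm (f x) <= M * rnorm x) ->
    (exists M : R, forall x, rnorm (g x) <= M * rnorm x) ->
    (forall d x, level d x -> f x = g x) -> forall x, f x = g x.
  move=> /linear_additive[f0 fD _ fZ] /linear_additive[g0 gD _ gZ] [M hM] [M' hM'] fg x.
  apply/subr0_eq; apply: (@level_ext H (fun x => f x - g x) (M + M')).
  - by move=> x1 x2; rewrite fD gD opprD addrACA.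
  - by move=> c y; rewrite fZ gZ -scalerBr => ->; rewrite scaler0.
  - by move=> y; rewrite (le_trans (rnormD _ _)) // rnormN mulrDl lerD.
  - by move=> d y dy; rewrite (fg d) // subrr.
have Nadj x y : hdot H (N x) y = hdot H x (N y).
  apply/subr0_eq; move: y.
  apply: (@level_ext C (fun y => hdot H (N x) y - hdot H x (N y)) (2 * rnorm x)).
  - by move=> y z; rewrite ND !hdotDr opprD addrACA.
  - by move=> c y; rewrite NZ !hdotZr -mulrBr => ->; rewrite mulr0.
  - move=> y; rewrite (le_trans (rnormD _ _)) // rnormN.
    have := hdot_CS (N x) y; have := hdot_CS x (N y).
    have := ler_wpM2r (rnorm_ge0 y) (Nb x); have := ler_wpM2l (rnorm_ge0 x) (Nb y); lra.
  move=> e y ey; move: x.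
  apply: (@level_ext C (fun x => hdot H (N x) y - hdot H x (N y)) (2 * rnorm y)).
  - by move=> x z; rewrite ND !hdotDl opprD addrACA.
  - by move=> c x; rewrite NZ !hdotZl -mulrBr => ->; rewrite mulr0.
  - move=> x; rewrite (le_trans (rnormD _ _)) // rnormN.
    have := hdot_CS (N x) y; have := hdot_CS x (N y).
    have := ler_wpM2r (rnorm_ge0 y) (Nb x); have := ler_wpM2l (rnorm_ge0 x) (Nb y); lra.
  move=> d x dx; rewrite (Nlev d) // (Nlev e) // hdotZl hdotZr rc_conj.
  have [->|de] := eqVneq d e; first by rewrite subrr.
  by rewrite (level_orth de dx ey) !mulr0 subrr.
have NZk k x : N (Z k x) = q%:C *: Z k (N x).
  have [M hM] := starrep_bounded hT (pol_z q k).
  move: x; apply: eqop.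
  - by move=> a x y; rewrite (starrep_linear hT) Nl.
  - by move=> a x y; rewrite Nl (starrep_linear hT) scalerDr !scalerA mulrC.
  - by exists M => x; exact: le_trans (Nb _) (hM _).
  - exists (rnorm (q%:C : C) * `|M|) => x; rewrite rnormZ -mulrA ler_wpM2l //.
    rewrite (le_trans (hM _)) // (le_trans (ler_wpM2r _ (ler_norm M))) //.
    by rewrite ler_wpM2l.
  - move=> d x dx; rewrite (Nlev d x dx) (Nlev d.+1); last exact: level_Z.
    by rewrite (starrepZr hT) scalerA -rcM exprS.
exists N; split=> //; last split=> // k x.
  apply: eqop.
  - by move=> a x y; rewrite !Nl.
  - exact: qX_linear hZ.
  - by exists 1 => x; rewrite mul1r; exact: le_trans (Nb _) (Nb _).
  - by exists 1 => x; rewrite mul1r; exact: (qX_contr hq hZ).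
  - move=> d x dx; rewrite (level_X dx) (Nlev d x dx) NZ (Nlev d) // scalerA -rcM.
    by rewrite -exprD addnn -muln2 mulnC exprM.
apply: hdot_inj => z; rewrite (qrep_adjr hZ) Nadj NZk hdotZl hdotZr rc_conj.
by rewrite Nadj (qrep_adjr hZ).
Qed.

End NumberOperator.

(** * Dilation of the weighted shift *)

(** The number of roots is a power of two because a primitive root is then at hand: a 2^t-th root of
    -1 has order dividing 2^(t+1) but not 2^t. *)
Lemma unity_root_orthogonality (R : realType) t (M := (2 ^ t)%N) :
  exists w : R[i], rnorm w = 1 /\ forall j k, (j < M)%N -> (k < M)%N ->
    \sum_(r < M) (w ^+ r) ^+ j * (((w ^+ r) ^+ k)^*)%R = if j == k then M%:R else 0.
Proof.
have [w wM] : exists w : R[i], M.-primitive_root w.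
  rewrite /M; case: t {M} => [|t]; first by exists 1; rewrite expn0; apply/andP; split=> //;
    apply/forallP => i; rewrite ord1 unity_rootE expr1n eqxx.
  pose w : R[i] := (2 ^ t)%N.-root (-1); exists w.
  have wt : w ^+ (2 ^ t)%N = -1 by rewrite rootCK // expn_gt0.
  have wM : w ^+ (2 ^ t.+1)%N = 1 by rewrite expnSr exprM wt sqrrN expr1n.
  have M0 : (0 < 2 ^ t.+1)%N by rewrite expn_gt0.
  have [m hm] := prim_order_exists M0 wM.
  move=> /(dvdn_pfactor _ _ (isT : prime 2)) [a ha mE]; rewrite mE in hm.
  have [at'|at'] := leqP a t; last first.
    by have -> : t.+1 = a by apply/eqP; rewrite eqn_leq at' ha.
  have : w ^+ (2 ^ t)%N = 1 by apply/eqP; rewrite -(prim_order_dvd hm) dvdn_exp2l.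
  by rewrite wt => /eqP; rewrite eqNr oner_eq0.
have M0 : (0 < M)%N by rewrite expn_gt0.
have rX (u : R[i]) r : rnorm (u ^+ r) = rnorm u ^+ r.
  by elim: r => [|r ih]; rewrite ?expr0 ?rnorm1 // !exprS rnormM ih.
have w1 : rnorm w = 1.
  have : rnorm w ^+ M = 1 by rewrite -rX (prim_expr_order wM) rnorm1.
  by move/eqP; rewrite pexpr_eq1 // => /eqP.
have wV (u : R[i]) : rnorm u = 1 -> u * (u^*)%R = 1 by move=> u1; rewrite -sqr_rnorm u1 expr1n.
exists w; split=> // j k jM kM; pose x := w ^+ j * ((w ^+ k)^*)%R.
have xE r : (w ^+ r) ^+ j * (((w ^+ r) ^+ k)^*)%R = x ^+ r.
  by rewrite /x exprMn -!exprM -rmorphXn /= -exprM ![(r * _)%N]mulnC.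
under eq_bigr => r _ do rewrite xE.
case: eqP => [jk|/eqP jk].
  rewrite (eq_bigr (fun=> 1)) => [|r _]; first by rewrite sumr_const card_ord.
  by rewrite /x jk wV ?expr1n // rX w1 expr1n.
have x1 : x != 1.
  apply: contra_neq jk => x1; have : w ^+ j = w ^+ k.
    rewrite -[LHS]mulr1 -(wV (w ^+ k)) ?rX ?w1 ?expr1n // mulrCA.
    by rewrite -/x x1 mulr1.
  by move/eqP; rewrite (eq_prim_root_expr wM) !modn_small // => /eqP.
have xM : x ^+ M = 1.
  rewrite exprMn -rmorphXn /= -!exprM ![(_ * M)%N]mulnC !exprM (prim_expr_order wM).
  by rewrite !expr1n rmorph1 mulr1.
have /eqP : (x - 1) * \sum_(r < M) x ^+ r = 0 by rewrite -subrX1 xM subrr.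
by rewrite mulf_eq0 subr_eq0 (negPf x1) => /eqP.
Qed.

Section Dilation.
Context {R : realType} {P : starAlgType R[i]} {I : eqType} {H W : hilbertType R}.
Local Notation C := R[i].
(** In the application [W] is ker z^* , [G k] is z^k restricted to it, [B i] is the action on [W] of
    the generator of index i != i0, [gam k] is the weight in the norm of z^k w, and [lam] lists the
    increments of 1/gam. *)
Variables (z : I -> P) (i0 : I) (q : R) (T : P -> H -> H) (Tu : C -> P -> W -> W).
Variables (G : nat -> W -> H) (N : W -> W) (B : I -> W -> W) (gam : nat -> R).
Hypotheses (q0 : q != 0) (hT : starrep T).
Hypothesis hTu : forall u, rnorm u = 1 -> starrep (Tu u).
Hypotheses (Glin : forall k, linear (G k)) (Nlin : linear N) (Blin : forall i, linear (B i)).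
Hypothesis Gdot : forall j k x y, hdot H (G j x) (G k y) =
  if j == k then (gam k)%:C * hdot W (iter k N x) (iter k N y) else 0.
Hypothesis TG0 : forall k w, T (z i0) (G k w) = G k.+1 w.
Hypothesis TGk : forall i k w, i != i0 -> T (z i) (G k w) = (q ^- k)%:C *: G k (B i w).
Hypothesis Tu0 : forall u w, rnorm u = 1 -> Tu u (z i0) w = u *: N w.
Hypothesis Tuk : forall u i w, rnorm u = 1 -> i != i0 -> Tu u (z i) w = B i w.
Hypothesis NB : forall i w, i != i0 -> N (B i w) = q%:C *: B i (N w).
Hypothesis Gdense : forall x e, 0 < e ->
  exists2 y, lspan [set y | exists k w, y = G k w] y & rnorm (x - y) < e.
Variable lam : nat -> R.
Hypothesis gam0 : forall k, gam k != 0.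
Hypothesis lam_ge0 : forall l, 0 <= lam l.
Hypothesis lam_sum : forall k, \sum_(l < k.+1) lam l = (gam k)^-1.

Let mono (s : seq I) : P := \prod_(i <- s) z i.

Definition holomorphic : set P := lspan [set f | exists s, f = mono s].

(** The generators on coefficient sequences: an unweighted shift for [i0], a diagonal action
    otherwise. [Phi] and [Phiu u] intertwine this one model with [T] and with every [Tu u]. *)
Let act (i : I) (a : nat -> W) (k : nat) : W :=
  if i == i0 then if k is k'.+1 then a k' else 0 else (q ^- k)%:C *: B i (a k).

Let actw (s : seq I) (a : nat -> W) : nat -> W := foldr act a s.

Let supp m (a : nat -> W) := forall k, (m <= k)%N -> a k = 0.

Let NZ c x : N (c *: x) = c *: N x. Proof. by case: (linear_additive Nlin). Qed.
Let BZ i c x : B i (c *: x) = c *: B i x. Proof. by case: (linear_additive (Blin i)). Qed.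
Let GZ k c x : G k (c *: x) = c *: G k x. Proof. by case: (linear_additive (Glin k)). Qed.
Let B0 i : B i 0 = 0. Proof. by case: (linear_additive (Blin i)). Qed.
Let G0 i : G i 0 = 0. Proof. by case: (linear_additive (Glin i)). Qed.

Let iterN_lin k : linear (iter k N).
Proof. by elim: k => [|k ih] a x y //=; rewrite ih Nlin. Qed.

Let iterN0 k : iter k N 0 = 0. Proof. by case: (linear_additive (iterN_lin k)). Qed.
Let iterNZ k c x : iter k N (c *: x) = c *: iter k N x.
Proof. by case: (linear_additive (iterN_lin k)). Qed.

Let supp_act m i a : supp m a -> supp m.+1 (act i a).
Proof.
move=> ha k mk; rewrite /act; case: ifP => _.
  by case: k mk => // k mk; exact: ha.
by rewrite ha ?B0 ?scaler0 // ltnW.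
Qed.

Let supp_actw m s a : supp m a -> supp (m + size s) (actw s a).
Proof. by elim: s => [|i s ih] ha /=; rewrite ?addn0 // addnS; apply/supp_act/ih. Qed.

Let Phi M (a : nat -> W) : H := \sum_(k < M) G k (a k).
Let Phiu (u : C) M (a : nat -> W) : W := \sum_(k < M) u ^+ k *: iter k N (a k).

(** The coefficient at the top index M - 1 vanishes, so the shift pushes nothing beyond the
    truncation. *)
Let T_Phi i M m a : supp m a -> (m < M)%N -> T (z i) (Phi M a) = Phi M (act i a).
Proof.
move=> ha mM; rewrite /Phi (starrep_sumr hT) /act; case: eqVneq => [->|ii].
  case: M mM => // M mM; rewrite big_ord_recr big_ord_recl /= G0 add0r.
  rewrite (ha M) // G0 (starrep0r hT) addr0; apply: eq_bigr => k _.
  by rewrite TG0.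
by apply: eq_bigr => k _; rewrite TGk // GZ.
Qed.

Let Tu_Phi u i M m a : rnorm u = 1 -> supp m a -> (m < M)%N ->
  Tu u (z i) (Phiu u M a) = Phiu u M (act i a).
Proof.
move=> u1 ha mM; rewrite /Phiu (starrep_sumr (hTu u1)) /act; case: eqVneq => [->|ii].
  case: M mM => // M mM; rewrite big_ord_recr big_ord_recl /= scaler0 add0r.
  rewrite (ha M) // iterN0 scaler0.
  rewrite (starrep0r (hTu u1)).
 rewrite addr0; apply: eq_bigr => k _.
  by rewrite Tu0 // NZ scalerA exprS.
apply: eq_bigr => k _; rewrite Tuk // BZ.
congr (_ *: _); rewrite iterNZ; move: (a k) => w.
(* The q^k from commuting [B i] with N^k cancels the q^(-k) built into [act]. *)
have -> : iter k N (B i w) = (q ^+ k)%:C *: B i (iter k N w).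
  elim: (k : nat) => [|j ih] /=; first by rewrite expr0 scale1r.
  by rewrite ih NZ NB // scalerA -rcM mulrC exprS.
by rewrite scalerA -rcM mulVf ?scale1r // expf_neq0.
Qed.

Let T_mono s M m a : supp m a -> (m + size s < M)%N ->
  T (mono s) (Phi M a) = Phi M (actw s a).
Proof.
move=> ha; elim: s => [|i s ih] sM; first by rewrite /mono big_nil (starrep1 hT).
rewrite /mono big_cons (starrepM hT) -/(mono s) ih; last by rewrite (ltn_trans _ sM) //= addnS.
apply: T_Phi (supp_actw ha) _.
by rewrite (ltn_trans _ sM) //= addnS.
Qed.

Let Tu_mono u s M m a : rnorm u = 1 -> supp m a -> (m + size s < M)%N ->
  Tu u (mono s) (Phiu u M a) = Phiu u M (actw s a).
Proof.
move=> u1 ha; elim: s => [|i s ih] sM; first by rewrite /mono big_nil (starrep1 (hTu u1)).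
rewrite /mono big_cons (starrepM (hTu u1)) -/(mono s) ih; last by rewrite (ltn_trans _ sM) //= addnS.
apply: (Tu_Phi _ _ (supp_actw ha)) => //.
by rewrite (ltn_trans _ sM) //= addnS.
Qed.

(** The factors of the Schur multiplier: summing lam l times kap l j times kap l k over l gives gam
    j gam k / gam (min j k). *)
Let kap l k : R := if (l <= k)%N then gam k else 0.
Let wt l (a : nat -> W) k : W := (kap l k)%:C *: a k.

Let supp_wt l m a : supp m a -> supp m (wt l a).
Proof. by move=> ha k mk; rewrite /wt ha // scaler0. Qed.

(** Each letter [i0] shifts the index by one, so the weight is read at the source index. For k below
    the number of such letters both sides vanish, which makes the truncated subtraction harmless. *)
Let actw_wt l s a k : actw s (wt l a) k = (kap l (k - count_mem i0 s))%:C *: actw s a k.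
Proof.
elim: s k => [|i s ih] k /=; first by rewrite subn0.
rewrite /act; case: eqVneq => ii.
  by case: k => [|k]; rewrite ?scaler0 // ih add1n subSS.
by rewrite add0n ih BZ !scalerA mulrC.
Qed.

(** Only l <= k - j contribute; their [lam] add up to 1/gam (k - j), which cancels one factor and
    leaves a value independent of j. *)
Let kap_sum M j k : (k < M)%N ->
  \sum_(l < M) lam l * (kap l (k - j) * kap l k) = gam k.
Proof.
move=> kM.
rewrite (bigID (fun l : 'I_M => (l < (k - j).+1)%N)) /= [X in _ + X]big1 => [|l]; last first.
  by rewrite -leqNgt /kap ltnNge => /negPf ->; rewrite mul0r mulr0.
have jM : ((k - j).+1 <= M)%N by rewrite (leq_trans _ kM) // ltnS leq_subr.
rewrite addr0 -(big_ord_widen_cond _ (fun _ => true) (fun l => lam l * (kap l (k - j) * kap l k)) jM) /=.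
under eq_bigr => l _.
  have lk : (l <= k - j)%N by rewrite -ltnS.
  rewrite /kap lk (leq_trans lk (leq_subr _ _)).
  over.
by rewrite -mulr_suml lam_sum mulKf.
Qed.

Let Phi_dot M a b : hdot H (Phi M a) (Phi M b) =
  \sum_(k < M) (gam k)%:C * hdot W (iter k N (a k)) (iter k N (b k)).
Proof.
rewrite hdot_suml; apply: eq_bigr => k _; rewrite hdot_sumr (bigD1 k) //= Gdot eqxx.
rewrite big1 ?addr0 // => j jk; rewrite Gdot ifN //.
by apply: contra_neq jk => e; apply: val_inj.
Qed.

(** The sesquilinear form of [p] in the dilation: a direct sum over the roots of unity w^r and the
    layers l, with weights 2^(-t) and [lam l]. *)
Let avg (t : nat) (w : C) (p : P) (a b : nat -> W) : C :=
  (2 ^ t)%N%:R^-1 * \sum_(r < 2 ^ t) \sum_(l < 2 ^ t) (lam l)%:C *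
    hdot W (Tu (w ^+ r) p (Phiu (w ^+ r) (2 ^ t) (wt l a))) (Phiu (w ^+ r) (2 ^ t) (wt l b)).

Let rnormX1 (w : C) r : rnorm w = 1 -> rnorm (w ^+ r) = 1.
Proof. by move=> w1; elim: r => [|r ih]; rewrite ?expr0 ?rnorm1 // exprS rnormM w1 ih mulr1. Qed.

Definition root_family (t : nat) (w : C) : Prop := rnorm w = 1 /\
  forall j k, (j < 2 ^ t)%N -> (k < 2 ^ t)%N ->
    \sum_(r < (2 ^ t)%N) (w ^+ r) ^+ j * (((w ^+ r) ^+ k)^*)%R =
      if j == k then (2 ^ t)%N%:R else 0.

(** Parseval for the finite Fourier transform: the average over roots of unity removes the terms
    with different powers of u. *)
Let Phiu_avg t w c d : root_family t w ->
  \sum_(r < 2 ^ t) hdot W (Phiu (w ^+ r) (2 ^ t) c) (Phiu (w ^+ r) (2 ^ t) d) =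
  (2 ^ t)%N%:R * \sum_(k < 2 ^ t) hdot W (iter k N (c k)) (iter k N (d k)).
Proof.
move=> [_ hw].
under eq_bigr => r _.
  rewrite hdot_suml; under eq_bigr => k _.
    rewrite hdot_sumr; under eq_bigr => j _ do rewrite hdotZl hdotZr mulrA.
    over.
  over.
rewrite exchange_big mulr_sumr; apply: eq_bigr => k _ /=.
rewrite exchange_big (bigD1 k) //= -mulr_suml hw // eqxx big1 ?addr0 // => j jk.
rewrite -mulr_suml hw // ifN ?mul0r //.
by rewrite eq_sym; apply: contra_neq jk => e; apply: val_inj.
Qed.

(** An exact identity: below 2^t no index wraps around. By [kap_sum] the layers add up to [gam k],
    the weight of [T] at the target index. *)
Let avg_mono t w s m a b : root_family t w ->
  supp m a -> (m + size s < 2 ^ t)%N ->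
  hdot H (T (mono s) (Phi (2 ^ t) a)) (Phi (2 ^ t) b) = avg t w (mono s) a b.
Proof.
move=> hw ha sM; have [w1 _] := hw.
have M0 : ((2 ^ t)%N%:R : C) != 0 by rewrite pnatr_eq0 -lt0n expn_gt0.
rewrite (T_mono ha) // Phi_dot /avg exchange_big /= mulr_sumr.
under [RHS]eq_bigr => l _.
  under eq_bigr => r _ do rewrite (Tu_mono (rnormX1 r w1) (supp_wt l ha)) //.
  rewrite -mulr_sumr Phiu_avg // mulrCA [_%:R^-1 * _]mulrA mulVf // mul1r mulr_sumr.
  under eq_bigr => k _.
    rewrite actw_wt /wt !iterNZ hdotZl hdotZr rc_conj !mulrA -!rcM -mulrA.
    over.
  over.
rewrite exchange_big; apply: eq_bigr => k _ /=.
rewrite -mulr_suml -rc_sum; congr (_%:C * _).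
rewrite -[LHS](kap_sum (count_mem i0 s) (ltn_ord k)); apply: eq_bigr => l _.
by rewrite mulrA.
Qed.

Let avg_eventually p m : holomorphic p -> exists t0, forall t w a b, (t0 <= t)%N ->
  root_family t w -> supp m a ->
  hdot H (T p (Phi (2 ^ t) a)) (Phi (2 ^ t) b) = avg t w p a b.
Proof.
elim=> [|c _ p' [s ->] _ [t0 ih]].
  exists 0%N => t w a b _ [w1 _] _; rewrite (starrep0 hT) hdot0l /avg big1 ?mulr0 // => r _.
  by rewrite big1 // => l _; rewrite (starrep0 (hTu (rnormX1 r w1))) hdot0l mulr0.
exists (maxn t0 (m + size s)) => t w a b; rewrite geq_max => /andP[tt mt] hw ha.
have sM : (m + size s < 2 ^ t)%N by rewrite (leq_ltn_trans mt) // ltn_expl.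
have [w1 _] := hw.
rewrite (starrepD hT) (starrepZ hT) hdotDl hdotZl (ih t w a b tt hw ha) (avg_mono b hw ha sM) /avg.
rewrite mulrCA -mulrDr mulr_sumr -big_split; congr (_ * _); apply: eq_bigr => r _ /=.
rewrite mulr_sumr -big_split; apply: eq_bigr => l _ /=.
have hr := hTu (rnormX1 r w1).
by rewrite (starrepD hr) (starrepZ hr) hdotDl hdotZl mulrDr mulrCA.
Qed.

Variable m : nat.
Local Notation HV := {ffun 'I_m.+1 -> H}.
Local Notation WV := {ffun 'I_m.+1 -> W}.
Variables (p : 'I_m.+1 -> 'I_m.+1 -> P).
Hypothesis hp : forall i k, holomorphic (p i k).
Let pm : starmx P m := \matrix_(i, k) p i k.
Variable c : R.
Hypothesis c0 : 0 <= c.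
Hypothesis hc : forall u x, rnorm u = 1 -> rnorm (mxrep (Tu u) pm x) <= c * rnorm x.

Let PhiV M (a : 'I_m.+1 -> nat -> W) : hpow H m.+1 := [ffun i => Phi M (a i)] : HV.

(** The empty word in [avg_mono]: the dilation preserves norms. *)
Let avg_one t w s a : root_family t w -> supp s a -> (s < 2 ^ t)%N ->
  rnorm (Phi (2 ^ t) a) ^+ 2 = (2 ^ t)%N%:R^-1 * \sum_(r < 2 ^ t) \sum_(l < 2 ^ t)
    lam l * rnorm (Phiu (w ^+ r) (2 ^ t) (wt l a)) ^+ 2.
Proof.
move=> hw ha sM; have [w1 _] := hw; apply: complexI; rewrite -hdotxx.
have := @avg_mono t w [::] s a a hw ha; rewrite addn0 => /(_ sM).
rewrite /mono big_nil (starrep1 hT) => ->; rewrite /avg rcM rcV rcnat rc_sum.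
congr (_ * _); apply: eq_bigr => r _; rewrite rc_sum; apply: eq_bigr => l _.
by rewrite (starrep1 (hTu (rnormX1 r w1))) rcM hdotxx.
Qed.

(** The bound is put in the additive form 2 Re <T x, y> <= c (|x|^2 + |y|^2) because both sides then
    split over roots and layers, where it follows from [hc] term by term. *)
Let dilation_Phi s (a b : 'I_m.+1 -> nat -> W) :
  (forall i, supp s (a i)) -> (forall i, supp s (b i)) -> exists t0, forall t, (t0 <= t)%N ->
  2 * rdot (mxrep T pm (PhiV (2 ^ t) a)) (PhiV (2 ^ t) b) <=
  c * (rnorm (PhiV (2 ^ t) a) ^+ 2 + rnorm (PhiV (2 ^ t) b) ^+ 2).
Proof.
move=> ha hb.
pose tt i k := projT1 (cid (avg_eventually s (hp i k))).
have ttP i k := projT2 (cid (avg_eventually s (hp i k))).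
exists (maxn (\max_i \max_k tt i k) s) => t; rewrite geq_max => /andP[tmax st].
have sM : (s < 2 ^ t)%N by rewrite (leq_ltn_trans st) // ltn_expl.
have [w hw] := unity_root_orthogonality R t; have [w1 _] := hw.
have ttt i k : (tt i k <= t)%N.
  apply: leq_trans tmax.
  exact: leq_trans (leq_bigmax (F := tt i) k) (leq_bigmax (F := fun i => \max_k tt i k) i).
pose A (d : 'I_m.+1 -> nat -> W) r l : hpow W m.+1 :=
  [ffun k => Phiu (w ^+ r) (2 ^ t) (wt l (d k))] : WV.
set Mi : R := (2 ^ t)%N%:R^-1.
have Mi0 : 0 <= Mi by rewrite invr_ge0 ler0n.
have hdotE : rdot (mxrep T pm (PhiV (2 ^ t) a)) (PhiV (2 ^ t) b) =
    Mi * \sum_(r < 2 ^ t) \sum_(l < 2 ^ t)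
      lam l * rdot (mxrep (Tu (w ^+ r)) pm (A a r l)) (A b r l).
  have hE : hdot _ (mxrep T pm (PhiV (2 ^ t) a)) (PhiV (2 ^ t) b) =
      Mi%:C * \sum_(r < 2 ^ t) \sum_(l < 2 ^ t)
        (lam l)%:C * hdot _ (mxrep (Tu (w ^+ r)) pm (A a r l)) (A b r l).
    transitivity (\sum_i \sum_k avg t w (p i k) (a k) (b i)).
      apply: eq_bigr => i _; rewrite !ffunE hdot_suml; apply: eq_bigr => k _.
      by rewrite !ffunE mxE; exact: ttP (ttt i k) hw (ha k).
    rewrite /avg rcV rcnat.
    under eq_bigr => i _ do rewrite -mulr_sumr.
    rewrite -mulr_sumr; congr (_ * _).
    under eq_bigr => i _ do rewrite exchange_big.
    rewrite exchange_big; apply: eq_bigr => r _ /=.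
    under eq_bigr => i _ do rewrite exchange_big.
    rewrite exchange_big; apply: eq_bigr => l _ /=.
    under eq_bigr => i _ do rewrite -mulr_sumr.
    rewrite -mulr_sumr; congr (_ * _); apply: eq_bigr => i _.
    by rewrite !ffunE hdot_suml; apply: eq_bigr => k _; rewrite !ffunE mxE.
  have ReM (u : R) (v : C) : complex.Re (u%:C * v) = u * complex.Re v.
    by case: v => v1 v2 /=; rewrite mul0r subr0.
  rewrite /rdot hE ReM; congr (_ * _); rewrite raddf_sum; apply: eq_bigr => r _.
  by rewrite raddf_sum; apply: eq_bigr => l _; exact: ReM.
have normE d : (forall i, supp s (d i)) -> rnorm (PhiV (2 ^ t) d) ^+ 2 =
    Mi * \sum_(r < 2 ^ t) \sum_(l < 2 ^ t) lam l * rnorm (A d r l) ^+ 2.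
  move=> hd; rewrite rnorm_hpow.
  under eq_bigr => i _ do rewrite ffunE (avg_one hw (hd i) sM).
  rewrite -mulr_sumr exchange_big; congr (_ * _); apply: eq_bigr => r _ /=.
  rewrite exchange_big; apply: eq_bigr => l _ /=.
  by rewrite -mulr_sumr rnorm_hpow; congr (_ * _); apply: eq_bigr => i _; rewrite ffunE.
rewrite hdotE !normE // -mulrDr !(mulrCA _ Mi) ler_wpM2l // -big_split /= !mulr_sumr.
apply: ler_sum => r _; rewrite -big_split /= !mulr_sumr; apply: ler_sum => l _.
rewrite -mulrDr !(mulrCA _ (lam l)) ler_wpM2l //.
have := rdot_CS (mxrep (Tu (w ^+ r)) pm (A a r l)) (A b r l).
have := ler_wpM2r (rnorm_ge0 (A b r l)) (hc (A a r l) (rnormX1 r w1)).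
have : 0 <= c * (rnorm (A a r l) - rnorm (A b r l)) ^+ 2 by rewrite mulr_ge0 // sqr_ge0.
lra.
Qed.

Let lspan_Phi y : lspan [set y | exists k w, y = G k w] y ->
  exists s a, supp s a /\ forall M, (s <= M)%N -> y = Phi M a.
Proof.
elim=> [|d _ y' [k [w ->]] _ [s [a [ha hy]]]].
  by exists 0%N, (fun=> 0); split=> // M _; rewrite /Phi big1 // => k _; rewrite G0.
exists (maxn s k.+1), (fun j => (if j == k then d *: w else 0) + a j); split.
  move=> j; rewrite geq_max => /andP[sj kj]; rewrite ha // addr0 ifN // gtn_eqF //.
move=> M; rewrite geq_max => /andP[sM kM]; rewrite /Phi.
under eq_bigr => j _.
  have -> : G j ((if j == k :> nat then d *: w else 0) + a j) =
     G j (if j == k :> nat then d *: w else 0) + G j (a j).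
    by case: (linear_additive (Glin j)) => _ ->.
  over.
rewrite big_split /= -/(Phi M a) -hy //; congr (_ + _).
rewrite (bigD1 (Ordinal kM)) //= eqxx GZ big1 ?addr0 // => j jk.
rewrite ifN ?G0 //; by apply: contra_neq jk => e; apply: val_inj.
Qed.

Let lspan_PhiV (x : hpow H m.+1) e : 0 < e -> exists s a, (forall i, supp s (a i)) /\
  forall M, (s <= M)%N -> rnorm (x - PhiV M a) < e.
Proof.
move=> e0; have e1 : 0 < e / m.+1%:R by rewrite divr_gt0.
have h i : exists sa : nat * (nat -> W), supp sa.1 sa.2 /\
    forall M, (sa.1 <= M)%N -> rnorm ((x : HV) i - Phi M sa.2) < e / m.+1%:R.
  have [y /lspan_Phi [s [a [ha ya]]] xy] := Gdense ((x : HV) i) e1.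
  by exists (s, a); split=> // M sM; rewrite -ya.
pose s i := (projT1 (cid (h i))).1; pose a i := (projT1 (cid (h i))).2.
have sP i : supp (s i) (a i) := proj1 (projT2 (cid (h i))).
have aP i M : (s i <= M)%N -> rnorm ((x : HV) i - Phi M (a i)) < e / m.+1%:R :=
  proj2 (projT2 (cid (h i))) M.
exists (\max_i s i), a; split=> [i k ik|M sM].
  by apply: sP; apply: leq_trans ik; exact: leq_bigmax.
apply: le_lt_trans (rnorm_hpow_le _) _.
have : \sum_(i < m.+1) e / m.+1%:R = e.
  by rewrite sumr_const card_ord -[_ *+ _]mulr_natr divfK.
move=> <-; rewrite !big_ord_recl /= ltr_leD //; first by rewrite ffun_subE ffunE aP // (leq_trans _ sM) // leq_bigmax.
apply: ler_sum => i _; rewrite ffun_subE ffunE ltW // aP // (leq_trans _ sM) // leq_bigmax //.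
Qed.

Let dilation_form (x y : hpow H m.+1) :
  2 * rdot (mxrep T pm x) y <= c * (rnorm x ^+ 2 + rnorm y ^+ 2).
Proof.
have hTm := mxrep_starrep m hT.
have [K' hK'] := starrep_bounded hTm pm; pose K := `|K'|.
have hK z' : rnorm (mxrep T pm z') <= K * rnorm z'.
  by rewrite (le_trans (hK' _)) // ler_wpM2r // ler_norm.
have K0 : 0 <= K := normr_ge0 K'.
apply: (@ler_addeps_mul _ _ _ (c * (2 * rnorm x + 2 * rnorm y + 2)
   + 2 * K * (rnorm x + rnorm y + 1))) => e0 e00.
(* Keeping [e] at most 1 makes e^2 at most e, so that every error term is linear in [e]. *)
pose e := Num.min e0 1.
have e1 : e <= 1 by rewrite ge_min lexx orbT.
have ee : e <= e0 by rewrite ge_min lexx.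
have e_gt0 : 0 < e by rewrite lt_min e00 ltr01.
have [s1 [a [ha xa]]] := lspan_PhiV x e_gt0; have [s2 [b [hb yb]]] := lspan_PhiV y e_gt0.
have [||t0 ht0] := @dilation_Phi (maxn s1 s2) a b.
- by move=> i k; rewrite geq_max => /andP[+ _]; exact: ha.
- by move=> i k; rewrite geq_max => /andP[_ +]; exact: hb.
pose t := maxn t0 (maxn s1 s2).
have := ht0 t (leq_maxl _ _).
have s1t : (s1 <= 2 ^ t)%N.
  by rewrite ltnW // (leq_ltn_trans _ (ltn_expl t (isT : 1 < 2)%N)) // /t leq_max leq_max leqnn orbT.
have s2t : (s2 <= 2 ^ t)%N.
  by rewrite ltnW // (leq_ltn_trans _ (ltn_expl t (isT : 1 < 2)%N)) // /t leq_max leq_max leqnn !orbT.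
have := xa _ s1t; have := yb _ s2t; move: (PhiV _ a) (PhiV _ b) => x' y' yy xx h.
have xn : rnorm x' <= rnorm x + e.
  by have := rnormD x (x' - x); rewrite addrC subrK rnormB; lra.
have yn : rnorm y' <= rnorm y + e.
  by have := rnormD y (y' - y); rewrite addrC subrK rnormB; lra.
have E : rdot (mxrep T pm x) y = rdot (mxrep T pm x') y' +
    (rdot (mxrep T pm (x - x')) y + rdot (mxrep T pm x') (y - y')).
  by rewrite (starrepBr hTm) rdotBl rdotBr; ring.
have h1 := le_trans (rdot_CS _ _) (ler_wpM2r (rnorm_ge0 y) (hK (x - x'))).
have h2 := le_trans (rdot_CS _ _) (ler_wpM2r (rnorm_ge0 (y - y')) (hK x')).
have nx := rnorm_ge0 x; have ny := rnorm_ge0 y; have nx' := rnorm_ge0 x'; have ny' := rnorm_ge0 y'.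
have h3 : K * rnorm (x - x') * rnorm y <= K * e * rnorm y.
  by rewrite ler_wpM2r // ler_wpM2l // ltW.
have h4 : K * rnorm x' * rnorm (y - y') <= K * (rnorm x + 1) * e.
  have xn1 : rnorm x' <= rnorm x + 1 by lra.
  by rewrite ler_pM ?mulr_ge0 ?ler_wpM2l ?(ltW yy).
have h5 : rnorm x' ^+ 2 <= rnorm x ^+ 2 + e * (2 * rnorm x + 1) by nra.
have h6 : rnorm y' ^+ 2 <= rnorm y ^+ 2 + e * (2 * rnorm y + 1) by nra.
have h7 := ler_wpM2l c0 (lerD h5 h6).
set Q := c * (2 * rnorm x + 2 * rnorm y + 2) + 2 * K * (rnorm x + rnorm y + 1).
have Q0 : 0 <= Q by rewrite addr_ge0 // mulr_ge0 ?mulr_ge0 //; lra.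
have h8 : e * Q <= e0 * Q by rewrite ler_wpM2r.
apply: le_trans (_ : _ <= c * (rnorm x ^+ 2 + rnorm y ^+ 2) + e * Q) _; last by rewrite lerD2l.
rewrite E /Q; lra.
Qed.

(* Choose [y] proportional to the image of [x]. *)
Lemma dilation_le x : rnorm (mxrep T pm x) <= c * rnorm x.
Proof.
rewrite -(@ler_pXn2r _ 2) ?nnegrE ?mulr_ge0 // exprMn.
(* The test vector is the image of [x] divided by [c]; for c = 0 the image itself serves. *)
have [c00|cn0] := eqVneq c 0.
  have := dilation_form x (mxrep T pm x); rewrite c00 mul0r expr0n mul0r rdotxx; lra.
have cp : 0 < c by rewrite lt_def cn0.
have := dilation_form x (c^-1%:C *: mxrep T pm x).
rewrite rdotC rdotZl rdotxx rnormZ rnorm_real ger0_norm ?invr_ge0 // exprMn.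
move: (rnorm (mxrep _ _ _)) (rnorm x) => X Y h.
have : c * (2 * (c^-1 * X ^+ 2)) <= c * (c * (Y ^+ 2 + c^-1 ^+ 2 * X ^+ 2)) by rewrite ler_pM2l.
have -> : c * (2 * (c^-1 * X ^+ 2)) = 2 * X ^+ 2 by field.
have -> : c * (c * (Y ^+ 2 + c^-1 ^+ 2 * X ^+ 2)) = c ^+ 2 * Y ^+ 2 + X ^+ 2 by field.
lra.
Qed.

End Dilation.

(** * The boundary representations *)

Section BoundaryModel.
Context {R : realType} {q : R} {n : nat} {H : hilbertType R} {T : Pol q n -> H -> H}.
Hypotheses (hq : 0 < q < 1) (hT : starrep T) (iT : irreducible T).
Local Notation C := R[i].
Local Notation Z k := (T (pol_z q k)).
Local Notation Zs k := (T (star (pol_z q k))).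
Local Notation X := (qX (fun k => Z k) (fun k => Zs k)).
Let hZ : qrep q (fun k => Z k) (fun k => Zs k) := qrep_of_starrep hT.
Variables (i0 : 'I_n) (v : H) (N : H -> H).
Hypothesis i00 : i0 = 0%N :> nat.
Hypotheses (v0 : v != 0) (vac : forall k, Zs k v = 0).
Hypotheses (Nlin : linear N) (Nb : forall x, rnorm (N x) <= rnorm x).
Hypothesis Nadj : forall x y, hdot H (N x) y = hdot H x (N y).
Hypothesis NN : forall x, N (N x) = X x.
Hypothesis NZ : forall k x, N (Z k x) = q%:C *: Z k (N x).
Hypothesis ZsN : forall k x, Zs k (N x) = q%:C *: N (Zs k x).

Let N0 : N 0 = 0. Proof. by case: (linear_additive Nlin). Qed.
Let NZr c x : N (c *: x) = c *: N x. Proof. by case: (linear_additive Nlin). Qed.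
Let q0 : 0 < q. Proof. by case/andP: hq. Qed.
Let q1 : q < 1. Proof. by case/andP: hq. Qed.
Let gt_i0 (k : 'I_n) : (i0 < k)%N = (k != i0).
Proof. by rewrite i00 lt0n -(inj_eq val_inj) /= i00. Qed.

Lemma qX_split x : X x = x - (Z i0 (Zs i0 x) + \sum_(k < n | (i0 < k)%N) Z k (Zs k x)).
Proof.
rewrite /qX (bigD1 i0) //=; congr (_ - (_ + _)); apply: eq_bigl => k.
by rewrite gt_i0.
Qed.

(** For the first generator the sum over k > i0 in the relation misses only Z i0 Zs i0, so the
    bracket is X up to this term. This is why the first generator is singled out. *)
Lemma Zs0_Z0 x : Zs i0 (Z i0 x) = Z i0 (Zs i0 x) + (1 - q ^+ 2)%:C *: X x.
Proof. by rewrite (qrep_ss hZ) qX_split /= rcB rcX; hring. Qed.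

Let Zit k := iter k (Z i0).

Let ZitS k x : Zit k.+1 x = Z i0 (Zit k x). Proof. by []. Qed.

Lemma Z_iter (i : 'I_n) k x : i != i0 -> Z i (Zit k x) = (q ^- k)%:C *: Zit k (Z i x).
Proof.
move=> ii; elim: k => [|k ih]; first by rewrite expr0 invr1 scale1r.
have e : Z i (Z i0 (Zit k x)) = (q^-1)%:C *: Z i0 (Z i (Zit k x)).
  rewrite (qrep_zz hZ (j := i0) (k := i)) ?gt_i0 // scalerA -rcM mulVf ?scale1r //.
  by rewrite gt_eqF ?q0.
rewrite /= e ih (starrepZr hT) scalerA -rcM exprS invfM //.
Qed.

Lemma Zs_iter (i : 'I_n) k x : i != i0 -> Zs i (Zit k x) = (q ^+ k)%:C *: Zit k (Zs i x).
Proof.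
move=> ii; elim: k => [|k ih]; first by rewrite expr0 scale1r.
by rewrite /= (qrep_sz hZ) // ih (starrepZr hT) scalerA -rcM exprS.
Qed.

Lemma X_iter k x : X (Zit k x) = (q ^+ 2 ^+ k)%:C *: Zit k (X x).
Proof.
elim: k => [|k ih]; first by rewrite expr0 scale1r.
by rewrite /= (qX_Z hZ) ih (starrepZr hT) scalerA -rcM (exprS (q ^+ 2)).
Qed.

(** Commuting past one more factor contributes (1 - q^2) q^(2j), where j is the number of factors
    behind it; the geometric sum gives the coefficient. *)
Lemma Zs0_iter k x : Zs i0 x = 0 ->
  Zs i0 (Zit k.+1 x) = (1 - q ^+ 2 ^+ k.+1)%:C *: Zit k (X x).
Proof.
move=> x0; elim: k => [|k ih].
  by rewrite /= Zs0_Z0 x0 (starrep0r hT) add0r expr1.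
rewrite [in LHS]ZitS Zs0_Z0 ih X_iter (starrepZr hT) -ZitS.
rewrite scalerA -scalerDl -rcM -rcD; congr (_%:C *: _).
by rewrite [in RHS](exprS (q ^+ 2)); ring.
Qed.

Let V : set H := [set x | Zs i0 x = 0].

Lemma kernel_subspace : closed_subspace V.
Proof.
split; rewrite /V /=.
- apply/closedP_rnorm => x hx; have [M hM] := starrep_bounded hT (star (pol_z q i0)).
  apply: (@rnorm_le_eps _ _ _ `|M|) => e e0; have [y y0 xy] := hx e e0.
  rewrite -[Zs i0 x]subr0 -[X in _ - X]y0 -(starrepBr hT) (le_trans (hM _)) //.
  rewrite (le_trans (ler_wpM2r _ (ler_norm M))) // mulrC ler_wpM2r // ltW //.
- by rewrite (starrep0r hT).
- by move=> x y x0 y0; rewrite (starrepDr hT) x0 y0 addr0.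
- by move=> c x x0; rewrite (starrepZr hT) x0 scaler0.
Qed.

Let F (u : C) k x := if k == i0 then u *: N x else Z k x.
Let Fs (u : C) k x := if k == i0 then (u^*)%R *: N x else Zs k x.

Let VN x : V x -> V (N x).
Proof. by rewrite /V /= ZsN => ->; rewrite N0 scaler0. Qed.

Let VF u k x : V x -> V (F u k x).
Proof.
rewrite /F; case: ifPn => [_ /VN|ki Vx]; rewrite /V /=.
  by move=> h; rewrite (starrepZr hT) h scaler0.
by rewrite (qrep_sz hZ) 1?eq_sym // Vx (starrep0r hT) scaler0.
Qed.

Let VFs u k x : V x -> V (Fs u k x).
Proof.
rewrite /Fs; case: ifPn => [_ /VN|ki Vx]; rewrite /V /=.
  by move=> h; rewrite (starrepZr hT) h scaler0.
(* The commutation of two adjoints is obtained by duality from that of [Z k] and [Z i0]. *)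
apply: hdot_inj => z; rewrite hdot0l !(qrep_adjr hZ) /= (Z_iter 1 _ ki) /=.
by rewrite hdotZr -(qrep_adjr hZ) Vx hdot0l mulr0.
Qed.

Variables (W : hilbertType R) (J : W -> H).
Hypotheses (Jlin : linear J) (Jdot : forall x y, hdot W x y = hdot H (J x) (J y)).
Hypothesis JV : range J = V.

Let JD x y : J (x + y) = J x + J y. Proof. by case: (linear_additive Jlin). Qed.
Let JN x : J (- x) = - J x. Proof. by case: (linear_additive Jlin). Qed.
Let JZ c x : J (c *: x) = c *: J x. Proof. by case: (linear_additive Jlin). Qed.
Let J0 : J 0 = 0. Proof. by case: (linear_additive Jlin). Qed.

Let J_in w : Zs i0 (J w) = 0.
Proof. by have : V (J w) by rewrite -JV; exists w. Qed.

Lemma rnormJ w : rnorm (J w) = rnorm w.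
Proof. by apply/eqP; rewrite -(@eqrXn2 _ 2) // -!rdotxx /rdot Jdot. Qed.

Let J_inj : injective J.
Proof.
by move=> x y xy; apply/subr0_eq/rnorm0_eq0; rewrite -rnormJ JD JN xy subrr rnorm0.
Qed.

Let pull (f : H -> H) (hf : forall x, V x -> V (f x)) : {g : W -> W | forall w, J (g w) = f (J w)}.
Proof.
have h w : exists w', J w' = f (J w).
  have : V (f (J w)) by apply: hf; rewrite -JV; exists w.
  by rewrite -JV => -[w' _ e]; exists w'.
by exists (fun w => projT1 (cid (h w))) => w; exact: (projT2 (cid (h w))).
Qed.

Definition bdN : W -> W := sval (pull VN).
Definition bdZ u k : W -> W := sval (pull (VF u k)).
Definition bdZs u k : W -> W := sval (pull (VFs u k)).

Lemma bdNE w : J (bdN w) = N (J w). Proof. exact: (svalP (pull VN)). Qed.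
Let bdZE u k w : J (bdZ u k w) = F u k (J w). Proof. exact: (svalP (pull (VF u k))). Qed.
Let bdZsE u k w : J (bdZs u k w) = Fs u k (J w). Proof. exact: (svalP (pull (VFs u k))). Qed.

Lemma bdZ0 u w : bdZ u i0 w = u *: bdN w.
Proof. by apply: J_inj; rewrite bdZE /F eqxx JZ bdNE. Qed.
Lemma bdZk u k w : k != i0 -> J (bdZ u k w) = Z k (J w).
Proof. by move=> ki; rewrite bdZE /F (negPf ki). Qed.
Lemma bdZsk u k w : k != i0 -> J (bdZs u k w) = Zs k (J w).
Proof. by move=> ki; rewrite bdZsE /Fs (negPf ki). Qed.

Let J_sum I (r : seq I) (Q : pred I) (G : I -> W) :
  J (\sum_(i <- r | Q i) G i) = \sum_(i <- r | Q i) J (G i).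
Proof. exact: linear_sumE. Qed.

Let X_on_V w : X (J w) = J w - \sum_(k < n | (i0 < k)%N) Z k (Zs k (J w)).
Proof. by rewrite qX_split J_in (starrep0r hT) add0r. Qed.

(** The delicate relation is the one at [i0]: on ker z^* its bracket is exactly X = N^2, so it reads
    N^2 = q^2 N^2 + (1 - q^2) N^2. The phase of u cancels. *)
Lemma bd_qrep u : rnorm u = 1 -> qrep q (bdZ u) (bdZs u).
Proof.
move=> u1; have uu : (u^*)%R * u = 1 by rewrite mulrC -sqr_rnorm u1 expr1n.
have lF k : linear (F u k).
  move=> a x y; rewrite /F; case: ifP => _; last exact: (starrep_linear hT).
  by rewrite Nlin scalerDr !scalerA mulrC.
have lFs k : linear (Fs u k).
  move=> a x y; rewrite /Fs; case: ifP => _; last exact: (starrep_linear hT).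
  by rewrite Nlin scalerDr !scalerA mulrC.
split.
- by move=> k a x y; apply: J_inj; rewrite bdZE !Jlin lF !bdZE.
- by move=> k a x y; apply: J_inj; rewrite bdZsE !Jlin lFs !bdZsE.
- move=> k; have [M hM] := starrep_bounded hT (pol_z q k).
  exists (Num.max 1 M) => w; rewrite -!rnormJ bdZE /F; case: ifP => _.
    by rewrite rnormZ u1 mul1r (le_trans (Nb _)) // ler_peMl // le_max lexx.
  by rewrite (le_trans (hM _)) // ler_wpM2r // le_max lexx orbT.
- move=> k; have [M hM] := starrep_bounded hT (star (pol_z q k)).
  exists (Num.max 1 M) => w; rewrite -!rnormJ bdZsE /Fs; case: ifP => _.
    by rewrite rnormZ rnorm_conj u1 mul1r (le_trans (Nb _)) // ler_peMl // le_max lexx.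
  by rewrite (le_trans (hM _)) // ler_wpM2r // le_max lexx orbT.
- move=> k x y; rewrite !Jdot bdZE bdZsE /F /Fs; case: ifP => _; last exact: (qrep_adj hZ).
  by rewrite hdotZl hdotZr conjCK Nadj.
- move=> j k x jk; apply: J_inj; rewrite JZ !bdZE /F.
  have ki : k != i0 by rewrite -gt_i0 i00 (leq_ltn_trans _ jk).
  rewrite (negPf ki); case: ifP => _; last exact: (qrep_zz hZ).
  by rewrite NZ (starrepZr hT) !scalerA mulrC.
- move=> j k x jk; apply: J_inj; rewrite JZ bdZsE !bdZE bdZsE /F /Fs.
  have [ji|ji] := eqVneq j i0.
    rewrite -ji eq_sym (negPf jk) NZ (starrepZr hT) !scalerA mulrC //.
  case: ifP => _; last exact: (qrep_sz hZ).
  by rewrite (starrepZr hT) ZsN !scalerA mulrC.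
- move=> j x; apply: J_inj; rewrite JD !JZ JD JN J_sum bdZsE !bdZE bdZsE.
  under eq_bigr => k jk.
    rewrite bdZE bdZsE /F /Fs.
    have /negPf -> : k != i0 by rewrite -gt_i0 i00 (leq_ltn_trans _ jk).
    over.
  rewrite /F /Fs; case: eqP => [->|_]; last exact: (qrep_ss hZ).
  rewrite -X_on_V !NZr !NN !scalerA -[_ * u * _]mulrA [u * _]mulrC uu mulr1 scale1r.
  by rewrite -scalerDl -rcD addrC subrK scale1r.
Qed.

Definition bd_rep u := starrep_of_qrep (q := q) (bdZ u) (bdZs u).

Lemma bd_x1 u w : rnorm u = 1 ->
  bd_rep u (1 - \sum_(k < n) pol_z q k * star (pol_z q k)) w = 0.
Proof.
move=> u1; have hb := bd_qrep u1; have uu : (u^*)%R * u = 1 by rewrite mulrC -sqr_rnorm u1 expr1n.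
rewrite /bd_rep (starrep_x1 (starrep_of_qrepP hb)); apply: J_inj; rewrite J0 /qX JD JN J_sum.
rewrite (bigD1 i0) //=; under eq_bigl => k do rewrite -gt_i0.
under eq_bigr => k ik.
  rewrite (starrep_of_qrep_z hb) (starrep_of_qrep_zs hb) bdZE bdZsE /F /Fs.
  have /negPf -> : k != i0 by rewrite -gt_i0.
  over.
rewrite (starrep_of_qrep_z hb) (starrep_of_qrep_zs hb) bdZE bdZsE /F /Fs eqxx NZr NN.
by rewrite scalerA [u * _]mulrC uu scale1r X_on_V subrK subrr.
Qed.

Let S (U : set W) : set H := [set x | exists k w, U w /\ x = Zit k (J w)].

(** Stated for a general [U] because it is used twice: with an invariant subspace for
    irreducibility, and with all of [W] for density. Away from [i0] the operators do not depend on
    u, so u = 1 represents all values. *)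
Lemma level_iter_dense (U : set W) w0 : U w0 -> w0 != 0 ->
  (forall w, U w -> U (bdN w)) ->
  (forall k w, k != i0 -> U w -> U (bdZ 1 k w)) ->
  (forall k w, k != i0 -> U w -> U (bdZs 1 k w)) ->
  forall x e, 0 < e -> exists2 y, lspan (S U) y & rnorm (x - y) < e.
Proof.
move=> Uw w00 UN UZ UZs.
have JX w : X (J w) = J (bdN (bdN w)) by rewrite !bdNE NN.
apply: (irreducible_dense hT iT (x0 := J w0)).
- by exists 0%N, w0.
- by apply: contra_neq w00 => e; apply: J_inj; rewrite e J0.
- move=> i _ [k [w [Uw' ->]]]; have [->|ii] := eqVneq i i0.
    by apply: lspan_mem; exists k.+1, w.
  rewrite Z_iter // -(bdZk 1 _ ii); apply/lspan_scale/lspan_mem.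
  by exists k, (bdZ 1 i w); split=> //; exact: UZ.
- move=> i _ [k [w [Uw' ->]]]; have [->|ii] := eqVneq i i0.
    case: k => [|k]; first by rewrite /= J_in; exact: lspan0.
    rewrite Zs0_iter // JX; apply/lspan_scale/lspan_mem.
    by exists k, (bdN (bdN w)); split; first exact: (UN _ (UN _ Uw')).
  rewrite Zs_iter // -(bdZsk 1 _ ii); apply/lspan_scale/lspan_mem.
  by exists k, (bdZs 1 i w); split=> //; exact: UZs.
Qed.

Let v_in_J : exists2 w, w != 0 & J w = v.
Proof.
have : V v by exact: vac.
rewrite -JV => -[w _ e]; exists w => //.
by apply: contra_neq v0 => w0; rewrite -e w0 J0.
Qed.

(** For a nonzero invariant [U], the vectors z^k w with w in [U] span a dense subspace of [H]. An
    approximant of [J w] has the form J w' + z r with w' in [U]; as z r is orthogonal to ker z^* ,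
    w' approximates w at least as well. *)
Lemma bd_irreducible u : rnorm u = 1 -> irreducible (bd_rep u).
Proof.
move=> u1; have hb := bd_qrep u1; have hR := starrep_of_qrepP hb.
have u0 : u != 0 by apply: contra_eq_neq u1 => ->; rewrite rnorm0 eq_sym oner_eq0.
split; first by have [w w0 _] := v_in_J; exists w.
move=> U [cU U0 UD UZ] Uinv.
have UZk k w : U w -> U (bdZ u k w).
  by move=> Uw; rewrite -(starrep_of_qrep_z hb); exact: Uinv.
have UZsk k w : U w -> U (bdZs u k w).
  by move=> Uw; rewrite -(starrep_of_qrep_zs hb); exact: Uinv.
have [[w0 [Uw0 w00]]|no] := pselect (exists w, U w /\ w != 0); [right|left]; last first.
  apply/seteqP; split=> [w Uw|_ ->//]; apply/eqP/negPn/negP => w0; apply: no.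
  by exists w.
have dense := @level_iter_dense U w0 Uw0 w00.
apply/seteqP; split=> // w _; move/closedP_rnorm: cU; apply=> e e0.
have [|||y Sy wy] := dense _ _ _ (J w) e e0.
- move=> w' Uw'; have := UZ u^-1 _ (UZk i0 _ Uw').
  by rewrite bdZ0 scalerA mulVf // scale1r.
- move=> k w' ki Uw'; suff -> : bdZ 1 k w' = bdZ u k w' by exact: UZk.
  by apply: J_inj; rewrite !bdZk.
- move=> k w' ki Uw'; suff -> : bdZs 1 k w' = bdZs u k w' by exact: UZsk.
  by apply: J_inj; rewrite !bdZsk.
have [w' [Uw' [r yE]]] : exists w', U w' /\ exists r, y = J w' + Z i0 r.
  elim: Sy => [|c x' y' [k [w' [Uw' ->]]] _ [w2 [Uw2 [r ->]]]].
    by exists 0; split=> //; exists 0; rewrite (starrep0r hT) J0 addr0.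
  case: k => [|k].
    by exists (c *: w' + w2); split; [apply: UD => //; exact: UZ|exists r; rewrite JD JZ addrA].
  exists w2; split=> //; exists (c *: Zit k (J w') + r).
  by rewrite (starrepDr hT) (starrepZr hT) addrCA.
exists w' => //; apply: le_lt_trans wy.
rewrite -(@ler_pXn2r _ 2) ?nnegrE // -rnormJ JD JN yE opprD addrA.
have o : rdot (J w - J w') (Z i0 r) = 0.
  by rewrite /rdot -(qrep_adjr hZ) (starrepBr hT) !J_in subrr hdot0l.
rewrite -!rdotxx; move: (J w - J w') (Z i0 r) o => a b o.
rewrite rdotBl !rdotBr o (rdotC b) o.
by rewrite !(subr0, sub0r, opprK, rdotxx) lerDl exprn_ge0.
Qed.

(** The q-Pochhammer symbol of base q^2. The quotient of q^(2l) by [gam l] is the increment of 1/gam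
    at l. *)
Let gam k : R := \prod_(j < k) (1 - (q ^+ 2) ^+ j.+1).
Let lam l : R := (q ^+ 2) ^+ l / gam l.

Let qq_lt1 k : (q ^+ 2) ^+ k.+1 < 1.
Proof.
have h : q ^+ 2 < 1 by rewrite expr_lt1 ?q1 ?(ltW q0).
by rewrite expr_lt1 // exprn_ge0 // ltW // q0.
Qed.

Let gam_gt0 k : 0 < gam k.
Proof. by apply: prodr_gt0 => j _; rewrite subr_gt0 qq_lt1. Qed.

Let gamS k : gam k.+1 = gam k * (1 - (q ^+ 2) ^+ k.+1).
Proof. by rewrite /gam big_ord_recr. Qed.

Let lam_sum k : \sum_(l < k.+1) lam l = (gam k)^-1.
Proof.
elim: k => [|k ih]; first by rewrite big_ord1 /lam expr0 mul1r.
rewrite big_ord_recr /= ih /lam gamS; field.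
by rewrite subr_eq0 eq_sym lt_eqF ?gt_eqF ?gam_gt0 ?qq_lt1.
Qed.

Let r1 : rnorm (1 : C) = 1 := rnorm1.

Let bdN_lin : linear bdN.
Proof. by move=> a x y; apply: J_inj; rewrite Jlin !bdNE Jlin Nlin. Qed.

Let bdN_adj x y : hdot W (bdN x) y = hdot W x (bdN y).
Proof. by rewrite !Jdot !bdNE Nadj. Qed.

Let G k w := Zit k (J w).

(** Moving one z across the inner product applies [Zs0_iter]: it lowers both exponents, yields one
    factor of [gam], and leaves an X = N^2 that is shared between the two sides. *)
Let G_dot j k x y : hdot H (G j x) (G k y) =
  if j == k then (gam k)%:C * hdot W (iter k bdN x) (iter k bdN y) else 0.
Proof.
elim: j k x y => [|j ih] [|k] x y.
- by rewrite eqxx /gam big_ord0 mul1r Jdot.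
- by rewrite /G ZitS -(qrep_adjr hZ) J_in hdot0l.
- by rewrite /G ZitS (qrep_adj hZ) J_in hdot0r.
rewrite /G (ZitS j) (qrep_adj hZ) (Zs0_iter _ (J_in y)) hdotZr rc_conj.
rewrite -NN -!bdNE -/(G j x) -/(G k _) ih eqSS.
case: eqP => [<-|_]; last by rewrite mulr0.
rewrite mulrA gamS -rcM [gam j * _]mulrC; congr (_ * _).
by rewrite -!iterSr [iter j.+1 bdN x]iterS bdN_adj.
Qed.

Lemma bd_dominates m (p : 'I_m.+1 -> 'I_m.+1 -> Pol q n) c :
  (forall i k, holomorphic (pol_z q (n := n)) (p i k)) -> 0 <= c ->
  (forall u x, rnorm u = 1 ->
     rnorm (mxrep (bd_rep u) (\matrix_(i, k) p i k : starmx (Pol q n) m) x) <= c * rnorm x) ->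
  forall x, rnorm (mxrep T (\matrix_(i, k) p i k : starmx (Pol q n) m) x) <= c * rnorm x.
Proof.
move=> hp c0 hc.
apply: (@dilation_le _ _ _ _ _ (pol_z q (n := n)) i0 q T bd_rep G bdN (bdZ 1) gam _ hT
   _ _ _ _ G_dot _ _ _ _ _ _ lam) => //.
- by rewrite gt_eqF ?q0.
- by move=> u u1; exact: starrep_of_qrepP (bd_qrep u1).
- by move=> k a x y; rewrite /G Jlin; elim: k => //= k ->; rewrite (starrep_linear hT).
- by move=> i; exact: qrep_linear (bd_qrep r1) i.
- by move=> i k w ii; rewrite /G Z_iter // bdZk.
- by move=> u w u1; rewrite /bd_rep (starrep_of_qrep_z (bd_qrep u1)) bdZ0.
- move=> u i w u1 ii; rewrite /bd_rep (starrep_of_qrep_z (bd_qrep u1)).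
  by apply: J_inj; rewrite !bdZk.
- move=> i w ii; apply: J_inj; rewrite bdNE JZ !bdZk // bdNE; exact: NZ.
- move=> x e e0; have [w0 w00 _] := v_in_J.
  have [|||y Sy xy] := @level_iter_dense [set: W] w0 I w00 _ _ _ x e e0; [by []..|].
  exists y => //; elim: Sy => [|d x' y' [k [w [_ ->]]] _ ih]; first exact: lspan0.
  by apply: lspanD => //; exists k, w.
- by move=> k; rewrite gt_eqF ?gam_gt0.
- by move=> l; rewrite divr_ge0 ?(ltW (gam_gt0 _)) // exprn_ge0 // exprn_ge0 // ltW // q0.
Qed.

End BoundaryModel.

(** * The maximum principle *)

Section MaximumPrinciple.
Context {R : realType} {q : R} {n : nat}.
Hypotheses (hq : 0 < q < 1) (hn : (0 < n)%N).
Local Notation P := (Pol q n).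
Local Notation x1 := (1 - \sum_(k < n) pol_z q k * star (pol_z q k) : P).
Local Notation hol := (holomorphic (pol_z q (n := n))).

Lemma holomorphic_mx_le m (p : 'M[P]_m.+1) c : (forall i k, hol (p i k)) -> 0 <= c ->
  (forall (H : hilbertType R) (T : P -> H -> H), starrep T -> irreducible T ->
     (forall x, T x1 x = 0) ->
     forall x, rnorm (mxrep T (p : starmx P m) x) <= c * rnorm x) ->
  forall (H : hilbertType R) (T : P -> H -> H), starrep T -> irreducible T ->
    forall x, rnorm (mxrep T (p : starmx P m) x) <= c * rnorm x.
Proof.
move=> hp c0 hb H T hT iT.
have [X0|[v v0 vac]] := vacuum_exists hq (qrep_of_starrep hT).
  by apply: hb => // x; rewrite (starrep_x1 hT).
have [N [Nlin Nb Nadj NN [NZ ZsN]]] := number_operator hq hT iT v0 vac.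
pose i0 : 'I_n := Ordinal hn; have i00 : i0 = 0%N :> nat by [].
have [W [J [Jlin Jdot JV]]] := closed_subspace_hilbert (kernel_subspace hT i0).
have pE : p = \matrix_(i, k) p i k by apply/matrixP => i k; rewrite mxE.
move=> x; rewrite pE.
have := @bd_dominates _ _ _ _ _ hq hT iT i0 v N i00 v0 vac Nlin Nb Nadj NN NZ ZsN
  W J Jlin Jdot JV m p c hp c0; apply=> u w u1; rewrite -pE.
apply: hb.
- exact: starrep_of_qrepP (bd_qrep hq hT i00 Nlin Nb Nadj NN NZ ZsN Jlin Jdot JV u1).
- exact: (bd_irreducible hq hT iT i00 v0 vac Nlin Nb Nadj NN NZ ZsN Jlin Jdot JV u1).
- move=> y; exact: (bd_x1 hq hT i00 Nlin Nb Nadj NN NZ ZsN Jlin Jdot JV).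
Qed.

Lemma holomorphic_mul f g : hol f -> hol g -> hol (f * g).
Proof.
move=> + hg; elim=> [|c u w [s ->] _ ih]; first by rewrite mul0r; exact: lspan0.
rewrite mulrDl -scalerAl; apply: lspan_add => //; apply: lspan_scale.
apply: lspan_map hg => [a x y|_ [s' ->]]; first by rewrite mulrDr -scalerAr.
by apply: lspan_mem; exists (s ++ s'); rewrite /= big_cat.
Qed.

(** The elements approximable by holomorphic polynomials form a closed subalgebra containing the
    generators, so minimality applies. *)
Lemma holomorphic_dense (A : cstarAlgType R) (iota : {lrmorphism P -> A}) b :
  gen_closed_subalg (range (fun l : 'I_n => iota (pol_z q l))) b ->
  forall e, 0 < e -> exists2 f, hol f & cnorm (b - iota f) < e.
Proof.
move=> /(_ [set b | forall e, 0 < e -> exists2 f, hol f & cnorm (b - iota f) < e]); apply.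
split; last first.
  move=> _ [l _ <-] e e0; exists (pol_z q l).
    by apply: lspan_mem; exists [:: l]; rewrite big_seq1.
  by rewrite subrr (cstar_norm0 cnormP).
split.
- move=> x hx e e0; have [|y hy xy] := hx (e / 2); first by rewrite divr_gt0.
  have [|f hf yf] := hy (e / 2); first by rewrite divr_gt0.
  exists f => //; rewrite (le_lt_trans (cnorm_dist _ y _)) // (splitr e) ltrD //.
- move=> e e0; exists 1; last by rewrite rmorph1 subrr (cstar_norm0 cnormP).
  by apply: lspan_mem; exists [::]; rewrite big_nil.
- move=> x y hx hy e e0; have [|f hf xf] := hx (e / 2); first by rewrite divr_gt0.
  have [|g hg yg] := hy (e / 2); first by rewrite divr_gt0.
  exists (f + g); first exact: lspan_add.
  by rewrite rmorphD opprD addrACA (le_lt_trans (cstar_normD cnormP _ _)) // (splitr e) ltrD.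
- move=> c x hx e e0; have c1 : 0 < rnorm c + 1 by rewrite ltr_wpDl.
  have [|f hf] := hx (e / (rnorm c + 1)); first by rewrite divr_gt0.
  rewrite ltr_pdivlMr // => xf; exists (c *: f); first exact: lspan_scale.
  rewrite linearZ -scalerBr (cstar_normZ cnormP); apply: le_lt_trans xf.
  by rewrite mulrC ler_wpM2l ?(cstar_norm_ge0 cnormP) // lerDl.
- move=> x y hx hy e e0; pose K := cnorm x + cnorm y + 2.
  have x0 := cstar_norm_ge0 cnormP x; have y0 := cstar_norm_ge0 cnormP y.
  have K0 : 0 < K by rewrite /K; lra.
  (* For d <= 1 the product has error at most d |y| + (|x| + 1) d = d K - d, strictly below [e]. *)
  pose d := Num.min 1 (e / K).
  have d0 : 0 < d by rewrite lt_min ltr01 divr_gt0.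
  have d1 : d <= 1 by rewrite ge_min lexx.
  have dK : d * K <= e by rewrite -ler_pdivlMr // ge_min lexx orbT.
  have [f hf xf] := hx d d0; have [g hg yg] := hy d d0.
  exists (f * g); first exact: holomorphic_mul.
  have -> : x * y - iota (f * g) = (x - iota f) * y + iota f * (y - iota g).
    by rewrite rmorphM mulrBl mulrBr subrKA.
  have f1 : cnorm (iota f) <= cnorm x + 1.
    have := cnorm_dist (iota f) x 0; rewrite !subr0 cnormB; lra.
  have h0 := cstar_normD cnormP ((x - iota f) * y) (iota f * (y - iota g)).
  have h1 := cstar_normM cnormP (x - iota f) y.
  have h2 := cstar_normM cnormP (iota f) (y - iota g).
  have h3 : cnorm (x - iota f) * cnorm y <= d * cnorm y by rewrite ler_wpM2r // ltW.
  have h4 : cnorm (iota f) * cnorm (y - iota g) <= (cnorm x + 1) * d.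
    by rewrite ler_pM ?(cstar_norm_ge0 cnormP) // ltW.
  have : d * K = d * cnorm y + (cnorm x + 1) * d + d by rewrite /K; ring.
  lra.
Qed.

End MaximumPrinciple.

(* Reduction of the theorem to polynomial matrices *)
Local Close Scope complex_scope.

Theorem theorem1 (R : realType) (q : R) (hq : 0 < q < 1)
  (n : nat) (hn : (1 <= n)%N)
  (* C(B)_q *)
  (CB : cstarAlgType R) (iota : {lrmorphism Pol q n -> CB})
  (hCB : cstar_envelope iota)
  (* C(dB)_q = C(B)_q / J *)
  (CdB : cstarAlgType R) (jq : {lrmorphism CB -> CdB})
  (hCdB : cstar_quotient
     (gen_closed_ideal
        [set 1 - \sum_(k < n) iota (pol_z q k) * star (iota (pol_z q k))]) jq)
  (m : nat) (hm : (1 <= m)%N)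
  (NCB : 'M[CB]_m -> R) (hNCB : cstar_mxnorm NCB)
  (NCdB : 'M[CdB]_m -> R) (hNCdB : cstar_mxnorm NCdB)
  (a : 'M[CB]_m)
  (ha : forall i k,
     gen_closed_subalg (range (fun l : 'I_n => iota (pol_z q l))) (a i k)) :
  NCdB (map_mx jq a) = NCB a.
Proof.
case: m hm NCB hNCB NCdB hNCdB a ha => // m _ NCB hNCB NCdB hNCdB a ha.
have hB : cstar_norm (@GRing.scale R[i] (starmx CB m)) *%R star NCB := hNCB.
have hD : cstar_norm (@GRing.scale R[i] (starmx CdB m)) *%R star NCdB := hNCdB.
have contr := mx_quotient_contractive hCdB hB hD.
apply/eqP; rewrite eq_le contr /=.
(* Replacing [a] by a polynomial matrix costs at most [e] per entry, once in [NCB] and once in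
   [NCdB]. *)
apply: (@ler_addeps_mul _ _ _ (2 * (m.+1 * m.+1)%:R)) => e e0.
have hp i k := holomorphic_dense (ha i k) e0.
pose p : 'M[Pol q n]_m.+1 := \matrix_(i, k) projT1 (cid2 (hp i k)).
have p_hol i k : holomorphic (pol_z q (n := n)) (p i k).
  by rewrite mxE; case: (cid2 (hp i k)).
have ap i k : cnorm (a i k - iota (p i k)) < e.
  by rewrite mxE; case: (cid2 (hp i k)).
pose ip : starmx CB m := map_mx iota p.
have close : NCB ((a : starmx CB m) - ip) <= e * (m.+1 * m.+1)%:R.
  apply: le_trans (mx_cnorm_le hCB hB _) _.
  apply: (@le_trans _ _ (\sum_(i < m.+1) \sum_(k < m.+1) e)).
    apply: ler_sum => i _; apply: ler_sum => k _.
    have -> : ((a : starmx CB m) - ip) i k = a i k - iota (p i k) by rewrite !mxE.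
    exact: ltW.
  by rewrite !sumr_const !card_ord -mulrnA mulr_natr.
(* For polynomial entries it suffices to test irreducible representations that annihilate the
   generator of J, and these factor through [CdB]. *)
have key : NCB ip <= NCdB (map_mx jq ip).
  apply: (mx_envelope_le hCB hB) => [|H T hT iT x]; first exact: cstar_norm_ge0 hD _.
  apply: (holomorphic_mx_le hq hn) => // [|H' T' hT' iT' T'x1 x'].
    exact: cstar_norm_ge0 hD _.
  apply: (mx_boundary_le hCB hCdB hD) => // _ ->.
  exists (1 - \sum_(k < n) pol_z q k * star (pol_z q k)) => //.
  rewrite rmorphB rmorph1 rmorph_sum; congr (_ - _); apply: eq_bigr => k _.
  by rewrite rmorphM /= (envelope_star hCB).
have h1 := cstar_normD hB ((a : starmx CB m) - ip) ip; rewrite subrK in h1.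
have h2 : NCdB (map_mx jq ip) <= NCdB (map_mx jq a) + e * (m.+1 * m.+1)%:R.
  have -> : map_mx jq ip = (map_mx jq a : starmx CdB m) + map_mx jq (ip - (a : starmx CB m)).
    by rewrite (map_mxB jq) addrC subrK.
  apply: le_trans (cstar_normD hD _ _) _; rewrite lerD2l.
  apply: le_trans (contr _) _.
  by rewrite -(cstar_normN hB) opprB.
have -> : e * (2 * (m.+1 * m.+1)%:R) = e * (m.+1 * m.+1)%:R + e * (m.+1 * m.+1)%:R by ring.
move: (e * _) close h1 h2 key => E close h1 h2 key.
have : NCB (a : starmx CB m) <= NCB ((a : starmx CB m) - ip) + NCB ip := h1.
lra.
Qed.
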